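(* Let $\Phi\in L^\infty(\mathbb{M}_{n,n})$ satisfy $\|H_\Phi\|_{\mathrm e}<1$. Then $\Phi$ has a unitary interpolant $U$ satisfying $\|H_{U^*}\|_{\mathrm e}<1$ if and only if $\|H_\Phi\|\le 1$.
   Context: $\mathbb{T}$ is the unit circle, $\mathbb{M}_{m,n}$ the space of complex $m\times n$ matrices. $H^2(\mathbb{C}^n)$ is the vector-valued Hardy space, $H^2_-(\mathbb{C}^m)=L^2(\mathbb{C}^m)\ominus H^2(\mathbb{C}^m)$, and $\mathbb{P}_-$ is the orthogonal projection onto $H^2_-$. For $\Phi\in L^\infty(\mathbb{M}_{m,n})$ the Hankel operator $H_\Phi:H^2(\mathbb{C}^n)\to H^2_-(\mathbb{C}^m)$ is $H_\Phi f=\mathbb{P}_-\Phi f$; $\|\cdot\|_{\mathrm e}$ denotes the essential norm (distance to the compact operators). A unitary interpolant of $\Phi\in L^\infty(\mathbb{M}_{n,n})$ is a function $U\in L^\infty(\mathbb{M}_{n,n})$ whose values are unitary matrices a.e. on $\mathbb{T}$ and such that $\hat U(j)=\hat\Phi(j)$ for all $j<0$ (equivalently $\Phi-U\in H^\infty(\mathbb{M}_{n,n})$). *)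

(* Defs.v *)
From HB Require Import structures.
From mathcomp Require Import all_boot all_order all_algebra.
From mathcomp Require Import all_classical all_reals all_analysis.
From mathcomp Require Import complex.
Set Implicit Arguments. Unset Strict Implicit. Unset Printing Implicit Defensive.
Import Order.TTheory GRing.Theory Num.Theory.
Import numFieldNormedType.Exports.
Local Open Scope classical_set_scope.
Local Open Scope ring_scope.

(* The unit circle T is parametrised by t in [0,1] via t |-> exp(2 pi i t);
   normalised Lebesgue measure on T becomes Lebesgue measure on [0,1]. *)
Section Hankel.
Variable R : realType.
Local Notation C := (R[i]).
Local Notation mu := (@lebesgue_measure R).

Definition Tdom : set R := `[0%R, 1%R].

Definition cabs2 (z : C) : R := (@complex.Re R z) ^+ 2 + (@complex.Im R z) ^+ 2.

Definition cint (g : R -> C) : C :=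
  Complex (Rintegral mu Tdom (fun t => (@complex.Re R) (g t)))
          (Rintegral mu Tdom (fun t => (@complex.Im R) (g t))).

Definition cexpm (j : int) (t : R) : C :=
  Complex (cos (2 * pi * j%:~R * t)) (- sin (2 * pi * j%:~R * t)).

Definition mx_measurable m n (F : R -> 'M[C]_(m, n)) : Prop :=
  forall i j, measurable_fun Tdom (fun t => (@complex.Re R) (F t i j)) /\
              measurable_fun Tdom (fun t => (@complex.Im R) (F t i j)).

Definition vnorm2 n (v : 'cV[C]_n) : R := \sum_i cabs2 (v i 0).

Definition L2 n (f : R -> 'cV[C]_n) : Prop :=
  mx_measurable f /\ mu.-integrable Tdom (fun t => (vnorm2 (f t))%:E).

Definition l2norm n (f : R -> 'cV[C]_n) : R :=
  Num.sqrt (Rintegral mu Tdom (fun t => vnorm2 (f t))).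

Definition Linf m n (F : R -> 'M[C]_(m, n)) : Prop :=
  mx_measurable F /\
  exists M : R, {ae mu, forall t, Tdom t -> forall i j, cabs2 (F t i j) <= M}.

Definition fourier m n (F : R -> 'M[C]_(m, n)) (j : int) : 'M[C]_(m, n) :=
  \matrix_(a, b) cint (fun t => F t a b * cexpm j t).

Definition H2 n (f : R -> 'cV[C]_n) : Prop :=
  L2 f /\ forall j : int, (j < 0)%R -> fourier f j = 0.
Definition H2minus n (f : R -> 'cV[C]_n) : Prop :=
  L2 f /\ forall j : int, (0 <= j)%R -> fourier f j = 0.

(* h = P_- g  (orthogonal projection of L^2 onto H^2_-) *)
Definition Pminus n (g h : R -> 'cV[C]_n) : Prop :=
  H2minus h /\ H2 (fun t => g t - h t).

Definition hankel m n (Phi : R -> 'M[C]_(m, n)) (f : R -> 'cV[C]_n)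
  (h : R -> 'cV[C]_m) : Prop := Pminus (fun t => Phi t *m f t) h.

(* compact operators H^2(C^n) -> H^2_-(C^m): linear maps sending the unit
   ball of H^2(C^n) into a totally bounded subset of H^2_-(C^m) *)
Definition compact_op m n (K : (R -> 'cV[C]_n) -> (R -> 'cV[C]_m)) : Prop :=
  (forall f, H2 f -> H2minus (K f)) /\
  (forall (a : C) f g, H2 f -> H2 g ->
     K (fun t => a *: f t + g t) = (fun t => a *: K f t + K g t)) /\
  (forall e : R, 0 < e -> exists s : seq (R -> 'cV[C]_m),
     (forall g, g \in s -> L2 g) /\
     forall f, H2 f -> l2norm f <= 1 ->
       exists2 g, g \in s & l2norm (fun t => K f t - g t) < e).

Definition hankel_minus_norm m n (Phi : R -> 'M[C]_(m, n))
  (K : (R -> 'cV[C]_n) -> (R -> 'cV[C]_m)) : \bar R :=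
  ereal_sup [set x | exists f h, [/\ H2 f, l2norm f <= 1, hankel Phi f h &
                       x = (l2norm (fun t => h t - K f t))%:E]].

Definition hankel_norm m n (Phi : R -> 'M[C]_(m, n)) : \bar R :=
  hankel_minus_norm Phi (fun _ _ => 0).

Definition hankel_ess_norm m n (Phi : R -> 'M[C]_(m, n)) : \bar R :=
  ereal_inf [set x | exists K, compact_op K /\ x = hankel_minus_norm Phi K].

Definition adjmx m n (A : 'M[C]_(m, n)) : 'M[C]_(n, m) := (map_mx conjc A)^T.

Definition adjfun m n (U : R -> 'M[C]_(m, n)) : R -> 'M[C]_(n, m) :=
  fun t => adjmx (U t).

Definition unitary_interpolant n (Phi U : R -> 'M[C]_n) : Prop :=
  [/\ Linf U,
      {ae mu, forall t, Tdom t -> adjmx (U t) *m U t = 1%:M} &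
      forall j : int, (j < 0)%R -> fourier U j = fourier Phi j].

End Hankel.

(* Main.v *)
(** The Hankel operator [Gamma f = P_- (Phi f)] is a contraction iff the form of
    [1 + Gamma + Gamma^*] on [L^2 = H^2_- + H^2] is positive; call it [a].  Since the
    essential norm of [Gamma] is less than 1, [a] is coercive on a subspace of finite
    codimension, so [a] is complete on closed subspaces although it may degenerate.
    Multiplication by [z], restricted to the functions whose coefficient of index [-1]
    vanishes, is [a]-isometric.  Both its domain and its range have codimension [n], and a
    rank count on the null space of [a] shows that it extends to an [a]-isometric bijection
    [W].  The map [z^m e_i |-> W^(m+1) (z^(-1) e_i)] then identifies [L^2] with the
    completion of [a], fixing [H^2_-] and intertwining [z] with [W].  The preimages [u_i] of
    the constant vectors [e_i] are the columns of the interpolant [U]: on the nonnegative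
    side [a] is the inner product, so the [u_i] are pointwise orthonormal by uniqueness of
    Fourier coefficients, and their negative coefficients are those of [Phi].  Coercivity
    modulo the null space bounds [P_+ (U^* f)] below for [f] in [H^2], whence the
    norm of the Hankel operator of [U^*] is less than 1.

    Conversely, if [Phi - U] is analytic, then [P_- (Phi f) = P_- (U f)] for [f] in [H^2]. *)
Require Import Defs.
From HB Require Import structures.
From mathcomp Require Import all_boot all_order all_fingroup all_algebra.
From mathcomp Require Import all_classical all_reals all_analysis.
From mathcomp Require Import measurable_realfun complex.
From mathcomp Require Import ring lra zify.
Set Implicit Arguments. Unset Strict Implicit. Unset Printing Implicit Defensive.
Import Order.TTheory GRing.Theory Num.Theory.
Import numFieldNormedType.Exports.
Local Open Scope classical_set_scope.
Local Open Scope ring_scope.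

(** * Semi-inner product spaces *)

Section Quarter.
Variable R : realType.

Definition quarter (k : nat) : R := 4^-1 ^+ k.

Lemma quarter_gt0 k : 0 < quarter k.
Proof. by rewrite exprn_gt0// invr_gt0. Qed.

Lemma quarterS k : quarter k.+1 = quarter k / 4.
Proof. by rewrite /quarter exprS mulrC. Qed.

Lemma exists_mul_quarter_le (C e : R) : 0 < e -> exists k, C * quarter k <= e.
Proof.
move=> e0; exists (Num.bound (C / e)).
rewrite /quarter exprVn ler_pdivrMr ?exprn_gt0// mulrC -ler_pdivrMr//.
apply: le_trans (ltW (upper_nthrootP (leqnn _))) _.
by rewrite lerXn2r ?nnegrE// ler_nat.
Qed.

Lemma eq0_of_sqr_le_quarter (C x : R) :
  (forall k, x ^+ 2 <= C * quarter k) -> x = 0.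
Proof.
move=> xC; apply/eqP; rewrite -sqrf_eq0; apply/eqP/le_anti.
rewrite sqr_ge0 andbT leNgt; apply/negP => x_gt0.
have [|k kC] := @exists_mul_quarter_le C (x ^+ 2 / 2); first by rewrite divr_gt0.
by have := xC k; lra.
Qed.

End Quarter.

Notation normsq b x := (b x x) (only parsing).

Section SemiInner.
Variables (R : realType) (V : lmodType R[i]).
Local Notation C := (R[i]).
Local Open Scope complex_scope.

(* The real part of a positive semidefinite sesquilinear form. *)
Record semi_inner (b : V -> V -> R) : Prop := SemiInner {
  siDl : forall x y z, b (x + y) z = b x z + b y z;
  siC : forall x y, b x y = b y x;
  siZl : forall (r : R) x y, b (r%:C *: x) y = r * b x y;
  siJ : forall x y, b ('i *: x) ('i *: y) = b x y;
  si_ge0 : forall x, 0 <= normsq b x }.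

Definition cform (b : V -> V -> R) (x y : V) : C := Complex (b x y) (b x ('i *: y)).

Definition null_eqv (b : V -> V -> R) (x y : V) := normsq b (x - y) = 0.

Definition real_subspace (G : V -> Prop) :=
  G 0 /\ forall (r : R) x y, G x -> G y -> G (r%:C *: x + y).

Lemma real_subspaceB G x y : real_subspace G -> G x -> G y -> G (x - y).
Proof.
move=> [_ GS] Gx Gy; have := GS (-1) y x Gy Gx.
by rewrite rmorphN1 scaleN1r addrC.
Qed.

Lemma real_subspaceD G x y : real_subspace G -> G x -> G y -> G (x + y).
Proof. by move=> [_ GS] Gx Gy; have := GS 1 x y Gx Gy; rewrite scale1r. Qed.

Definition bounded_functional (b : V -> V -> R) (phi : V -> R) :=
  (forall (r : R) x y, phi (r%:C *: x + y) = r * phi x + phi y) /\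
  exists2 L, 0 <= L & forall x, phi x ^+ 2 <= L * normsq b x.

(* Convergence at a geometric rate: every Cauchy sequence has such a subsequence, so
   completeness may be tested at this rate only. *)
Definition fast_cauchy (b : V -> V -> R) (u : nat -> V) :=
  exists K, forall k, normsq b (u k.+1 - u k) <= K * quarter R k.

Definition fast_cvg (b : V -> V -> R) (u : nat -> V) (x : V) :=
  exists K, forall k, normsq b (x - u k) <= K * quarter R k.

Definition complete_for (b : V -> V -> R) (G : V -> Prop) :=
  forall u, (forall k, G (u k)) -> fast_cauchy b u -> exists2 x, G x & fast_cvg b u x.

Definition adherent (b : V -> V -> R) (S : V -> Prop) (x : V) :=
  exists2 u, (forall k, S (u k)) & fast_cvg b u x.

Section Form.
Variable b : V -> V -> R.
Hypothesis bP : semi_inner b.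

Lemma siDr x y z : b x (y + z) = b x y + b x z.
Proof. by rewrite siC// siDl// !(siC bP x). Qed.

Lemma siZr (r : R) x y : b x (r%:C *: y) = r * b x y.
Proof. by rewrite siC// siZl// (siC bP x). Qed.

Lemma si0l x : b 0 x = 0.
Proof. by have := siZl bP 0 0 x; rewrite mul0r scaler0. Qed.

Lemma si0r x : b x 0 = 0. Proof. by rewrite siC// si0l. Qed.

Lemma siNl x y : b (- x) y = - b x y.
Proof. by apply/eqP; rewrite -addr_eq0 -siDl// addNr si0l. Qed.

Lemma siNr x y : b x (- y) = - b x y.
Proof. by rewrite siC// siNl siC. Qed.

Lemma siBl x y z : b (x - y) z = b x z - b y z.
Proof. by rewrite siDl// siNl. Qed.

Lemma siBr x y z : b x (y - z) = b x y - b x z.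
Proof. by rewrite siDr siNr. Qed.

Lemma siJr x y : b x ('i *: y) = - b ('i *: x) y.
Proof.
by rewrite -[in LHS](siJ bP) scalerA -expr2 sqr_i scaleN1r siNr.
Qed.

Lemma normsqZ (r : R) x : normsq b (r%:C *: x) = r ^+ 2 * normsq b x.
Proof. by rewrite (siZl bP) siZr mulrA. Qed.

(* Normalizing by a slightly larger constant than the norm covers null vectors as well. *)
Lemma le_normsq_of_unit_ball (H : V -> Prop) (G : V -> R) (c : R) :
  (forall (r : R) x, H x -> H (r%:C *: x)) ->
  (forall (r : R) x, H x -> G (r%:C *: x) = r ^+ 2 * G x) ->
  (forall x, H x -> normsq b x <= 1 -> G x <= c) -> forall x, H x -> G x <= c * normsq b x.
Proof.
move=> HZ GZ Gc x Hx; have x0 := si_ge0 bP x.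
have c0 : 0 <= c.
  have := Gc _ (HZ 0 x Hx); rewrite normsqZ GZ// expr0n !mul0r.
  exact.
apply/ler_addgt0Pr => d d0; pose N := normsq b x + d / (c + 1).
have N0 : 0 < N by rewrite ltr_wpDl// divr_gt0//; lra.
have NK : (Num.sqrt N)^-1 ^+ 2 = N^-1 by rewrite exprVn sqr_sqrtr// ltW.
have := Gc _ (HZ (Num.sqrt N)^-1 x Hx); rewrite normsqZ GZ// NK.
rewrite !(mulrC N^-1) !ler_pdivrMr// mul1r => G_le.
apply: le_trans (G_le _) _; first by rewrite lerDl divr_ge0//; lra.
rewrite /N mulrDr lerD2l mulrA ler_pdivrMr//; last by lra.
by rewrite mulrC ler_pM2l//; lra.
Qed.

Lemma normsq_distC x y : normsq b (x - y) = normsq b (y - x).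
Proof. by rewrite -[x - y]opprB siNl siNr opprK. Qed.

Lemma normsqD_le x y : normsq b (x + y) <= 2 * normsq b x + 2 * normsq b y.
Proof.
have := si_ge0 bP (x - y).
by rewrite !(siDl bP) !siDr !siNl !siNr (siC bP y x); lra.
Qed.

Lemma normsqD_le_weighted (t : R) x y : 0 < t < 1 ->
  normsq b (x + y) <= t^-1 * normsq b x + (1 - t)^-1 * normsq b y.
Proof.
move=> /andP[t0 t1]; have tn0 : t != 0 by lra.
have t1n0 : 1 - t != 0 by lra.
have := si_ge0 bP ((1 - t)%:C *: x - t%:C *: y).
rewrite !(siBl, siBr) !(siZl bP, siZr) !(siDl bP, siDr) (siC bP y x) => diff_ge0.
have tt_gt0 : 0 < t * (1 - t) by rewrite mulr_gt0//; lra.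
rewrite -(ler_pM2l tt_gt0).
have -> : t * (1 - t) * (t^-1 * b x x + (1 - t)^-1 * b y y) = (1 - t) * b x x + t * b y y.
  by field; apply/andP.
by lra.
Qed.

Lemma normsqB_le x y : normsq b (x - y) <= 2 * normsq b x + 2 * normsq b y.
Proof. by have := normsqD_le x (- y); rewrite siNl siNr opprK. Qed.

Lemma normsq_dist_le y x z :
  normsq b (x - z) <= 2 * normsq b (x - y) + 2 * normsq b (y - z).
Proof. by have := normsqD_le (x - y) (y - z); rewrite addrA subrK. Qed.

Lemma apollonius x y z :
  normsq b (y - z) =
  2 * normsq b (x - y) + 2 * normsq b (x - z) - 4 * normsq b (x - (2^-1)%:C *: (y + z)).
Proof.
rewrite !(siBl, siBr) !(siZl bP, siZr) !(siDl bP, siDr).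
by rewrite (siC bP z y) (siC bP y x) (siC bP z x); field.
Qed.

Lemma si_orthD u v u' v' : b v u' = 0 -> b v' u = 0 ->
  b (u + v) (u' + v') = b u u' + b v v'.
Proof.
by move=> vu' v'u; rewrite (siDl bP) !siDr vu' (siC bP u v') v'u addr0 add0r.
Qed.

Lemma cauchy_schwarz x y : b x y ^+ 2 <= normsq b x * normsq b y.
Proof.
have y_ge0 := si_ge0 bP y; have x_ge0 := si_ge0 bP x.
have quadratic_ge0 t : 0 <= b x x + 2 * t * b x y + t ^+ 2 * b y y.
  have := si_ge0 bP (x + t%:C *: y).
  by rewrite !(siDl bP) !siDr !(siZl bP) !siZr (siC bP y x); lra.
have [y0|yn0] := eqVneq (b y y) 0.
  rewrite y0 mulr0; have [->|xyn0] := eqVneq (b x y) 0; first by rewrite expr0n.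
  have := quadratic_ge0 (- (b x x + 1) / (2 * b x y)); rewrite y0.
  have -> : 2 * (- (b x x + 1) / (2 * b x y)) * b x y = - (b x x + 1) by field.
  by lra.
have y_gt0 : 0 < b y y by rewrite lt_def yn0.
have := quadratic_ge0 (- b x y / b y y).
have -> : b x x + 2 * (- b x y / b y y) * b x y + (- b x y / b y y) ^+ 2 * b y y
   = (b x x * b y y - b x y ^+ 2) / b y y by field.
by rewrite pmulr_lge0 ?invr_gt0// subr_ge0.
Qed.

Lemma le_mul_normsq_of_dual (X K : R) v g : 0 <= X -> 0 <= K ->
  X = b v g -> normsq b g <= K * X -> X <= K * normsq b v.
Proof.
move=> X0 K0 XE g_le; have [->|Xn0] := eqVneq X 0; first by rewrite mulr_ge0// si_ge0.
have X_gt0 : 0 < X by rewrite lt_def Xn0.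
rewrite -(ler_pM2r X_gt0) -mulrAC -expr2 {1}XE; apply: le_trans (cauchy_schwarz _ _) _.
by rewrite mulrC; apply: ler_wpM2r => //; exact: si_ge0.
Qed.

Lemma normsq_eq0P x : normsq b x <= 0 -> normsq b x = 0.
Proof. by move=> x_le0; apply/le_anti; rewrite x_le0 si_ge0. Qed.

Lemma si_null x y : normsq b x = 0 -> b x y = 0.
Proof.
move=> x0; apply/eqP; rewrite -sqrf_eq0; apply/eqP/le_anti.
by rewrite sqr_ge0 andbT; have := cauchy_schwarz x y; rewrite x0 mul0r.
Qed.

Lemma normsq_null_add x y : normsq b x = 0 -> normsq b y = 0 -> normsq b (x + y) = 0.
Proof. by move=> x0 y0; rewrite (siDl bP) !(si_null _ x0) (si_null _ y0) addr0. Qed.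

Lemma null_eqv_trans y x z : null_eqv b x y -> null_eqv b y z -> null_eqv b x z.
Proof. by move=> xy yz; rewrite /null_eqv -(subrK y x) -addrA; exact: normsq_null_add. Qed.

Lemma null_eqv_sil x x' y : null_eqv b x x' -> b x y = b x' y.
Proof. by move=> xx'; apply/eqP; rewrite -subr_eq0 -siBl si_null. Qed.

Lemma null_eqv_sir x y y' : null_eqv b y y' -> b x y = b x y'.
Proof. by move=> yy'; rewrite !(siC bP x); exact: null_eqv_sil. Qed.

Lemma null_eqv_normsq x x' : null_eqv b x x' -> normsq b x = normsq b x'.
Proof. by move=> xx'; rewrite (null_eqv_sil _ xx') (null_eqv_sir _ xx'). Qed.

Lemma cform_eq0 x y : cform b x y = 0 <-> b x y = 0 /\ b x ('i *: y) = 0.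
Proof. by rewrite /cform; split=> [[-> ->]|[-> ->]]. Qed.

Lemma cform_null x y : normsq b x = 0 -> cform b x y = 0.
Proof. by move=> x0; apply/cform_eq0; rewrite !(si_null _ x0). Qed.

Lemma null_eqv_cforml x x' y : null_eqv b x x' -> cform b x y = cform b x' y.
Proof. by move=> xx'; rewrite /cform !(null_eqv_sil _ xx'). Qed.

Lemma cformDl x y z : cform b (x + y) z = cform b x z + cform b y z.
Proof. by rewrite /cform !(siDl bP). Qed.

Lemma cformZl (c : C) x y : cform b (c *: x) y = c * cform b x y.
Proof.
case: c => r s; have cE : r +i* s = r%:C + s%:C * 'i by simpc.
have -> : (r +i* s) *: x = r%:C *: x + s%:C *: ('i *: x).
  by rewrite scalerA -scalerDl cE.
rewrite /cform !(siDl bP) !(siZl bP) (siJ bP) -[b ('i *: x) y]opprK -siJr.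
by apply/eqP; rewrite eq_complex /=; apply/andP; split; apply/eqP; ring.
Qed.

Lemma cformC x y : cform b y x = (cform b x y)^*.
Proof. by rewrite /cform /= siJr !(siC bP x). Qed.

Lemma cformDr x y z : cform b x (y + z) = cform b x y + cform b x z.
Proof. by rewrite /cform scalerDr !siDr. Qed.

Lemma cformZr (c : C) x y : cform b x (c *: y) = c^* * cform b x y.
Proof. by rewrite (cformC (c *: y)) cformZl (cformC y) [LHS]rmorphM. Qed.

Lemma cformxx x : cform b x x = (normsq b x)%:C.
Proof. by have := cformC x x; rewrite /cform => -[xJ]; congr Complex; lra. Qed.

Lemma cform_suml (I : Type) (r : seq I) (P : pred I) (c : I -> C) (v : I -> V) x :
  cform b (\sum_(i <- r | P i) c i *: v i) x
  = \sum_(i <- r | P i) c i * cform b (v i) x.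
Proof.
elim/big_rec2: _ => [|i y1 y2 _ IH]; first by rewrite /cform !si0l.
by rewrite cformDl cformZl IH.
Qed.

Lemma cform_sumr (I : Type) (r : seq I) (P : pred I) (c : I -> C) (v : I -> V) x :
  cform b x (\sum_(i <- r | P i) c i *: v i)
  = \sum_(i <- r | P i) (c i)^* * cform b x (v i).
Proof.
rewrite cformC cform_suml rmorph_sum; apply: eq_bigr => i _.
by rewrite (cformC (v i)) [LHS]rmorphM.
Qed.

Lemma bounded_functional_form y : bounded_functional b (b^~ y).
Proof.
split=> [r x x'|]; first by rewrite (siDl bP) (siZl bP).
by exists (normsq b y) => [|x]; [exact: si_ge0|rewrite mulrC cauchy_schwarz].
Qed.

Lemma bounded_functionalB phi x y : bounded_functional b phi -> phi (x - y) = phi x - phi y.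
Proof.
move=> [phiL _]; have := phiL (-1) y x.
by rewrite rmorphN1 scaleN1r addrC => ->; rewrite mulN1r addrC.
Qed.

Lemma fast_cvg_ge0 u x : fast_cvg b u x ->
  exists2 K, 0 <= K & forall k, normsq b (x - u k) <= K * quarter R k.
Proof.
move=> [K xK]; exists K => //; have := xK 0%N.
by rewrite /quarter expr0 mulr1; apply: le_trans; exact: si_ge0.
Qed.

Lemma fast_cvg_cst x : fast_cvg b (fun=> x) x.
Proof. by exists 0 => k; rewrite subrr si0l mul0r. Qed.

Lemma fast_cvg_cauchy u x : fast_cvg b u x -> fast_cauchy b u.
Proof.
move=> /fast_cvg_ge0[K K0 xK]; exists (4 * K) => k.
apply: le_trans (normsq_dist_le x _ _) _; rewrite (normsq_distC _ x).
by have := xK k; have := xK k.+1; have := quarter_gt0 R k; rewrite quarterS; nra.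
Qed.

Lemma fast_cvg_lin (r : R) u x v y : fast_cvg b u x -> fast_cvg b v y ->
  fast_cvg b (fun k => r%:C *: u k + v k) (r%:C *: x + y).
Proof.
move=> [K xK] [L yL]; exists (2 * (r ^+ 2 * K) + 2 * L) => k.
rewrite opprD addrACA -scalerBr; apply: le_trans (normsqD_le _ _) _.
have := ler_wpM2l (sqr_ge0 r) (xK k); have := yL k.
by rewrite normsqZ mulrA; lra.
Qed.

Lemma fast_cvg_congr u v x : (forall k, null_eqv b (u k) (v k)) ->
  fast_cvg b u x -> fast_cvg b v x.
Proof.
move=> uv [K xK]; exists K => k; rewrite -(@null_eqv_normsq (x - u k)) => [|]; first exact: xK.
rewrite /null_eqv opprB addrC addrA subrK normsq_distC; exact: uv.
Qed.

Lemma fast_cvg_functional u x phi : fast_cvg b u x -> bounded_functional b phi ->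
  exists K, forall k, (phi x - phi (u k)) ^+ 2 <= K * quarter R k.
Proof.
move=> [K xK] phiP; have [_ [L L0 phiB]] := phiP; exists (L * K) => k.
rewrite -bounded_functionalB//; apply: le_trans (phiB _) _; rewrite -mulrA.
exact: ler_wpM2l.
Qed.

Lemma fast_cvg_functional_eq0 u x phi : fast_cvg b u x -> bounded_functional b phi ->
  (exists K, forall k, phi (u k) ^+ 2 <= K * quarter R k) -> phi x = 0.
Proof.
move=> ux phiP [K uK]; have [L xL] := fast_cvg_functional ux phiP.
apply: (@eq0_of_sqr_le_quarter _ (2 * L + 2 * K)) => k.
have := xL k; have := uK k; have := sqr_ge0 (phi x - 2 * phi (u k)).
by rewrite !expr2; lra.
Qed.

Lemma fast_cvg_form u x v y : fast_cvg b u x -> fast_cvg b v y ->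
  exists K, forall k, (b x y - b (u k) (v k)) ^+ 2 <= K * quarter R k.
Proof.
move=> ux vy; have [K xK] := fast_cvg_functional ux (bounded_functional_form y).
have [M M0 yM] := fast_cvg_ge0 vy; have [L L0 xL] := fast_cvg_ge0 ux.
exists (2 * K + 2 * ((2 * normsq b x + 2 * L) * M)) => k.
have q_gt0 := quarter_gt0 R k; have q_le1 : quarter R k <= 1.
  by rewrite exprn_ile1// ?invr_ge0// invf_le1// ler1n.
have u_le : normsq b (u k) <= 2 * normsq b x + 2 * L.
  have := normsqB_le x (x - u k); rewrite subKr => /le_trans; apply.
  by rewrite lerD2l ler_pM2l//; apply: le_trans (xL k) _; exact: ler_piMr.
have uv : b (u k) (y - v k) ^+ 2 <= (2 * normsq b x + 2 * L) * M * quarter R k.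
  apply: le_trans (cauchy_schwarz _ _) _; rewrite -mulrA.
  by apply: ler_pM (yM k); rewrite ?si_ge0.
have -> : b x y - b (u k) (v k) = (b x y - b (u k) y) + b (u k) (y - v k).
  by rewrite siBr addrA subrK.
have := sqr_ge0 ((b x y - b (u k) y) - b (u k) (y - v k)); have := xK k.
by move: uv; rewrite !expr2; lra.
Qed.

Lemma complete_kernel G (I : Type) (S : I -> Prop) (phi : I -> V -> R) : complete_for b G ->
  (forall i, bounded_functional b (phi i)) ->
  complete_for b (fun x => G x /\ forall i, S i -> phi i x = 0).
Proof.
move=> Gc phiP u Gu u_cauchy; have [x Gx ux] := Gc u (fun k => (Gu k).1) u_cauchy.
exists x => //; split=> // i Si; apply: fast_cvg_functional_eq0 ux (phiP i) _.
by exists 0 => k; rewrite (Gu k).2// expr0n mul0r.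
Qed.

Lemma real_subspace_kernel G (I : Type) (S : I -> Prop) (phi : I -> V -> R) :
  real_subspace G -> (forall i, bounded_functional b (phi i)) ->
  real_subspace (fun x => G x /\ forall i, S i -> phi i x = 0).
Proof.
move=> [G0 GS] phiP; split=> [|r x y [Gx phix] [Gy phiy]].
  by split=> // i _; have := bounded_functionalB 0 0 (phiP i); rewrite !subrr.
split=> [|i Si]; first exact: GS.
by case: (phiP i) => -> _; rewrite phix// phiy// mulr0 addr0.
Qed.

Lemma almost_minimal_almost_orthogonal x (d e : R) g :
  (forall t : R, d <= normsq b (x - t%:C *: g)) ->
  normsq b x <= d + e -> b x g ^+ 2 <= e * normsq b g.
Proof.
move=> d_le x_le; have e0 : 0 <= e.
  by have := d_le 0; rewrite scale0r subr0; lra.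
have [g0|gn0] := eqVneq (b g g) 0.
  by rewrite (siC bP) (si_null x g0) g0 mulr0 expr0n.
have g_gt0 : 0 < b g g by rewrite lt_def gn0 si_ge0.
have := d_le (b x g / b g g).
rewrite !siBl !siBr !(siZl bP) !siZr (siC bP g x).
have -> : b x x - b x g / b g g * b x g
  - (b x g / b g g * b x g - b x g / b g g * (b x g / b g g * b g g))
  = b x x - b x g ^+ 2 / b g g by field.
by move=> d_le'; rewrite -ler_pdivrMr//; lra.
Qed.

Lemma minimizing_sequence (G : V -> Prop) x : G 0 -> exists d (u : nat -> V),
  [/\ forall g, G g -> d <= normsq b (x - g), forall k, G (u k) &
      forall k, normsq b (x - u k) <= d + quarter R k].
Proof.
move=> G0; pose S : set R := [set r | exists2 g, G g & r = normsq b (x - g)]%classic.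
have S_inf : has_inf S.
  split; first by exists (normsq b (x - 0)), 0.
  by exists 0 => _ [g _ ->]; exact: si_ge0.
have /choice[u uP] : forall k, exists v, G v /\ normsq b (x - v) <= inf S + quarter R k.
  move=> k.
  by have [_ [g Gg ->] /ltW] := inf_adherent (quarter_gt0 R k) S_inf; exists g.
exists (inf S), u; split=> [g Gg|k|k]; [|by case: (uP k)..].
by apply: ge_inf; [case: S_inf|exists g].
Qed.

Theorem projection (G : V -> Prop) x : real_subspace G -> complete_for b G ->
  exists2 g, G g & forall g', G g' -> b (x - g) g' = 0.
Proof.
move=> GG Gc; have [G0 GS] := GG.
have [d [u [d_le Gu u_le]]] := minimizing_sequence x G0.
have [|g Gg ug] := Gc u Gu.
  exists 4 => k; rewrite (apollonius x).
  have := d_le ((2^-1)%:C *: (u k.+1 + u k)); rewrite -[_ *: _]addr0.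
  move=> /(_ (GS _ _ _ (real_subspaceD GG (Gu _) (Gu _)) G0)); rewrite addr0.
  by have := u_le k; have := u_le k.+1; rewrite quarterS; have := quarter_gt0 R k; lra.
exists g => // g' Gg'.
have xug : fast_cvg b (fun k => x - u k) (x - g).
  have := fast_cvg_lin (-1) ug (fast_cvg_cst x).
  by rewrite rmorphN1 /= scaleN1r addrC; under eq_fun do rewrite scaleN1r addrC.
apply: (fast_cvg_functional_eq0 xug (bounded_functional_form g')).
exists (normsq b g') => k; rewrite mulrC.
apply: (@almost_minimal_almost_orthogonal _ d) => // t.
by rewrite -addrA -opprD; apply: d_le; rewrite addrC; exact: GS.
Qed.

Lemma adherent_approx S x (e : R) : adherent b S x -> 0 < e ->
  exists2 s, S s & normsq b (x - s) <= e.
Proof.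
move=> [u Su [K xK]] /(exists_mul_quarter_le K)[k kK].
by exists (u k) => //; exact: le_trans (xK k) kK.
Qed.

Lemma subset_adherent S x : S x -> adherent b S x.
Proof. by move=> Sx; exists (fun=> x) => //; exact: fast_cvg_cst. Qed.

Lemma real_subspace_adherent S : real_subspace S -> real_subspace (adherent b S).
Proof.
move=> [S0 SS]; split=> [|r x y [u Su ux] [v Sv vy]]; first exact: subset_adherent.
by exists (fun k => r%:C *: u k + v k) => [k|]; [exact: SS|exact: fast_cvg_lin].
Qed.

Lemma complete_adherent S : complete_for b (fun=> True) -> complete_for b (adherent b S).
Proof.
move=> bc u Su u_cauchy; have [x _ ux] := bc u (fun=> I) u_cauchy; exists x => //.
have /choice[v vP] : forall k, exists s, S s /\ normsq b (u k - s) <= quarter R k.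
  by move=> k; have [s Ss us] := adherent_approx (Su k) (quarter_gt0 R k); exists s.
have [K xK] := ux; exists v => [k|]; first by case: (vP k).
exists (2 * K + 2) => k; apply: le_trans (normsq_dist_le (u k) _ _) _.
by rewrite [leRHS]mulrDl -mulrA lerD// ler_pM2l//; case: (vP k).
Qed.

(* The closure of [S] is complete, so [x] projects onto it. *)
Lemma adherent_of_orthogonal S x : real_subspace S -> complete_for b (fun=> True) ->
  (forall y, (forall s, S s -> b y s = 0) -> normsq b y = 0) -> adherent b S x.
Proof.
move=> SS bc S_total.
have [g Sg xg] := projection x (real_subspace_adherent SS) (complete_adherent (S := S) bc).
have xg0 : null_eqv b x g.
  by apply: S_total => s Ss; apply: xg; exact: subset_adherent.
have [u Su [K gK]] := Sg; exists u => //; exists (2 * K) => k.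
apply: le_trans (normsq_dist_le g _ _) _; rewrite xg0 mulr0 add0r -mulrA.
by rewrite ler_pM2l.
Qed.

End Form.
End SemiInner.

(** * Pairs of forms *)

Section Tame.
Variables (R : realType) (V : lmodType R[i]) (b a : V -> V -> R) (M : R).
Local Open Scope complex_scope.
Hypotheses (bP : semi_inner b) (aP : semi_inner a).
Hypothesis a_le : forall x, normsq a x <= M * normsq b x.

(* Modulo null vectors of [a], the form [b] is controlled by [a] on [H]. *)
Definition tame (H : V -> Prop) := exists2 K, 0 <= K &
  forall x, H x -> exists x', [/\ H x', null_eqv a x x' & normsq b x' <= K * normsq a x].

Lemma fast_cvg_dominated u x : fast_cvg b u x -> fast_cvg a u x.
Proof.
move=> [K xK]; exists (Num.max M 0 * K) => k; rewrite -mulrA.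
apply: le_trans (a_le _) (le_trans _ (ler_wpM2l _ (xK k))).
  by apply: ler_wpM2r; rewrite ?(si_ge0 bP) ?le_max ?lexx.
by rewrite le_max lexx orbT.
Qed.

(* Replacing the steps of an [a]-Cauchy sequence by their [b]-controlled representatives
   gives a [b]-Cauchy sequence with the same [a]-limit. *)
Lemma tame_complete H : real_subspace H -> complete_for b H -> tame H -> complete_for a H.
Proof.
move=> HH Hc [K K0 KP] u Hu [L uL].
have [y yP] := choice (fun k => KP _ (real_subspaceB HH (Hu k.+1) (Hu k))).
pose v k := u 0%N + \sum_(i < k) y i.
have vS k : v k.+1 = v k + y k by rewrite /v big_ord_recr /= addrA.
have Hv k : H (v k).
  elim: k => [|k IH]; first by rewrite /v big_ord0 addr0.
  by rewrite vS; apply: real_subspaceD => //; case: (yP k).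
have [|x Hx vx] := Hc v Hv.
  exists (K * L) => k; rewrite vS addrC addKr -mulrA; case: (yP k) => _ _ /le_trans; apply.
  exact: ler_wpM2l.
exists x => //; apply: (fast_cvg_congr aP) (fast_cvg_dominated vx) => k.
elim: k => [|k IH]; first by rewrite /null_eqv /v big_ord0 addr0 subrr (si0l aP).
have -> : null_eqv a (v k.+1) (u k.+1) =
    (normsq a ((v k - u k) + (y k - (u k.+1 - u k))) = 0).
  by rewrite /null_eqv vS [in RHS]addrACA -opprD [u k + _]addrC subrK.
apply: (normsq_null_add aP) => //; rewrite (normsq_distC aP); by case: (yP k).
Qed.

Lemma tame_extend H G w : real_subspace H -> (forall y, G y -> H y) -> H w ->
  (forall x, H x -> exists y (c : R), G y /\ x = y + c%:C *: w) ->
  (forall y, G y -> a w y = 0) -> tame G -> tame H.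
Proof.
move=> [_ HS] GH Hw decomp wG [K K0 KP]; pose B := normsq b w / normsq a w.
have B0 : 0 <= B by rewrite divr_ge0 ?(si_ge0 bP) ?(si_ge0 aP).
exists (2 * K + 2 * B) => [|x /decomp[y [c [Gy ->]]]]; first by lra.
have [y' [Gy' yy' y'_le]] := KP y Gy; have y_ge0 := si_ge0 aP y.
have [w0|wn0] := eqVneq (normsq a w) 0.
  have yw : null_eqv a (y + c%:C *: w) y.
    by rewrite /null_eqv addrAC subrr add0r (normsqZ aP) w0 mulr0.
  exists y'; split; [exact: GH|exact: null_eqv_trans yw yy'|].
  rewrite (null_eqv_normsq aP yw); apply: le_trans y'_le _.
  by apply: ler_wpM2r => //; lra.
have w_gt0 : 0 < normsq a w by rewrite lt_def wn0 (si_ge0 aP).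
exists (y' + c%:C *: w); split.
- by rewrite addrC; apply: HS => //; exact: GH.
- by rewrite /null_eqv opprD addrACA subrr addr0.
have wy : a (c%:C *: w) y = 0 by rewrite (siZl aP) wG// mulr0.
rewrite (si_orthD aP wy wy) (normsqZ aP).
apply: le_trans (normsqD_le bP _ _) _; rewrite (normsqZ bP).
have -> : normsq b w = B * normsq a w by rewrite /B divfK.
have := mulr_ge0 B0 y_ge0; have := mulr_ge0 K0 (mulr_ge0 (sqr_ge0 c) (ltW w_gt0)).
by rewrite expr2; lra.
Qed.

Lemma tame_kernel H G phi : real_subspace H -> real_subspace G -> complete_for b G ->
  bounded_functional b phi -> (forall x, G x <-> H x /\ phi x = 0) -> tame G -> tame H.
Proof.
move=> HH GG Gc phiP GE G_tame; have GH y : G y -> H y by move=> /GE[].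
have [[v Hv phiv]|phi0] := pselect (exists2 v, H v & phi v != 0); last first.
  have [K K0 KP] := G_tame; exists K => // x Hx.
  have [|x' [Gx' ? ?]] := KP x; last by exists x'; split=> //; exact: GH.
  by apply/GE; split=> //; apply/eqP/negPn/negP => phix; apply: phi0; exists x.
have [g Gg gP] := projection aP v GG (tame_complete GG Gc G_tame).
have Hw : H (v - g) by apply: real_subspaceB => //; exact: GH.
have phiw : phi (v - g) = phi v.
  by rewrite (bounded_functionalB _ _ phiP) ((GE g).1 Gg).2 subr0.
apply: (tame_extend HH GH Hw) gP G_tame => x Hx; pose c := phi x / phi v.
exists (x - c%:C *: (v - g)), c; rewrite subrK; split=> //; apply/GE.
rewrite addrC -scaleNr -rmorphN; case: HH phiP => _ HS [phiL _].
by split; [exact: HS|rewrite phiL phiw /c mulNr divfK// addNr].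
Qed.

Lemma tame_finite_codim (I : eqType) (s : seq I) (phi : I -> V -> R) H :
  (forall i, bounded_functional b (phi i)) -> real_subspace H -> complete_for b H ->
  tame (fun x => H x /\ forall i, i \in s -> phi i x = 0) -> tame H.
Proof.
move=> phiP HH Hc; elim: s => [|i s IH] H_tame.
  have [K K0 KP] := H_tame; exists K => // x Hx.
  by have [//|x' [[]]] := KP x; exists x'.
apply: IH; apply: tame_kernel (phiP i) _ H_tame => //.
- exact: (real_subspace_kernel (fun j => j \in s)).
- exact: (real_subspace_kernel (fun j => j \in i :: s)).
- exact: (complete_kernel (S := fun j => j \in i :: s) Hc phiP).
move=> x; split=> [[Hx phix]|[[Hx phix] phiix]]; last first.
  by split=> // j; rewrite inE => /predU1P[->|/phix].
split; last by apply: phix; rewrite mem_head.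
by split=> // j js; apply: phix; rewrite inE js orbT.
Qed.

End Tame.

Section ClosureRelation.
Variables (R : realType) (V1 V2 : lmodType R[i]).
Variables (b1 : V1 -> V1 -> R) (b2 : V2 -> V2 -> R).
Local Open Scope complex_scope.
Hypotheses (b1P : semi_inner b1) (b2P : semi_inner b2).

Definition real_linear_rel (T : V1 -> V2 -> Prop) := forall (r : R) x y x' y',
  T x y -> T x' y' -> T (r%:C *: x + x') (r%:C *: y + y').

Definition isometric_rel (T : V1 -> V2 -> Prop) := forall x y x' y',
  T x y -> T x' y' -> b1 x x' = b2 y y'.

Definition closure_rel (T : V1 -> V2 -> Prop) (x : V1) (y : V2) := exists u v,
  [/\ forall k, T (u k) (v k), fast_cvg b1 u x & fast_cvg b2 v y].

Lemma closure_rel_incl T x y : T x y -> closure_rel T x y.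
Proof. by move=> Txy; exists (fun=> x), (fun=> y); split=> //; exact: fast_cvg_cst. Qed.

Lemma closure_rel_total T x : real_linear_rel T -> isometric_rel T ->
  complete_for b2 (fun=> True) -> adherent b1 (fun s => exists t, T s t) x ->
  exists y, closure_rel T x y.
Proof.
move=> Tlin Tiso b2c [u /choice[v Tuv] ux].
have [|y _ vy] := b2c v (fun=> I); last by exists y, u, v.
have [K uK] := fast_cvg_cauchy b1P ux; exists K => k.
have Tstep : T (u k.+1 - u k) (v k.+1 - v k).
  by have := Tlin (-1) _ _ _ _ (Tuv k) (Tuv k.+1); rewrite rmorphN1 !scaleN1r ![- _ + _]addrC.
by rewrite -(Tiso _ _ _ _ Tstep Tstep).
Qed.

Lemma closure_rel_isometric T : isometric_rel T -> isometric_rel (closure_rel T).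
Proof.
move=> Tiso x y x' y' [u [v [Tuv ux vy]]] [u' [v' [Tuv' ux' vy']]].
have [K xK] := fast_cvg_form b1P ux ux'; have [L yL] := fast_cvg_form b2P vy vy'.
apply/eqP; rewrite -subr_eq0; apply/eqP.
apply: (@eq0_of_sqr_le_quarter _ (2 * K + 2 * L)) => k.
have := xK k; have := yL k; rewrite (Tiso _ _ _ _ (Tuv k) (Tuv' k)).
have := sqr_ge0 ((b1 x x' - b2 (v k) (v' k)) + (b2 y y' - b2 (v k) (v' k))).
by rewrite !expr2; lra.
Qed.

Lemma closure_rel_map T (f : {additive V1 -> V1}) (g : {additive V2 -> V2}) x y :
  (forall s, normsq b1 (f s) = normsq b1 s) -> (forall t, normsq b2 (g t) = normsq b2 t) ->
  (forall s t, T s t -> T (f s) (g t)) -> closure_rel T x y -> closure_rel T (f x) (g y).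
Proof.
move=> fiso giso fgT [u [v [Tuv [K xK] [L yL]]]].
exists (f \o u), (g \o v); split=> [k| |]; first exact: fgT.
  by exists K => k; rewrite -raddfB fiso; exact: xK.
by exists L => k; rewrite -raddfB giso; exact: yL.
Qed.

End ClosureRelation.

Lemma closure_rel_sym (R : realType) (V1 V2 : lmodType R[i]) (b1 : V1 -> V1 -> R)
    (b2 : V2 -> V2 -> R) (T : V1 -> V2 -> Prop) x y :
  closure_rel b2 b1 (fun t s => T s t) y x -> closure_rel b1 b2 T x y.
Proof. by move=> [v [u [Tuv vy ux]]]; exists u, v. Qed.

(** * Congruence of positive semidefinite matrices *)

Lemma exists_perm_front n (P : pred 'I_n) : exists s : 'S_n, forall i, P (s i) = (i < #|P|)%N.
Proof.
pose l := enum P ++ enum (predC P).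
have l_size : size l = n by rewrite size_cat -!cardE cardC card_ord.
have l_uniq : uniq l.
  rewrite cat_uniq !enum_uniq andbT /=; apply/hasPn => i.
  by rewrite !mem_enum.
have f_inj : injective (fun i : 'I_n => nth i l i).
  move=> i j; rewrite (set_nth_default i j) ?l_size// => /eqP.
  by rewrite nth_uniq ?l_size// => /eqP/val_inj.
exists (perm f_inj) => i; rewrite permE nth_cat -cardE.
case: ltnP => i_P.
  by have := mem_nth i (_ : i < size (enum P))%N; rewrite -cardE mem_enum; apply.
have := @mem_nth _ i (enum (predC P)) (i - #|P|); rewrite mem_enum -cardE.
by rewrite ltn_subLR// cardC card_ord ltn_ord => /(_ isT)/negbTE.
Qed.

Section PsdCongruence.
Local Open Scope sesquilinear_scope.
Variable C : numClosedFieldType.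

Definition psdmx n (G : 'M[C]_n) :=
  G \is hermsymmx /\ forall c : 'rV[C]_n, 0 <= (c *m G *m c^t*) 0 0.

Lemma trmxC_unit n (A : 'M[C]_n) : (A^t* \in unitmx) = (A \in unitmx).
Proof. by rewrite map_unitmx unitmx_tr. Qed.

Lemma psd_diagonal n (G : 'M[C]_n) : psdmx G ->
  exists A d, [/\ A \in unitmx, A *m G *m A^t* = diag_mx d & forall i, 0 <= d 0 i].
Proof.
move=> [G_herm G_ge0]; exists (spectralmx G), (spectral_diag G).
set A := spectralmx G; set d := spectral_diag G.
have A_unitary : A \is unitarymx := spectral_unitarymx G.
have AG : A *m G *m A^t* = diag_mx d.
  have /orthomx_spectralP -> := hermitian_normalmx G_herm.
  rewrite -/A -/d invmx_unitary// !mulmxA.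
  by rewrite (unitarymxP A_unitary) mul1mx -mulmxA (unitarymxP A_unitary) mulmx1.
split=> [||i]; [exact: spectral_unit|by []|].
have -> : d 0 i = (row i A *m G *m (row i A)^t*) 0 0; last exact: G_ge0.
have := congr1 (fun B : 'M[C]_n => B i i) AG; rewrite [in RHS]mxE eqxx mulr1n => <-.
by rewrite -row_mul !mxE; apply: eq_bigr => j _; rewrite !mxE.
Qed.

Lemma diag_congruent_pid n (d : 'rV[C]_n) : (forall i, 0 <= d 0 i) ->
  exists2 X, X \in unitmx & X *m diag_mx d *m X^t* = pid_mx #|[pred i | d 0 i != 0]%R|.
Proof.
move=> d_ge0; have [s sP] := exists_perm_front [pred i | d 0 i != 0].
pose x := \row_i (if d 0 (s i) == 0 then 1 else (sqrtC (d 0 (s i)))^-1).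
pose X := diag_mx x *m perm_mx s; have XE i k : X i k = (s i == k)%:R * x 0 i.
  by rewrite /X mul_diag_mx mxE mulrC; congr (_ * _); rewrite !mxE.
exists X.
  rewrite unitmx_mul unitmx_perm andbT unitmxE det_diag unitfE prodf_seq_neq0.
  apply/allP => i _; rewrite mxE; case: ifPn => [_|di]; first exact: oner_neq0.
  by rewrite invr_eq0 sqrtC_eq0.
clearbody X; apply/matrixP => i j.
rewrite mul_mx_diag mxE (bigD1 (s i)) //= big1 ?addr0; last first.
  by move=> k ki; rewrite mxE XE eq_sym (negbTE ki) !mul0r.
rewrite !mxE !XE eqxx mul1r (inj_eq perm_inj) [j == i]eq_sym val_eqE -sP /=.
have [<-|_] := eqVneq i j; last by rewrite mul0r rmorph0 mulr0.
rewrite !mxE; case: eqVneq => [->|di]; first by rewrite mulr0 mul0r.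
rewrite mul1r -[X in _ * X * _]sqrtCK; set r := sqrtC _.
have r0 : r != 0 by rewrite sqrtC_eq0.
have -> : (r^-1)^* = r^-1 by apply: geC0_conj; rewrite invr_ge0 sqrtC_ge0.
by rewrite expr2 mulKf// divff.
Qed.

Lemma psd_congruent_pid n (G : 'M[C]_n) : psdmx G ->
  exists2 X, X \in unitmx & X *m G *m X^t* = pid_mx (\rank G).
Proof.
move=> /psd_diagonal[A [d [A_unit AG d_ge0]]]; have [Y Y_unit Yd] := diag_congruent_pid d_ge0.
have YAG : (Y *m A) *m G *m (Y *m A)^t* = pid_mx #|[pred i | d 0 i != 0]%R|.
  by rewrite trmx_mul map_mxM -Yd -AG !mulmxA.
have YA_unit : Y *m A \in unitmx by rewrite unitmx_mul Y_unit.
suff -> : \rank G = #|[pred i | d 0 i != 0]%R| by exists (Y *m A).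
have := congr1 (@mxrank C n n) YAG.
rewrite mxrankMfree ?row_free_unit ?trmxC_unit// eqmxMfull ?row_full_unit//.
by rewrite rank_pid_mx// -[leqRHS]card_ord max_card.
Qed.

Lemma psd_congruent n (G G' : 'M[C]_n) : psdmx G -> psdmx G' ->
  \rank G = \rank G' -> exists2 X, X \in unitmx & X *m G' *m X^t* = G.
Proof.
move=> /psd_congruent_pid[Y Y_unit YG] /psd_congruent_pid[Y' Y'_unit YG'] rkG.
exists (invmx Y *m Y'); first by rewrite unitmx_mul unitmx_inv Y_unit.
have -> : invmx Y *m Y' *m G' *m (invmx Y *m Y')^t* =
    invmx Y *m (Y' *m G' *m Y'^t*) *m (invmx Y)^t*.
  by rewrite trmx_mul map_mxM !mulmxA.
rewrite YG' -rkG -YG -[Y *m G *m _]mulmxA mulKmx// -mulmxA -map_mxM -trmx_mul.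
by rewrite mulVmx// trmx1 map_mx1 mulmx1.
Qed.

End PsdCongruence.

(** * Isometric extension *)

Section LinComb.
Variables (R : realType) (V : lmodType R[i]).
Local Notation C := (R[i]).

Definition lincomb n (v : 'I_n -> V) (c : 'rV[C]_n) : V := \sum_i c 0 i *: v i.

Lemma lincomb_is_linear n (v : 'I_n -> V) : linear (lincomb v).
Proof.
move=> k c c'; rewrite /lincomb scaler_sumr -big_split /=; apply: eq_bigr => i _.
by rewrite !mxE scalerDl scalerA.
Qed.

HB.instance Definition _ n (v : 'I_n -> V) :=
  GRing.isLinear.Build C 'rV[C]_n V *:%R (lincomb v) (lincomb_is_linear v).

Lemma linear_lincomb m (f : {linear V -> 'rV[C]_m}) n (v : 'I_n -> V) c :
  f (lincomb v c) = c *m \matrix_i f (v i).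
Proof.
rewrite linear_sum mulmx_sum_row; apply: eq_bigr => i _.
by rewrite linearZ rowK.
Qed.

Lemma exists_row_free_span N (P : V -> Prop) (psi : {linear V -> 'rV[C]_N}) :
  exists r (k : 'I_r -> V), [/\ forall i, P (k i),
    row_free (\matrix_i psi (k i)) &
    forall x, P x -> (psi x <= \matrix_i psi (k i))%MS].
Proof.
pose realizable j := `[< exists m (k : 'I_m -> V),
   (forall i, P (k i)) /\ \rank (\matrix_i psi (k i)) = j >].
have realizable0 : exists j, realizable j.
  exists 0%N; apply/asboolP; exists 0%N, (fun=> 0); split; first by case.
  by apply/eqP; rewrite -leqn0 rank_leq_row.
have realizable_le j : realizable j -> (j <= N)%N.
  by move=> /asboolP[m [k [_ <-]]]; exact: rank_leq_col.
case: (ex_maxnP realizable0 realizable_le) => j /asboolP[m [k [Pk rk]]] rk_max.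
pose A := \matrix_i psi (k i).
have span x : P x -> (psi x <= A)%MS.
  move=> Px; apply/negPn/negP => xA.
  pose k' (i : 'I_(m + 1)) := match fintype.split i with inl l => k l | inr _ => x end.
  have kA : \matrix_i psi (k' i) = col_mx A (psi x).
    apply/row_matrixP => i; rewrite rowK /k' -[in RHS](splitK i).
    by case: (fintype.split i) => l /=; rewrite ?col_mxEu ?rowKu ?rowKd ?rowK// row_id.
  have : realizable (\rank (\matrix_i psi (k' i))).
    apply/asboolP; exists (m + 1)%N, k'; split=> // i.
    by rewrite /k'; case: (fintype.split i).
  move/rk_max; rewrite -rk leqNgt => /negP; apply.
  rewrite kA -addsmxE; apply: rank_ltmx; rewrite /ltmx addsmxSl /=.
  by apply: contra xA; rewrite addsmx_sub => /andP[].
have kA : \matrix_i psi (k (maxrankfun A i)) = rowsub (maxrankfun A) A.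
  by apply/row_matrixP => i; rewrite row_rowsub !rowK.
exists (\rank A), (k \o maxrankfun A); split=> [i||x Px]; first exact: Pk.
  by rewrite kA maxrowsub_free.
by rewrite kA eq_maxrowsub; exact: span.
Qed.

Section Gram.
Variable a : V -> V -> R.
Hypothesis aP : semi_inner a.
Local Open Scope sesquilinear_scope.

Definition gram n (v : 'I_n -> V) : 'M[C]_n := \matrix_(i, j) cform a (v i) (v j).

Lemma cform_lincomb n (v : 'I_n -> V) c c' :
  cform a (lincomb v c) (lincomb v c') = (c *m gram v *m c'^t*) 0 0.
Proof.
rewrite (cform_suml aP) -mulmxA mxE; apply: eq_bigr => i _; congr (_ * _).
rewrite (cform_sumr aP) mxE; apply: eq_bigr => j _.
by rewrite !mxE mulrC.
Qed.

Lemma gram_psd n (v : 'I_n -> V) : psdmx (gram v).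
Proof.
split=> [|c].
  apply/is_hermitianmxP; rewrite expr0 scale1r; apply/matrixP => i j.
  by rewrite !mxE; exact: cformC.
by rewrite -cform_lincomb cformxx// ler0c si_ge0.
Qed.

Lemma gram_null n (v : 'I_n -> V) c :
  (c *m gram v == 0) = (normsq a (lincomb v c) == 0).
Proof.
apply/eqP/eqP => [c0|c0].
  have := cform_lincomb v c c; rewrite c0 mul0mx mxE cformxx//.
  by move/(congr1 (@complex.Re R)).
apply/rowP => j; have := cform_lincomb v c (delta_mx 0 j).
by rewrite cform_null// trmx_delta map_delta_mx -colE !mxE => <-.
Qed.

Definition orth_section n (L : {linear V -> 'rV[C]_n}) (m : 'I_n -> V) :=
  (forall i, L (m i) = delta_mx 0 i) /\ (forall i y, L y = 0 -> a (m i) y = 0).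

Lemma exists_orth_section n (L : {linear V -> 'rV[C]_n}) (e : 'I_n -> V) :
  complete_for a (fun x => L x = 0) -> (forall i, L (e i) = delta_mx 0 i) ->
  exists m, orth_section L m.
Proof.
move=> kerL_complete Le.
have kerL_subspace : real_subspace (fun x => L x = 0).
  split=> [|r x y Lx Ly]; first exact: linear0.
  by rewrite linearP Lx Ly scaler0 addr0.
have /choice[m mP] : forall i, exists m, L m = delta_mx 0 i /\ forall y, L y = 0 -> a m y = 0.
  move=> i; have [g Lg gP] := projection aP (e i) kerL_subspace kerL_complete.
  by exists (e i - g); rewrite linearB /= Lg subr0.
by exists m; split=> i; case: (mP i).
Qed.

Section OrthSection.
Variables (n : nat) (L : {linear V -> 'rV[C]_n}) (m : 'I_n -> V).
Hypothesis mP : orth_section L m.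

Lemma orth_sectionK c : L (lincomb m c) = c.
Proof.
rewrite linear_lincomb [X in c *m X](_ : _ = 1%:M) ?mulmx1//.
by apply/row_matrixP => i; rewrite rowK mP.1 row1.
Qed.

Lemma orth_section_ker x : L (x - lincomb m (L x)) = 0.
Proof. by rewrite linearB /= orth_sectionK subrr. Qed.

Lemma orth_section_orth c y : L y = 0 -> a (lincomb m c) y = 0.
Proof.
move=> Ly; suff: cform a (lincomb m c) y = 0 by case.
rewrite (cform_suml aP) big1 // => i _; rewrite /cform !mP.2 ?mulr0//.
by rewrite linearZ /= Ly scaler0.
Qed.

Lemma orth_section_null c :
  reflect (exists2 k, normsq a k = 0 & L k = c) (c *m gram m == 0).
Proof.
rewrite gram_null; apply: (iffP eqP) => [c0|[k k0 <-]].
  by exists (lincomb m c) => //; exact: orth_sectionK.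
have o := orth_section_orth (L k) (orth_section_ker k).
have := si_orthD aP o o; rewrite subrK k0.
have := si_ge0 aP (k - lincomb m (L k)).
have := si_ge0 aP (lincomb m (L k)); lra.
Qed.

End OrthSection.

(* [W] is [z] on the kernel of [L]; the orthogonal sections [m] and [m'] span complements of
   the domain and the range, and the congruence [X] of their Gram matrices defines [W] there. *)
Lemma isometric_glue n (z zi : {linear V -> V}) (L L' : {linear V -> 'rV[C]_n})
    (m m' : 'I_n -> V) (X : 'M[C]_n) :
  cancel z zi -> cancel zi z -> (forall x, L' (z x) = L x) ->
  (forall x y, L x = 0 -> L y = 0 -> a (z x) (z y) = a x y) ->
  orth_section L m -> orth_section L' m' ->
  X \in unitmx -> X *m gram m' *m X^t* = gram m ->
  exists W Wi : {linear V -> V},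
    [/\ cancel W Wi, cancel Wi W, forall x y, a (W x) (W y) = a x y &
        forall x, L x = 0 -> W x = z x].
Proof.
move=> zK ziK zL z_iso mP m'P X_unit XG.
pose W : {linear V -> V} :=
  (z \o (idfun \- (lincomb m \o L))) \+ (lincomb m' \o (mulmxr X \o L)).
pose Wi : {linear V -> V} :=
  (zi \o (idfun \- (lincomb m' \o L'))) \+ (lincomb m \o (mulmxr (invmx X) \o L')).
have WE x : W x = z (x - lincomb m (L x)) + lincomb m' (L x *m X) by [].
have WiE x : Wi x = zi (x - lincomb m' (L' x)) + lincomb m (L' x *m invmx X) by [].
clearbody W Wi; have L_ker := orth_section_ker mP; have L'_ker := orth_section_ker m'P.
exists W, Wi; split=> [x|x|x y|x Lx].
- rewrite WiE WE [L' _]linearD (orth_sectionK m'P) [L' (z _)]zL L_ker add0r.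
  by rewrite addrK zK mulmxK// subrK.
- rewrite WE WiE [L _]linearD (orth_sectionK mP) -[L (zi _)]zL ziK L'_ker add0r.
  by rewrite addrK ziK mulmxKV// subrK.
- have o' u v : a (lincomb m' u) (z (v - lincomb m (L v))) = 0.
    by apply: (orth_section_orth m'P); rewrite zL L_ker.
  have o u v : a (lincomb m u) (v - lincomb m (L v)) = 0.
    exact: (orth_section_orth mP).
  rewrite !WE (si_orthD aP) ?o'// z_iso//.
  rewrite -[in RHS](subrK (lincomb m (L x)) x) -[in RHS](subrK (lincomb m (L y)) y).
  rewrite [RHS](si_orthD aP) ?o//; congr (_ + _).
  suff : cform a (lincomb m' (L x *m X)) (lincomb m' (L y *m X))
       = cform a (lincomb m (L x)) (lincomb m (L y)) by case.
  by rewrite !cform_lincomb// -XG trmx_mul map_mxM !mulmxA.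
- by rewrite WE Lx mul0mx !(linear0 (lincomb _)) subr0 addr0.
Qed.

End Gram.

(* The null space of [a] modulo that of [b] is finite-dimensional when the linear map [psi]
   is injective on it. *)
Section NullSpace.
Variables (N : nat) (a b : V -> V -> R) (psi : {linear V -> 'rV[C]_N}).
Hypothesis aP : semi_inner a.
Hypothesis psi_null : forall x, normsq b x = 0 -> psi x = 0.
Hypothesis psi_inj : forall x, normsq a x = 0 -> psi x = 0 -> normsq b x = 0.

Definition null_basis r (k : 'I_r -> V) := [/\ forall i, normsq a (k i) = 0,
  row_free (\matrix_i psi (k i)) &
  forall x, normsq a x = 0 -> (psi x <= \matrix_i psi (k i))%MS].

Section NullBasis.
Variables (r : nat) (k : 'I_r -> V).
Hypothesis kP : null_basis k.

Definition null_coord (x : V) : 'rV[C]_r := psi x *m pinvmx (\matrix_i psi (k i)).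

Lemma null_lincomb c : normsq a (lincomb k c) = 0.
Proof.
have [k0 _ _] := kP; apply/eqP; rewrite -(gram_null aP); apply/eqP.
rewrite [gram _ _](_ : _ = 0) ?mulmx0//.
by apply/matrixP => i j; rewrite !mxE cform_null.
Qed.

Lemma null_coordK c : null_coord (lincomb k c) = c.
Proof. by have [_ k_free _] := kP; rewrite /null_coord linear_lincomb mulmxKp. Qed.

Lemma null_coordP x : normsq a x = 0 -> null_eqv b x (lincomb k (null_coord x)).
Proof.
have [_ _ k_span] := kP; move=> x0; apply: psi_inj; last first.
  by rewrite linearB /= linear_lincomb mulmxKpV ?k_span// subrr.
apply: normsq_eq0P => //; have := normsqB_le aP x (lincomb k (null_coord x)).
by rewrite x0 null_lincomb mulr0 addr0.
Qed.

Definition null_mx (f : {linear V -> V}) : 'M[C]_r :=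
  (\matrix_i psi (f (k i))) *m pinvmx (\matrix_i psi (k i)).

Lemma null_mxE f c : c *m null_mx f = null_coord (f (lincomb k c)).
Proof. by rewrite mulmxA; congr (_ *m _); exact/esym/(linear_lincomb (psi \o f)). Qed.

Lemma null_eqv_linear n (L : {linear V -> 'rV[C]_n}) x y :
  (forall x, normsq b x = 0 -> L x = 0) -> null_eqv b x y -> L x = L y.
Proof. by move=> L_null /L_null/eqP; rewrite linearB subr_eq0 => /eqP. Qed.

Section InjectiveMap.
Variables (n : nat) (f g : {linear V -> V}) (P Q : {linear V -> 'rV[C]_n}).
Hypothesis fK : cancel f g.
Hypothesis g_iso : forall x, normsq b (g x) = normsq b x.
Hypothesis Q_null : forall x, normsq b x = 0 -> Q x = 0.
Hypothesis fP : forall x, normsq a x = 0 -> P x = 0 -> normsq a (f x) = 0 /\ Q (f x) = 0.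

Lemma null_mx_ker (c : 'rV[C]_r) : c *m \matrix_i P (k i) = 0 ->
  c *m null_mx f *m (\matrix_i Q (k i)) = 0 /\ c *m null_mx f *m null_mx g = c.
Proof.
rewrite -linear_lincomb => /(fP (null_lincomb c))[fy0 Qfy].
have fy := null_coordP fy0; rewrite -null_mxE in fy; split.
  by rewrite -linear_lincomb -(null_eqv_linear Q_null fy).
rewrite null_mxE /null_coord; have gfy : null_eqv b (lincomb k c) (g (lincomb k (c *m null_mx f))).
  by rewrite /null_eqv -[in LHS](fK (lincomb k c)) -linearB g_iso.
rewrite -(null_eqv_linear psi_null gfy); exact: null_coordK.
Qed.

Lemma rank_null_ker_le :
  (\rank (kermx (\matrix_i P (k i))) <= \rank (kermx (\matrix_i Q (k i))))%N.
Proof.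
have kerP i : row i (kermx (\matrix_i P (k i))) *m \matrix_i P (k i) = 0.
  by rewrite -row_mul mulmx_ker row0.
have kerK : kermx (\matrix_i P (k i)) *m null_mx f *m null_mx g = kermx (\matrix_i P (k i)).
  by apply/row_matrixP => i; rewrite 2!row_mul; exact: (null_mx_ker (kerP i)).2.
rewrite -[X in (\rank X <= _)%N]kerK; apply: leq_trans (mxrankM_maxl _ _) _.
apply: mxrankS; apply/row_subP => i; rewrite row_mul sub_kermx.
by rewrite (null_mx_ker (kerP i)).1.
Qed.

End InjectiveMap.

Lemma rank_gram_orth_section n (L : {linear V -> 'rV[C]_n}) (m : 'I_n -> V) :
  (forall x, normsq b x = 0 -> L x = 0) -> orth_section a L m ->
  \rank (gram a m) = (n - (r - \rank (kermx (\matrix_i L (k i)))))%N.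
Proof.
have [k0 _ _] := kP; move=> L_null mP.
have kerE : (kermx (gram a m) == \matrix_i L (k i))%MS.
  apply/andP; split; apply/row_subP => i.
    have : row i (kermx (gram a m)) *m gram a m == 0.
      by rewrite -row_mul mulmx_ker row0.
    move/(orth_section_null aP mP) => [x x0 <-].
    rewrite (null_eqv_linear L_null (null_coordP x0)) linear_lincomb; exact: submxMl.
  by rewrite rowK sub_kermx; apply/(orth_section_null aP mP); exists (k i).
have := mxrank_ker (gram a m); rewrite (eqmxP kerE).
have := mxrank_ker (\matrix_i L (k i)) => ->.
have := rank_leq_row (\matrix_i L (k i)); have := rank_leq_row (gram a m).
by move=> gram_le L_le; rewrite subKn// => ->; rewrite subKn.
Qed.

End NullBasis.

(* The domain and the range of the partial isometry have codimension [n]; since it maps null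
   vectors to null vectors both ways, the Gram matrices of their complements have equal rank. *)
Theorem isometric_extension n (z zi : {linear V -> V}) (L : {linear V -> 'rV[C]_n})
    (e : 'I_n -> V) :
  cancel z zi -> cancel zi z -> (forall x, normsq b (z x) = normsq b x) ->
  (forall x, normsq b x = 0 -> L x = 0) -> (forall i, L (e i) = delta_mx 0 i) ->
  (forall x y, L (z x) = 0 -> L (z y) = 0 -> a (z x) (z y) = a x y) ->
  complete_for a (fun x => L (z x) = 0) -> complete_for a (fun x => L x = 0) ->
  exists W Wi : {linear V -> V},
    [/\ cancel W Wi, cancel Wi W, forall x y, a (W x) (W y) = a x y &
        forall x, L (z x) = 0 -> W x = z x].
Proof.
move=> zK ziK bz L_null Le a_iso dom_complete rng_complete.
have bzi x : normsq b (zi x) = normsq b x by rewrite -bz ziK.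
pose Lz : {linear V -> 'rV[C]_n} := L \o z.
have Lz_null x : normsq b x = 0 -> Lz x = 0 by move=> x0; apply: L_null; rewrite bz.
have Lz_e i : Lz (zi (e i)) = delta_mx 0 i by rewrite /= ziK.
have [m mP] := exists_orth_section aP (L := Lz) dom_complete Lz_e.
have [m' m'P] := exists_orth_section aP rng_complete Le.
have [r [k kP]] := exists_row_free_span (fun x => normsq a x = 0) psi.
have ker_rk : \rank (kermx (\matrix_i Lz (k i))) = \rank (kermx (\matrix_i L (k i))).
  apply/eqP; rewrite eqn_leq; apply/andP; split.
    by apply: (rank_null_ker_le kP zK bzi L_null) => x x0 Lx; rewrite a_iso.
  apply: (rank_null_ker_le kP ziK bz Lz_null) => x x0 Lx.
  by rewrite /= -a_iso /= ziK.
have rk : \rank (gram a m) = \rank (gram a m').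
  rewrite (rank_gram_orth_section kP Lz_null mP) ker_rk.
  by rewrite (rank_gram_orth_section kP L_null m'P).
have [X X_unit XG] := psd_congruent (gram_psd aP m) (gram_psd aP m') rk.
exact: (@isometric_glue a aP n z zi Lz L m m' X zK ziK (fun=> erefl) a_iso mP m'P X_unit XG).
Qed.

End NullSpace.
End LinComb.

(** * Bilateral shifts and Hardy projections *)

Section BilateralShift.
Variables (R : realType) (n : nat) (V : lmodType R[i]).
Local Notation C := (R[i]).
Local Open Scope complex_scope.
Variables (b : V -> V -> R) (z : int -> {linear V -> V}) (e : int -> 'I_n -> V).

Record bilateral_shift : Prop := BilateralShift {
  shift_form : semi_inner b;
  shift_complete : complete_for b (fun=> True);
  shiftD : forall (j k : int) x, z (j + k) x = z j (z k x);
  shift0 : forall x, z 0 x = x;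
  shift_iso : forall j x y, b (z j x) (z j y) = b x y;
  shift_basis : forall k j i, z k (e j i) = e (k + j) i;
  basis_orthonormal : forall j i k l, cform b (e j i) (e k l) = ((j == k) && (i == l))%:R;
  basis_total : forall x, (forall j i, cform b x (e j i) = 0) -> normsq b x = 0 }.

Definition fcoef (x : V) (j : int) (i : 'I_n) : C := cform b x (e j i).

Definition fcoef_vanish (S : int -> Prop) (x : V) := forall j, S j -> forall i, fcoef x j i = 0.

Definition analytic := fcoef_vanish (fun j => j < 0).
Definition coanalytic := fcoef_vanish (fun j => 0 <= j).

(* The orthogonal projections onto the coanalytic and the analytic vectors; a semi-inner
   product determines them only up to null vectors. *)
Definition Pm (x : V) : V :=
  xget 0 [set g | coanalytic g /\ forall h, coanalytic h -> b (x - g) h = 0]%classic.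
Definition Pp (x : V) : V := x - Pm x.

Lemma PmPp x : Pm x + Pp x = x. Proof. by rewrite addrC subrK. Qed.

Lemma PmE x : Pm x = x - Pp x. Proof. by rewrite /Pp subKr. Qed.

Hypothesis bze : bilateral_shift.
Let bP : semi_inner b := shift_form bze.

Lemma shiftK j : cancel (z j) (z (- j)).
Proof. by move=> x; rewrite -(shiftD bze) addNr (shift0 bze). Qed.

Lemma shiftNK j : cancel (z (- j)) (z j).
Proof. by move=> x; rewrite -(shiftD bze) addrN (shift0 bze). Qed.

Lemma cform_shift j x y : cform b (z j x) (z j y) = cform b x y.
Proof. by rewrite /cform -linearZ /= !(shift_iso bze). Qed.

Lemma cform_shiftN (k : int) x y : cform b (z (- k) x) y = (cform b (z k y) x)^*.
Proof. by rewrite -(cform_shift k) shiftNK (cformC bP). Qed.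

Lemma fcoefD x y j i : fcoef (x + y) j i = fcoef x j i + fcoef y j i.
Proof. exact: cformDl. Qed.

Lemma fcoefZ c x j i : fcoef (c *: x) j i = c * fcoef x j i.
Proof. exact: cformZl. Qed.

Lemma fcoefB x y j i : fcoef (x - y) j i = fcoef x j i - fcoef y j i.
Proof. by rewrite fcoefD -scaleN1r fcoefZ mulN1r. Qed.

Lemma fcoef_null x j i : normsq b x = 0 -> fcoef x j i = 0.
Proof. exact: cform_null. Qed.

Lemma fcoef_shift k x j i : fcoef (z k x) j i = fcoef x (j - k) i.
Proof.
rewrite /fcoef; have -> : e j i = z k (e (j - k) i) by rewrite (shift_basis bze) addrC subrK.
exact: cform_shift.
Qed.

Lemma fcoef_basis j i k l : fcoef (e j i) k l = ((j == k) && (i == l))%:R.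
Proof. exact: basis_orthonormal. Qed.

Section CoefVanish.
Variable S : int -> Prop.

Lemma fcoef_vanish0 : fcoef_vanish S 0.
Proof. by move=> j _ i; rewrite -[0](scale0r 0) fcoefZ mul0r. Qed.

Lemma fcoef_vanishD x y : fcoef_vanish S x -> fcoef_vanish S y -> fcoef_vanish S (x + y).
Proof. by move=> Sx Sy j Sj i; rewrite fcoefD Sx// Sy// addr0. Qed.

Lemma fcoef_vanishZ c x : fcoef_vanish S x -> fcoef_vanish S (c *: x).
Proof. by move=> Sx j Sj i; rewrite fcoefZ Sx// mulr0. Qed.

Lemma fcoef_vanishB x y : fcoef_vanish S x -> fcoef_vanish S y -> fcoef_vanish S (x - y).
Proof. by move=> Sx Sy; rewrite -scaleN1r; apply: fcoef_vanishD; last exact: fcoef_vanishZ. Qed.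

Lemma fcoef_vanish_lin c x y : fcoef_vanish S x -> fcoef_vanish S y -> fcoef_vanish S (c *: x + y).
Proof. by move=> Sx Sy; apply: fcoef_vanishD; first exact: fcoef_vanishZ. Qed.

Lemma fcoef_vanish_subspace : real_subspace (fcoef_vanish S).
Proof. by split=> [|r x y]; [exact: fcoef_vanish0|exact: fcoef_vanish_lin]. Qed.

Lemma fcoef_vanish_complete : complete_for b (fcoef_vanish S).
Proof.
move=> u Su u_cauchy; have [x _ ux] := shift_complete bze (fun=> I) u_cauchy.
exists x => // j Sj i; apply/cform_eq0.
have lim_eq0 y : (forall k, b (u k) y = 0) -> b x y = 0.
  move=> uy; apply: (fast_cvg_functional_eq0 ux (bounded_functional_form bP y)).
  by exists 0 => k; rewrite uy expr0n mul0r.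
by split; apply: lim_eq0 => k; have [] := (cform_eq0 _ _ _).1 (Su k j Sj i).
Qed.

Lemma fcoef_vanish_basis j i : ~ S j -> fcoef_vanish S (e j i).
Proof. by move=> Sj k Sk l; rewrite fcoef_basis; case: eqVneq => // jk; case: Sj; rewrite jk. Qed.

End CoefVanish.

Lemma analytic_basis j i : 0 <= j -> analytic (e j i).
Proof. by move=> j0; apply: fcoef_vanish_basis; lia. Qed.

Lemma coanalytic_basis j i : j < 0 -> coanalytic (e j i).
Proof. by move=> j0; apply: fcoef_vanish_basis; lia. Qed.

Lemma analytic_shift k x : 0 <= k -> analytic x -> analytic (z k x).
Proof. by move=> k0 hx j j0 i; rewrite fcoef_shift hx//; lia. Qed.

Lemma Pm_spec x : coanalytic (Pm x) /\ forall h, coanalytic h -> b (x - Pm x) h = 0.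
Proof.
apply: (@xgetPex _ _ [set g | coanalytic g /\ forall h, coanalytic h -> b (x - g) h = 0]%classic).
have [g gm xg] := projection bP x (fcoef_vanish_subspace _)
  (fcoef_vanish_complete (S := fun j => 0 <= j)).
by exists g.
Qed.

Lemma coanalytic_Pm x : coanalytic (Pm x). Proof. exact: (Pm_spec x).1. Qed.

Lemma Pp_orth x h : coanalytic h -> b (Pp x) h = 0. Proof. exact: (Pm_spec x).2. Qed.

Lemma analytic_Pp x : analytic (Pp x).
Proof.
move=> j j0 i; apply/cform_eq0; have hj := coanalytic_basis i j0.
by split; apply: Pp_orth => //; exact: fcoef_vanishZ.
Qed.

Lemma analytic_coanalytic_null x : analytic x -> coanalytic x -> normsq b x = 0.
Proof.
move=> xp xm; apply: (basis_total bze) => j i.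
by case: (ltP j 0) => j0; [exact: xp|exact: xm].
Qed.

Lemma Pm_unique x h : coanalytic h -> analytic (x - h) -> null_eqv b (Pm x) h.
Proof.
move=> hm xhp; apply: analytic_coanalytic_null; last first.
  by apply: fcoef_vanishB => //; exact: coanalytic_Pm.
have -> : Pm x - h = (x - h) - Pp x by rewrite PmE addrAC.
by apply: fcoef_vanishB => //; exact: analytic_Pp.
Qed.

Lemma Pp_unique x g : analytic g -> coanalytic (x - g) -> null_eqv b (Pp x) g.
Proof.
move=> gp xgm; apply: analytic_coanalytic_null.
  by apply: fcoef_vanishB => //; exact: analytic_Pp.
have -> : Pp x - g = (x - g) - Pm x by rewrite addrAC.
by apply: fcoef_vanishB => //; exact: coanalytic_Pm.
Qed.

Lemma Pm_lin c x y : null_eqv b (Pm (c *: x + y)) (c *: Pm x + Pm y).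
Proof.
apply: Pm_unique; first by apply: fcoef_vanish_lin; exact: coanalytic_Pm.
by rewrite opprD addrACA -scalerBr; apply: fcoef_vanish_lin; exact: analytic_Pp.
Qed.

Lemma Pp_lin c x y : null_eqv b (Pp (c *: x + y)) (c *: Pp x + Pp y).
Proof.
apply: Pp_unique; first by apply: fcoef_vanish_lin; exact: analytic_Pp.
rewrite opprD addrACA -scalerBr -!PmE.
by apply: fcoef_vanish_lin; exact: coanalytic_Pm.
Qed.

Lemma Pm_analytic x : analytic x -> null_eqv b (Pm x) 0.
Proof. by move=> xp; apply: Pm_unique; [exact: fcoef_vanish0|rewrite subr0]. Qed.

Lemma Pp_analytic x : analytic x -> null_eqv b (Pp x) x.
Proof. by move=> xp; apply: Pp_unique => //; rewrite subrr; exact: fcoef_vanish0. Qed.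

Lemma Pm_coanalytic x : coanalytic x -> null_eqv b (Pm x) x.
Proof. by move=> xm; apply: Pm_unique => //; rewrite subrr; exact: fcoef_vanish0. Qed.

Lemma Pp_coanalytic x : coanalytic x -> null_eqv b (Pp x) 0.
Proof. by move=> xm; apply: Pp_unique; [exact: fcoef_vanish0|rewrite subr0]. Qed.

Lemma PmZ c x : null_eqv b (Pm (c *: x)) (c *: Pm x).
Proof.
apply: Pm_unique; first by apply: fcoef_vanishZ; exact: coanalytic_Pm.
by rewrite -scalerBr; apply: fcoef_vanishZ; exact: analytic_Pp.
Qed.

Lemma PpZ c x : null_eqv b (Pp (c *: x)) (c *: Pp x).
Proof.
apply: Pp_unique; first by apply: fcoef_vanishZ; exact: analytic_Pp.
by rewrite -scalerBr -PmE; apply: fcoef_vanishZ; exact: coanalytic_Pm.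
Qed.

Lemma analytic_orth x y : analytic x -> coanalytic y -> b x y = 0.
Proof.
by move=> xp ym; rewrite -(null_eqv_sil bP _ (Pp_analytic xp)); exact: Pp_orth.
Qed.

Lemma form_Pp x g : analytic g -> b (Pp x) g = b x g.
Proof.
move=> gp; rewrite -[in RHS](PmPp x) (siDl bP) [b (Pm x) g](siC bP).
by rewrite (analytic_orth gp (coanalytic_Pm x)) add0r.
Qed.

Lemma form_Pm x h : coanalytic h -> b (Pm x) h = b x h.
Proof. by move=> hm; rewrite -[in RHS](PmPp x) (siDl bP) (Pp_orth _ hm) addr0. Qed.

Lemma form_PmPp x y : b x y = b (Pm x) (Pm y) + b (Pp x) (Pp y).
Proof.
have o u v : b (Pp u) (Pm v) = 0 by apply: Pp_orth; exact: coanalytic_Pm.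
by rewrite -[in LHS](PmPp x) -[in LHS](PmPp y) (si_orthD bP).
Qed.

Lemma normsq_Pp_le x : normsq b (Pp x) <= normsq b x.
Proof. by rewrite (form_PmPp x) lerDr si_ge0. Qed.

Lemma normsq_Pm_le x : normsq b (Pm x) <= normsq b x.
Proof. by rewrite (form_PmPp x) lerDl si_ge0. Qed.

(* A coanalytic vector shifted once stays coanalytic when its coefficient of index [-1]
   vanishes. *)
Lemma Pm_Pp_shift x : (forall i, fcoef x (-1) i = 0) ->
  null_eqv b (Pm (z 1 x)) (z 1 (Pm x)) /\ null_eqv b (Pp (z 1 x)) (z 1 (Pp x)).
Proof.
move=> x1; have zx : z 1 x = z 1 (Pm x) + z 1 (Pp x) by rewrite -linearD PmPp.
have zp : analytic (z 1 (Pp x)) by apply: analytic_shift => //; exact: analytic_Pp.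
have zm : coanalytic (z 1 (Pm x)).
  move=> j j0 i; rewrite fcoef_shift; have [->|jn0] := eqVneq j 0.
    by rewrite PmE sub0r fcoefB x1 analytic_Pp// subr0.
  by apply: coanalytic_Pm; lia.
split; first by apply: Pm_unique => //; rewrite zx addrAC subrr add0r.
by apply: Pp_unique => //; rewrite zx addrK.
Qed.

End BilateralShift.

(** * The form of a Hankel contraction *)

Lemma quadratic_lower_bound (R : realType) (A B t q : R) : 0 <= A -> 0 <= B ->
  0 <= q <= 1 -> t ^+ 2 <= q * (A * B) -> (1 - q) / 2 * (A + B) <= A + B + 2 * t.
Proof.
move=> A0 B0 /andP[q0 q1] t_le; rewrite leNgt; apply/negP => t_lt.
pose s := (1 + q) / 2 * (A + B).
have s0 : 0 <= s by rewrite mulr_ge0//; lra.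
have ts : s < - (2 * t) by rewrite /s; lra.
have s_sqr : s ^+ 2 < (2 * t) ^+ 2.
  by rewrite -[X in _ < X]sqrrN ltr_pXn2r// nnegrE; lra.
have amgm : 4 * (A * B) <= (A + B) ^+ 2 by have := sqr_ge0 (A - B); nra.
have q_le : q <= ((1 + q) / 2) ^+ 2 by have := sqr_ge0 (1 - q); nra.
have : q * (4 * (A * B)) <= ((1 + q) / 2) ^+ 2 * (A + B) ^+ 2.
  by apply: ler_pM => //; rewrite !mulr_ge0.
by move: s_sqr; rewrite /s exprMn; lra.
Qed.

Section HankelForm.
Variables (R : realType) (n : nat) (V : lmodType R[i]).
Local Notation C := (R[i]).
Local Open Scope complex_scope.
Variables (b : V -> V -> R) (z : int -> {linear V -> V}) (e : int -> 'I_n -> V).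
Variables (M Mad : {linear V -> V}).
Local Notation fcoef := (fcoef b e).
Local Notation analytic := (analytic b e).
Local Notation coanalytic := (coanalytic b e).
Local Notation Pm := (Pm b e).
Local Notation Pp := (Pp b e).

Definition hankel_op (f : V) : V := Pm (M f).

Definition hankel_contraction := forall f, analytic f -> normsq b (hankel_op f) <= normsq b f.

Definition cross (x y : V) : R := b (M (Pp x)) (Pm y).

(* The form of [1 + Gamma + Gamma^*], where [Gamma] is the Hankel operator of [M]. *)
Definition hform (x y : V) : R := b x y + cross x y + cross y x.

Hypothesis bze : bilateral_shift b z e.
Hypothesis M_adj : forall x y, b (M x) y = b x (Mad y).
Let bP : semi_inner b := shift_form bze.

Lemma hankel_opZ c f : null_eqv b (hankel_op (c *: f)) (c *: hankel_op f).
Proof. by rewrite /hankel_op linearZ; exact: (PmZ bze). Qed.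

Lemma null_eqv_adj x x' y : null_eqv b x x' -> b (M x) y = b (M x') y.
Proof. by move=> xx'; rewrite !M_adj; exact: null_eqv_sil. Qed.

Lemma cross_eqvl x x' y : null_eqv b (Pp x) x' -> cross x y = b (M x') (Pm y).
Proof. exact: null_eqv_adj. Qed.

Lemma cross_eqvr x y y' : null_eqv b (Pm y) y' -> cross x y = b (M (Pp x)) y'.
Proof. exact: null_eqv_sir. Qed.

Lemma crossDl x y u : cross (x + y) u = cross x u + cross y u.
Proof.
have := Pp_lin bze 1 x y; rewrite !scale1r => /cross_eqvl ->.
by rewrite linearD (siDl bP).
Qed.

Lemma crossDr x y u : cross u (x + y) = cross u x + cross u y.
Proof.
by have := Pm_lin bze 1 x y; rewrite !scale1r => /cross_eqvr ->; rewrite (siDr bP).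
Qed.

Lemma crossZl (r : R) x u : cross (r%:C *: x) u = r * cross x u.
Proof. by rewrite (cross_eqvl _ (PpZ bze _ x)) linearZ (siZl bP). Qed.

Lemma crossZr (r : R) x u : cross u (r%:C *: x) = r * cross u x.
Proof. by rewrite (cross_eqvr _ (PmZ bze _ x)) (siZr bP). Qed.

Lemma crossJ x y : cross ('i *: x) ('i *: y) = cross x y.
Proof.
rewrite (cross_eqvl _ (PpZ bze _ x)) linearZ (null_eqv_sir bP _ (PmZ bze _ y)).
exact: (siJ bP).
Qed.

Lemma hformxx x : hform x x = normsq b (Pp x) + normsq b (Pm x) + 2 * cross x x.
Proof. by rewrite /hform (form_PmPp bze x x); ring. Qed.

Lemma cross_sqr_le (q : R) x :
  normsq b (hankel_op (Pp x)) <= q * normsq b (Pp x) ->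
  cross x x ^+ 2 <= q * (normsq b (Pp x) * normsq b (Pm x)).
Proof.
move=> op_le; rewrite /cross -(form_Pm bze _ (coanalytic_Pm bze x)).
apply: le_trans (cauchy_schwarz bP _ _) _; rewrite mulrA.
by apply: ler_wpM2r => //; exact: si_ge0.
Qed.

Lemma hform_coercive (q : R) x : 0 <= q <= 1 ->
  normsq b (hankel_op (Pp x)) <= q * normsq b (Pp x) ->
  (1 - q) / 2 * normsq b x <= hform x x.
Proof.
move=> q01 /cross_sqr_le x_le; rewrite (form_PmPp bze x x) [X in _ * X]addrC hformxx.
by apply: (@quadratic_lower_bound _ _ _ _ q) => //; exact: si_ge0.
Qed.

Lemma hform_coanalytic x h : coanalytic h -> hform x h = b (x + M (Pp x)) h.
Proof.
move=> hm; rewrite /hform (siDl bP) (cross_eqvr _ (Pm_coanalytic bze hm)).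
by rewrite (cross_eqvl _ (Pp_coanalytic bze hm)) linear0 (si0l bP) addr0.
Qed.

Lemma hform_analytic x f : analytic f -> hform x f = b (x + Mad (Pm x)) f.
Proof.
move=> fp; rewrite /hform (siDl bP) (cross_eqvr _ (Pm_analytic bze fp)) (si0r bP) addr0.
by rewrite (cross_eqvl _ (Pp_analytic bze fp)) M_adj (siC bP f).
Qed.

Lemma hform_coanalytic2 g h : coanalytic g -> coanalytic h -> hform g h = b g h.
Proof.
move=> gm hm; rewrite hform_coanalytic// (siDl bP).
by rewrite (null_eqv_adj _ (Pp_coanalytic bze gm)) linear0 (si0l bP) addr0.
Qed.

Lemma hform_analytic2 f g : analytic f -> analytic g -> hform f g = b f g.
Proof.
move=> fp gp; rewrite hform_analytic// (siDl bP) [b (Mad _) _](siC bP) -M_adj.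
by rewrite (null_eqv_sir bP _ (Pm_analytic bze fp)) (si0r bP) addr0.
Qed.

Lemma hform_analytic_coanalytic f h : analytic f -> coanalytic h -> hform f h = b (M f) h.
Proof.
move=> fp hm; rewrite hform_coanalytic// (siDl bP) (analytic_orth bze fp hm) add0r.
exact: null_eqv_adj (Pp_analytic bze fp).
Qed.

Lemma cross_shift x y : (forall u, M (z 1 u) = z 1 (M u)) ->
  (forall i, fcoef x (-1) i = 0) -> (forall i, fcoef y (-1) i = 0) ->
  cross (z 1 x) (z 1 y) = cross x y.
Proof.
move=> M_shift /(Pm_Pp_shift bze)[_ xp] /(Pm_Pp_shift bze)[ym _].
by rewrite (cross_eqvl _ xp) (null_eqv_sir bP _ ym) M_shift (shift_iso bze).
Qed.

Lemma hform_shift x y : (forall u, M (z 1 u) = z 1 (M u)) ->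
  (forall i, fcoef x (-1) i = 0) -> (forall i, fcoef y (-1) i = 0) ->
  hform (z 1 x) (z 1 y) = hform x y.
Proof. by move=> M_shift x1 y1; rewrite /hform (shift_iso bze) !cross_shift. Qed.

Hypothesis contr : hankel_contraction.

Lemma hform_semi_inner : semi_inner hform.
Proof.
split.
- by move=> x y u; rewrite /hform (siDl bP) crossDl crossDr; ring.
- by move=> x y; rewrite /hform [b x y](siC bP); ring.
- by move=> r x y; rewrite /hform (siZl bP) crossZl crossZr !mulrDr.
- by move=> x y; rewrite /hform (siJ bP) !crossJ.
- move=> x; have := @hform_coercive 1 x; rewrite subrr mul0r mul0r mul1r.
  by apply; [rewrite ler01 lexx|exact: contr (analytic_Pp bze x)].
Qed.

Lemma hform_le x : normsq hform x <= 2 * normsq b x.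
Proof.
have := @cross_sqr_le 1 x; rewrite !mul1r => /(_ (contr (analytic_Pp bze x))) x_le.
have := @quadratic_lower_bound _ _ _ (- cross x x) 1 (si_ge0 bP (Pp x)) (si_ge0 bP (Pm x)).
rewrite hformxx (form_PmPp bze x x) sqrrN mul1r ler01 lexx => /(_ isT x_le).
by lra.
Qed.

End HankelForm.

(** * Compact perturbations and finite codimension *)

Record compact_on (R : realType) (V : lmodType R[i]) (b : V -> V -> R) (H : V -> Prop)
    (K : V -> V) : Prop := CompactOn {
  compact_lin : forall c f g, H f -> H g -> K (c *: f + g) = c *: K f + K g;
  compact_net : forall r : R, 0 < r -> exists s : seq V, forall f, H f -> normsq b f <= 1 ->
    exists2 g, g \in s & normsq b (K f - g) < r }.

Section CompactPerturbation.
Variables (R : realType) (n : nat) (V : lmodType R[i]).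
Local Notation C := (R[i]).
Local Open Scope complex_scope.
Variables (b : V -> V -> R) (z : int -> {linear V -> V}) (e : int -> 'I_n -> V).
Variables (M Mad : {linear V -> V}) (K : V -> V) (q : R).
Local Notation analytic := (analytic b e).
Local Notation Pp := (Pp b e).
Local Notation hankel_op := (hankel_op b e M).
Local Notation hform := (hform b e M).
Hypothesis bze : bilateral_shift b z e.
Hypothesis M_adj : forall x y, b (M x) y = b x (Mad y).
Hypothesis contr : hankel_contraction b e M.
Hypothesis K_compact : compact_on b analytic K.
Hypothesis q01 : 0 <= q < 1.
Hypothesis hankel_near : forall f, analytic f -> normsq b (hankel_op f - K f) <= q * normsq b f.
Let bP : semi_inner b := shift_form bze.

Lemma normsq_compact_le f : analytic f -> normsq b (K f) <= 4 * normsq b f.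
Proof.
move=> fp; have := normsqB_le bP (hankel_op f) (hankel_op f - K f); rewrite subKr.
have /andP[q0 /ltW q1] := q01; have := ler_piMl (si_ge0 bP f) q1.
by have := contr fp; have := hankel_near fp; lra.
Qed.

Lemma compact_eqv f g : analytic f -> analytic g -> null_eqv b f g -> null_eqv b (K f) (K g).
Proof.
move=> fp gp fg; apply: normsq_eq0P => //.
have -> : K f - K g = K (f - g).
  by have := compact_lin K_compact (-1) gp fp; rewrite !scaleN1r ![- _ + _]addrC.
apply: le_trans (normsq_compact_le (fcoef_vanishB bze fp gp)) _.
by rewrite [normsq b _]fg mulr0.
Qed.

Lemma compact_Pp_lin c x y :
  null_eqv b (K (Pp (c *: x + y))) (c *: K (Pp x) + K (Pp y)).
Proof.
have xp := analytic_Pp bze x; have yp := analytic_Pp bze y.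
rewrite -(compact_lin K_compact)//; apply: compact_eqv (Pp_lin bze _ _ _).
  exact: (analytic_Pp bze _).
exact: (fcoef_vanish_lin bze _ xp yp).
Qed.

Lemma compactZ (c : C) f : analytic f -> K (c *: f) = c *: K f.
Proof.
move=> fp; have zp : analytic 0 by exact: (fcoef_vanish0 bze).
have K0 : K 0 = 0.
  by have := compact_lin K_compact (-1) zp zp; rewrite scaler0 addr0 scaleN1r addNr.
by have := compact_lin K_compact c fp zp; rewrite K0 !addr0.
Qed.

Lemma bounded_functional_compact g : bounded_functional b (fun x => b (K (Pp x)) g).
Proof.
split=> [r x y|].
  by rewrite (null_eqv_sil bP _ (compact_Pp_lin _ _ _)) (siDl bP) (siZl bP).
exists (4 * normsq b g) => [|x]; first by rewrite mulr_ge0// si_ge0.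
apply: le_trans (cauchy_schwarz bP _ _) _; rewrite [leRHS]mulrAC.
apply: ler_wpM2r; first exact: si_ge0.
apply: le_trans (normsq_compact_le (analytic_Pp bze x)) _.
by rewrite ler_pM2l//; exact: (normsq_Pp_le bze).
Qed.

Section Net.
Variables (r : R) (s : seq V).
Hypothesis sP : forall f, analytic f -> normsq b f <= 1 ->
  exists2 g, g \in s & normsq b (K f - g) < r.

(* The value at a unit vector is near a point of the net, hence small if orthogonal to it. *)
Lemma orth_net_small f : analytic f -> (forall g, g \in s -> b (K f) g = 0) ->
  normsq b (K f) <= r * normsq b f.
Proof.
move=> fp fs; have [f0|fn0] := eqVneq (normsq b f) 0.
  by have := normsq_compact_le fp; rewrite f0 !mulr0.
have f_gt0 : 0 < normsq b f by rewrite lt_def fn0 si_ge0.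
pose c := (Num.sqrt (normsq b f))^-1.
have cc : c ^+ 2 * normsq b f = 1 by rewrite exprVn sqr_sqrtr ?ltW// mulVf.
have [||g gs] := @sP (c%:C *: f); first exact: (fcoef_vanishZ bze _ fp).
  by rewrite (normsqZ bP) cc.
rewrite compactZ// (siBl bP) !(siBr bP) (siC bP g) (siZl bP _ _ g) fs// (normsqZ bP) => Kf_lt.
have -> : normsq b (K f) = c ^+ 2 * normsq b (K f) * normsq b f.
  by rewrite mulrAC cc mul1r.
by rewrite ler_pM2r//; have := si_ge0 bP g; lra.
Qed.

Definition net_coef (x : V) : 'rV[C]_(size s) := \row_i cform b (K (Pp x)) s`_i.

Lemma net_coef_linear : linear net_coef.
Proof.
move=> c x y; apply/rowP => i; rewrite !mxE -(cformZl bP) -(cformDl bP).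
exact: (null_eqv_cforml bP _ (compact_Pp_lin _ _ _)).
Qed.

Lemma net_coef_null x : normsq b x = 0 -> net_coef x = 0.
Proof.
move=> x0; apply/rowP => i; rewrite !mxE; apply: (cform_null bP).
apply: (normsq_eq0P bP); apply: le_trans (normsq_compact_le (analytic_Pp bze x)) _.
by have := normsq_Pp_le bze x; rewrite x0; lra.
Qed.

Lemma net_coef_eq0 x : net_coef x = 0 -> forall g, g \in s -> b (K (Pp x)) g = 0.
Proof.
move=> /rowP x0 g /(nthP 0)[i i_lt <-].
by have := x0 (Ordinal i_lt); rewrite !mxE => /cform_eq0[].
Qed.

Definition net_bound : R := (1 - q) / (4 * (1 + q)).

Lemma net_bound_gt0 : 0 < net_bound.
Proof. by have /andP[q0 q1] := q01; rewrite divr_gt0//; lra. Qed.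

Lemma net_coercive x : r = (1 - q) ^+ 2 / (4 * (1 + q)) ->
  (forall g, g \in s -> b (K (Pp x)) g = 0) -> net_bound * normsq b x <= normsq hform x.
Proof.
move=> rE xs; have /andP[q0 q1] := q01; have xp := analytic_Pp bze x.
have -> : net_bound = (1 - (1 + 3 * q) / (2 * (1 + q))) / 2 by rewrite /net_bound; field; lra.
apply: (hform_coercive bze).
  by rewrite divr_ge0 ?ler_pdivrMr; lra.
have t01 : 0 < (1 + q) / 2 < 1 by lra.
have := normsqD_le_weighted bP (hankel_op (Pp x) - K (Pp x)) (K (Pp x)) t01.
rewrite subrK => /le_trans; apply.
have t1_ge0 : 0 <= ((1 + q) / 2)^-1 by rewrite invr_ge0; lra.
have t2_ge0 : 0 <= (1 - (1 + q) / 2)^-1 by rewrite invr_ge0; lra.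
have := lerD (ler_wpM2l t1_ge0 (hankel_near xp)) (ler_wpM2l t2_ge0 (orth_net_small xp xs)).
move=> /le_trans; apply; rewrite rE le_eqVlt; apply/orP; left; apply/eqP.
by field; rewrite !gt_eqF//; lra.
Qed.

End Net.

Lemma hform_tame : exists N (psi : {linear V -> 'rV[C]_N}),
  [/\ forall x, normsq b x = 0 -> psi x = 0,
      forall x, normsq hform x = 0 -> psi x = 0 -> normsq b x = 0 &
      forall H, real_subspace H -> complete_for b H -> tame b hform H].
Proof.
have /andP[q0 q1] := q01; pose r := (1 - q) ^+ 2 / (4 * (1 + q)).
have r0 : 0 < r by rewrite divr_gt0 ?exprn_gt0//; lra.
have [s sP] := compact_net K_compact r0.
have coercive x := net_coercive sP (x := x) erefl.
pose psi : {linear V -> 'rV[C]_(size s)} := HB.pack (net_coef s)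
  (GRing.isLinear.Build C V 'rV[C]_(size s) *:%R (net_coef s) (net_coef_linear s)).
exists (size s), psi; split=> [x|x x0 px|H HH Hc].
- exact: net_coef_null.
- apply: (normsq_eq0P bP); rewrite -(pmulr_rle0 _ net_bound_gt0) -[leRHS]x0.
  exact: coercive (net_coef_eq0 px).
have aP := hform_semi_inner bze M_adj contr.
apply: (tame_finite_codim bP aP (hform_le bze contr) bounded_functional_compact HH Hc (s := s)).
exists net_bound^-1 => [|x [Hx xs]]; first by rewrite invr_ge0 ltW// net_bound_gt0.
exists x; split=> //; first by rewrite /null_eqv subrr (si0l aP).
by rewrite ler_pdivlMl ?net_bound_gt0//; exact: coercive.
Qed.

End CompactPerturbation.

(** * The scattering identification *)

Section Scattering.
Variables (R : realType) (n : nat) (V : lmodType R[i]).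
Local Notation C := (R[i]).
Local Open Scope complex_scope.
Variables (b : V -> V -> R) (z : int -> {linear V -> V}) (e : int -> 'I_n -> V).
Variables (M Mad W Wi : {linear V -> V}).
Local Notation a := (hform b e M).
Local Notation fcoef := (fcoef b e).
Local Notation analytic := (analytic b e).
Local Notation coanalytic := (coanalytic b e).
Local Notation Pm := (Pm b e).
Local Notation Pp := (Pp b e).

Definition columns_bounded_below (u : 'I_n -> V) := exists2 K, 0 <= K &
  forall f, analytic f -> exists v, [/\ analytic v, normsq b f <= K * normsq b v &
    forall (k : nat) i, fcoef v k i = cform b f (z k (u i))].

Definition orthonormal_columns (u : 'I_n -> V) := forall (k : nat) i l,
  cform b (z k (u i)) (u l) = cform b (e k i) (e 0 l).

Record interpolating_columns (u : 'I_n -> V) : Prop := InterpolatingColumns {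
  columns_orthonormal : orthonormal_columns u;
  columns_coef : forall (j : int) i l, j < 0 -> fcoef (u i) j l = fcoef (M (e 0 i)) j l;
  columns_lower_bound : columns_bounded_below u }.

Hypothesis bze : bilateral_shift b z e.
Hypothesis M_adj : forall x y, b (M x) y = b x (Mad y).
Hypothesis contr : hankel_contraction b e M.
Hypothesis a_complete : complete_for a (fun=> True).
Hypothesis a_tame : tame b a (fun=> True).
Hypothesis WiK : cancel Wi W.
Hypothesis W_iso : forall x y, a (W x) (W y) = a x y.
Hypothesis W_shift : forall x, (forall i, fcoef x (-1) i = 0) -> W x = z 1 x.
Let bP : semi_inner b := shift_form bze.
Let aP : semi_inner a := hform_semi_inner bze M_adj contr.

Lemma iter_W_analytic k f : analytic f -> iter k W f = z k f.
Proof.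
move=> fp; elim: k => [|k IH] /=; first by rewrite (shift0 bze).
have -> : Posz k.+1 = 1 + Posz k by lia.
rewrite IH (shiftD bze) W_shift// => i; rewrite (fcoef_shift bze) fp//; lia.
Qed.

Lemma hform_iter_W k x y : a (iter k W x) (iter k W y) = a x y.
Proof. by elim: k => //= k IH; rewrite W_iso. Qed.

Lemma cform_W x y : cform a (W x) (W y) = cform a x y.
Proof. by rewrite /cform -linearZ /= !W_iso. Qed.

Lemma iter_WiK k x : iter k W (iter k Wi x) = x.
Proof. by elim: k => //= k IH; rewrite -iterS iterSr /= WiK. Qed.

(* [wbasis m i] is the image of [z^m e_i] under the identification of the two spaces that
   fixes the coanalytic vectors and turns the shift into [W]. *)
Definition wbasis (m : int) (i : 'I_n) : V :=
  match m with Negz _ => e m i | Posz k => iter k.+1 W (e (-1) i) end.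

Lemma wbasis_neg m i : m < 0 -> wbasis m i = e m i.
Proof. by case: m. Qed.

Lemma W_wbasis m i : W (wbasis m i) = wbasis (m + 1) i.
Proof.
case: m => [k|[|k]].
- by have -> : Posz k + 1 = Posz k.+1 by lia.
- by [].
- have -> : Negz k.+1 + 1 = Negz k by lia.
  rewrite /= W_shift => [|l]; last by rewrite (fcoef_basis bze).
  by rewrite (shift_basis bze); congr e; lia.
Qed.

Lemma wbasis_orthonormal m i l j :
  cform a (wbasis m i) (wbasis l j) = cform b (e m i) (e l j).
Proof.
have W_pow (k : nat) (p q : int) :
    cform a (wbasis (p + k) i) (wbasis (q + k) j) = cform a (wbasis p i) (wbasis q j).
  elim: k => [|k IH]; first by rewrite !addr0.
  have addS (r : int) : r + k.+1 = r + k + 1 by lia.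
  by rewrite !addS -!W_wbasis cform_W.
have [N [mN lN]] : exists N : nat, m - N%:Z < 0 /\ l - N%:Z < 0.
  by exists (`|m| + `|l| + 1)%N; lia.
rewrite -[m](subrK N%:Z) -[l](subrK N%:Z); move: (m - _) (l - _) mN lN => p q p0 q0.
rewrite W_pow !wbasis_neg// ![_ + N%:Z]addrC -!(shift_basis bze) (cform_shift bze).
have hp := coanalytic_basis bze i p0; have hq := coanalytic_basis bze j q0.
rewrite /cform !(hform_coanalytic2 bze M_adj)//; exact: (fcoef_vanishZ bze).
Qed.

Inductive trig : V -> V -> Prop :=
| trig0 : trig 0 0
| trigS c m i x y : trig x y -> trig (c *: e m i + x) (c *: wbasis m i + y).

Lemma trig_lin c x y x' y' : trig x y -> trig x' y' -> trig (c *: x + x') (c *: y + y').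
Proof.
move=> xy x'y'; elim: xy => [|d m i u v _ IH]; first by rewrite !scaler0 !add0r.
by rewrite !scalerDr !scalerA -!addrA; exact: trigS.
Qed.

Lemma trigZ c x y : trig x y -> trig (c *: x) (c *: y).
Proof. by move=> xy; have := trig_lin c xy trig0; rewrite !addr0. Qed.

Lemma trig_basis m i : trig (e m i) (wbasis m i).
Proof. by have := trigS 1 m i trig0; rewrite !addr0 !scale1r. Qed.

Lemma trig_shift x y : trig x y -> trig (z 1 x) (W y).
Proof.
elim=> [|c m i u v _ IH]; first by rewrite !linear0; exact: trig0.
by rewrite !linearP /= (shift_basis bze) W_wbasis (addrC 1 m); exact: trigS.
Qed.

Lemma trig_isometric : isometric_rel b a trig.
Proof.
move=> x y x' y' xy x'y'; suff : cform b x x' = cform a y y' by case.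
have basis_form m i u v : trig u v -> cform b (e m i) u = cform a (wbasis m i) v.
  elim=> [|c l j u' v' _ IH]; first by rewrite /cform !scaler0 !(si0r bP) !(si0r aP).
  by rewrite (cformDr bP) (cformDr aP) (cformZr bP) (cformZr aP) IH wbasis_orthonormal.
elim: xy => [|c m i u v _ IH]; first by rewrite /cform !(si0l bP) !(si0l aP).
by rewrite (cformDl bP) (cformDl aP) (cformZl bP) (cformZl aP) IH (basis_form _ _ _ _ x'y').
Qed.

Lemma trig_bounded_degree x y : trig x y ->
  exists k : nat, forall j : int, k%:Z <= j -> forall i, fcoef x j i = 0.
Proof.
elim=> [|c m i u v _ [k kP]].
  by exists 0%N => j _ i; rewrite (fcoef_null bze)// (si0l bP).
exists (maxn k `|m|.+1) => j kj l.
rewrite (fcoefD bze) (fcoefZ bze) (fcoef_basis bze) kP ?addr0; last by lia.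
by case: eqVneq => [mj|_]; [lia|rewrite mulr0].
Qed.

Lemma trig_domain_subspace : real_subspace (fun s => exists t, trig s t).
Proof.
split=> [|r u v [t ut] [t' vt']]; first by exists 0; exact: trig0.
by exists (r%:C *: t + t'); exact: trig_lin.
Qed.

Lemma trig_range_subspace : real_subspace (fun t => exists s, trig s t).
Proof.
split=> [|r u v [s su] [s' sv']]; first by exists 0; exact: trig0.
by exists (r%:C *: s + s'); exact: trig_lin.
Qed.

Lemma trig_dense x : adherent b (fun s => exists t, trig s t) x.
Proof.
apply: (adherent_of_orthogonal bP) trig_domain_subspace (shift_complete bze) _ => y y_orth.
apply: (basis_total bze) => j i; apply/cform_eq0; split; apply: y_orth.
  by exists (wbasis j i); exact: trig_basis.
by exists ('i *: wbasis j i); apply: trigZ; exact: trig_basis.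
Qed.

Lemma shifted_analytic_small v (r : R) : 0 < r -> exists k : nat, forall g, analytic g ->
  b v (z k g) ^+ 2 <= r * normsq b g.
Proof.
move=> r0; have [s [t st] vs] := adherent_approx (trig_dense v) r0.
have [k kP] := trig_bounded_degree st; exists k => g gp.
have s_orth : b s (z k g) = 0.
  rewrite -(shift_iso bze (- k%:Z)) (shiftK bze) (siC bP).
  by apply: (analytic_orth bze gp) => j j0 i; rewrite (fcoef_shift bze) kP//; lia.
have -> : b v (z k g) = b (v - s) (z k g) by rewrite (siBl bP) s_orth subr0.
apply: le_trans (cauchy_schwarz bP _ _) _; rewrite (shift_iso bze).
by apply: ler_wpM2r; [exact: si_ge0|].
Qed.

Lemma hform_orth_coanalytic y h : (forall m i, m < 0 -> cform a y (e m i) = 0) ->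
  coanalytic h -> a y h = 0.
Proof.
move=> y_orth hm; rewrite (hform_coanalytic bze M_adj)//.
apply: (analytic_orth bze) hm => m m0 i; have em := coanalytic_basis bze i m0.
transitivity (cform a y (e m i)); last exact: y_orth.
by rewrite /cform !(hform_coanalytic bze M_adj)//; exact: (fcoef_vanishZ bze).
Qed.

Lemma hform_Pp y : (forall m i, m < 0 -> cform a y (e m i) = 0) -> a y y = a y (Pp y).
Proof.
move=> y_orth; rewrite -[X in a y X = _](PmPp b e) (siDr aP).
by rewrite (hform_orth_coanalytic y_orth (coanalytic_Pm bze y)) add0r.
Qed.

(* Writing [x = W^k y] and replacing [y] by a [b]-bounded representative [y'], the norm of
   [x] becomes the pairing of a fixed vector with [z^k P_+ y']. *)
Lemma orth_wbasis_norm : exists2 K, 0 <= K & forall x (k : nat),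
  (forall m i, cform a x (wbasis m i) = 0) ->
  exists g, [/\ analytic g, normsq b g <= K * normsq a x &
                normsq a x = b (x + Mad (Pm x)) (z k g)].
Proof.
have [K K0 KP] := a_tame; exists K => // x k x_orth.
pose y := iter k Wi x; have Wy : iter k W y = x by exact: iter_WiK.
have y_orth m i : cform a y (wbasis m i) = 0.
  rewrite /y; elim: (k) m => [|k' IH] m /=; first exact: x_orth.
  by rewrite -cform_W WiK W_wbasis IH.
have yx : normsq a y = normsq a x by rewrite -(hform_iter_W k) Wy.
have [y' [_ yy' y'_le]] := KP y I.
have y'_orth m i : m < 0 -> cform a y' (e m i) = 0.
  by move=> m0; rewrite -(null_eqv_cforml aP _ yy') -wbasis_neg.
exists (Pp y'); split; first exact: (analytic_Pp bze).
  by rewrite -yx; exact: le_trans (normsq_Pp_le bze _) y'_le.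
rewrite -yx (null_eqv_normsq aP yy') hform_Pp// -(null_eqv_sil aP _ yy').
rewrite -(hform_iter_W k) Wy iter_W_analytic; last exact: (analytic_Pp bze).
by apply: (hform_analytic bze M_adj); apply: (analytic_shift bze) => //; exact: (analytic_Pp bze).
Qed.

Lemma wbasis_total x : (forall m i, cform a x (wbasis m i) = 0) -> normsq a x = 0.
Proof.
move=> x_orth; have [K K0 KP] := orth_wbasis_norm; have x_ge0 := si_ge0 aP x.
have x_sqr_le (r : R) : 0 < r -> normsq a x ^+ 2 <= r * (K * normsq a x).
  move=> r0; have [k kP] := shifted_analytic_small (x + Mad (Pm x)) r0.
  have [g [gp g_le xE]] := KP x k x_orth.
  by rewrite {1}xE; apply: le_trans (kP _ gp) _; rewrite ler_pM2l.
have [//|xn0] := eqVneq (normsq a x) 0; have x_gt0 : 0 < normsq a x by rewrite lt_def xn0.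
have := x_sqr_le (normsq a x / (2 * (K + 1))) ltac:(by rewrite divr_gt0//; lra).
rewrite expr2 mulrA ler_pM2r// mulrAC ler_pdivlMr; last by lra.
by have := mulr_ge0 x_ge0 K0; nra.
Qed.

Definition scattering : V -> V -> Prop := closure_rel b a trig.

Lemma scattering_total x : exists y, scattering x y.
Proof.
apply: (closure_rel_total bP _ trig_isometric a_complete (trig_dense x)).
by move=> r *; exact: trig_lin.
Qed.

Lemma scattering_onto y : exists x, scattering x y.
Proof.
have y_adherent : adherent a (fun t => exists s, trig s t) y.
  apply: (adherent_of_orthogonal aP) trig_range_subspace a_complete _ => x x_orth.
  apply: wbasis_total => m i; apply/cform_eq0; split; apply: x_orth.
    by exists (e m i); exact: trig_basis.
  by exists ('i *: e m i); apply: trigZ; exact: trig_basis.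
have [|u v u' v' uv u'v'|x xy] := closure_rel_total aP (T := fun t s => trig s t)
  _ _ (shift_complete bze) y_adherent; last by exists x; exact: closure_rel_sym.
  by move=> r *; exact: trig_lin.
by rewrite (trig_isometric uv u'v').
Qed.

Lemma scatteringJ x y : scattering x y -> scattering ('i *: x) ('i *: y).
Proof.
move=> xy; apply: closure_rel_map (fun s => siJ bP s s) (fun t => siJ aP t t) _ xy => s t.
exact: trigZ.
Qed.

Lemma scattering_cform x y x' y' : scattering x y -> scattering x' y' ->
  cform b x x' = cform a y y'.
Proof.
have iso := closure_rel_isometric bP aP trig_isometric.
by move=> xy x'y'; rewrite /cform (iso _ _ _ _ xy x'y') (iso _ _ _ _ xy (scatteringJ x'y')).
Qed.

Lemma scattering_shift (k : nat) x y : scattering x y -> scattering (z k x) (iter k W y).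
Proof.
move=> xy; elim: k => [|k IH] /=; first by rewrite (shift0 bze).
have -> : Posz k.+1 = 1 + Posz k by lia.
rewrite (shiftD bze); apply: (closure_rel_map (f := z 1) (g := W)) IH => [s|t|s t].
- exact: (shift_iso bze).
- exact: W_iso.
- exact: trig_shift.
Qed.

Lemma scattering_basis m i : scattering (e m i) (wbasis m i).
Proof. by apply: (closure_rel_incl bP aP); exact: trig_basis. Qed.

Lemma cform_hform_analytic f g : analytic f -> analytic g -> cform a f g = cform b f g.
Proof.
move=> fp gp; rewrite /cform !(hform_analytic2 bze M_adj)//.
exact: (fcoef_vanishZ bze).
Qed.

(* The identification carries [u_i] to [e_i] and [f] to some [x]; [v] is the analytic part of
   the vector representing the functional [a x] on analytic vectors. *)
Lemma scattering_bounded_below (u : 'I_n -> V) : (forall i, scattering (u i) (e 0 i)) ->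
  columns_bounded_below u.
Proof.
move=> ue; have [K K0 KP] := a_tame; exists K => // f fp.
have [x fx] := scattering_total f; have [x' [_ xx' x'_le]] := KP x I.
have fxx := closure_rel_isometric bP aP trig_isometric fx fx.
have x'_orth m i : m < 0 -> cform a x' (e m i) = 0.
  move=> m0; rewrite -(null_eqv_cforml aP _ xx') -wbasis_neg//.
  by rewrite -(scattering_cform fx (scattering_basis m i)); exact: fp.
pose v := x + Mad (Pm x); exists (Pp v); split; first exact: (analytic_Pp bze).
  apply: (le_mul_normsq_of_dual bP (g := Pp x')); rewrite ?si_ge0//.
    rewrite fxx (null_eqv_normsq aP xx') hform_Pp// -(null_eqv_sil aP _ xx').
    by rewrite (form_Pp bze) ?(hform_analytic bze M_adj)//; exact: (analytic_Pp bze).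
  by rewrite fxx; exact: le_trans (normsq_Pp_le bze _) x'_le.
move=> k i; have kp := analytic_basis bze i (isT : 0 <= Posz k).
rewrite (scattering_cform fx (scattering_shift k (ue i))) iter_W_analytic; last first.
  exact: (analytic_basis bze).
rewrite (shift_basis bze) addr0 /fcoef /cform !(form_Pp bze)//; last exact: (fcoef_vanishZ bze).
by rewrite !(hform_analytic bze M_adj)//; exact: (fcoef_vanishZ bze).
Qed.

Theorem scattering_columns : exists u, interpolating_columns u.
Proof.
have /choice[u ue] i := scattering_onto (e 0 i).
have ep i := analytic_basis bze i (lexx 0).
exists u; split; last exact: scattering_bounded_below.
- move=> k i l; rewrite (scattering_cform (scattering_shift k (ue i)) (ue l)) iter_W_analytic//.
  rewrite (shift_basis bze) addr0 cform_hform_analytic//; exact: (analytic_basis bze).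
- move=> j i l j0; rewrite [LHS](scattering_cform (ue i) (scattering_basis j l)) wbasis_neg//.
  have em := coanalytic_basis bze l j0.
  by rewrite /cform !(hform_analytic_coanalytic bze M_adj)//; exact: (fcoef_vanishZ bze).
Qed.

End Scattering.

Section InterpolantColumns.
Variables (R : realType) (n : nat) (V : lmodType R[i]).
Local Notation C := (R[i]).
Variables (b : V -> V -> R) (z : int -> {linear V -> V}) (e : int -> 'I_n -> V).
Variables (M Mad : {linear V -> V}) (K : V -> V) (q : R).
Local Notation fcoef := (fcoef b e).
Local Notation analytic := (analytic b e).
Local Notation hform := (hform b e M).
Hypothesis bze : bilateral_shift b z e.
Hypothesis M_adj : forall x y, b (M x) y = b x (Mad y).
Hypothesis M_shift : forall x, M (z 1 x) = z 1 (M x).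
Hypothesis contr : hankel_contraction b e M.
Hypothesis K_compact : compact_on b analytic K.
Hypothesis q01 : 0 <= q < 1.
Hypothesis hankel_near : forall f, analytic f ->
  normsq b (hankel_op b e M f - K f) <= q * normsq b f.
Let bP : semi_inner b := shift_form bze.
Let aP : semi_inner hform := hform_semi_inner bze M_adj contr.

Definition fcoef0 (x : V) : 'rV[C]_n := \row_i fcoef x 0 i.

Lemma fcoef0_linear : linear fcoef0.
Proof. by move=> c x y; apply/rowP => i; rewrite !mxE (fcoefD bze) (fcoefZ bze). Qed.

Lemma fcoef0_eq0 x : (fcoef0 x = 0) = fcoef_vanish b e (fun j => j = 0) x.
Proof.
apply/propext; split=> [/rowP x0 _ -> i|x0]; first by have := x0 i; rewrite !mxE.
by apply/rowP => i; rewrite !mxE x0.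
Qed.

Lemma fcoef0_shift_eq0 x : (fcoef0 (z 1 x) = 0) = fcoef_vanish b e (fun j => j = -1) x.
Proof.
rewrite fcoef0_eq0; apply/propext; split=> x0 _ -> i.
  by have := x0 0 erefl i; rewrite (fcoef_shift bze) sub0r.
by rewrite (fcoef_shift bze) sub0r x0.
Qed.

Lemma shift_extension : complete_for hform (fun=> True) /\ tame b hform (fun=> True) /\
  exists W Wi : {linear V -> V}, [/\ cancel W Wi, cancel Wi W,
    forall x y, hform (W x) (W y) = hform x y &
    forall x, (forall i, fcoef x (-1) i = 0) -> W x = z 1 x].
Proof.
have [N [psi [psi_null psi_inj H_tame]]] :=
  hform_tame bze M_adj contr K_compact q01 hankel_near.
have H_complete H : real_subspace H -> complete_for b H -> complete_for hform H.
  by move=> HH Hc; exact: (tame_complete bP aP (hform_le bze contr) HH Hc (H_tame _ HH Hc)).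
have VS : real_subspace (fun _ : V => True) by [].
have Vc := shift_complete bze; split; [exact: H_complete|split; first exact: H_tame].
pose L : {linear V -> 'rV[C]_n} :=
  HB.pack fcoef0 (GRing.isLinear.Build C V 'rV[C]_n *:%R fcoef0 fcoef0_linear).
have L_null x : normsq b x = 0 -> L x = 0.
  by move=> x0; apply/rowP => i; rewrite !mxE (fcoef_null bze).
have L_e i : L (e 0 i) = delta_mx 0 i.
  by apply/rowP => l; rewrite !mxE (fcoef_basis bze) !eqxx eq_sym.
have z_hform x y : L (z 1 x) = 0 -> L (z 1 y) = 0 -> hform (z 1 x) (z 1 y) = hform x y.
  rewrite /= !fcoef0_shift_eq0 => x1 y1.
  by apply: (hform_shift bze M_adj M_shift) => i; [exact: x1|exact: y1].
have dom_complete : complete_for hform (fun x => L (z 1 x) = 0).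
  rewrite (funext fcoef0_shift_eq0).
  exact: (H_complete _ (fcoef_vanish_subspace bze _) (fcoef_vanish_complete bze (S := _))).
have rng_complete : complete_for hform (fun x => L x = 0).
  rewrite (funext fcoef0_eq0).
  exact: (H_complete _ (fcoef_vanish_subspace bze _) (fcoef_vanish_complete bze (S := _))).
have [W [Wi [WK WiK W_iso W_shift]]] := isometric_extension aP psi_null psi_inj
  (shiftK bze 1) (shiftNK bze 1) (fun x => shift_iso bze 1 x x)
  L_null L_e z_hform dom_complete rng_complete.
exists W, Wi; split=> // x x1; apply: W_shift.
by rewrite /= fcoef0_shift_eq0 => _ ->.
Qed.

Theorem exists_interpolating_columns : exists u, interpolating_columns b z e M u.
Proof.
have [a_complete [a_tame [W [Wi [_ WiK W_iso W_shift]]]]] := shift_extension.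
exact: (scattering_columns bze M_adj contr a_complete a_tame WiK W_iso W_shift).
Qed.

End InterpolantColumns.


(** * Square integrable functions *)

Lemma normr_le_invD_sqr (R : realFieldType) (l x : R) : 0 < l -> `|x| <= l^-1 + l * x ^+ 2.
Proof.
move=> l0; have := normr_ge0 x; have := sqr_ge0 (l * `|x| - 1).
have -> : (l * `|x| - 1) ^+ 2 = l * (l^-1 + l * x ^+ 2 - 2 * `|x|).
  by rewrite -(real_normK (num_real x)); field; rewrite gt_eqF.
by rewrite pmulr_rge0//; lra.
Qed.

Section Rintegrable.
Context {d : measure_display} {T : measurableType d} {R : realType}.
Variables (mu : {measure set T -> \bar R}) (D : set T).
Hypothesis mD : measurable D.
Implicit Types f g v : T -> R.

Definition Rintegrable (f : T -> R) := mu.-integrable D (EFin \o f).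

Lemma Rintegrable_measurable f : Rintegrable f -> measurable_fun D f.
Proof. by move=> /integrableP[/measurable_EFinP]. Qed.

Lemma EFin_Rintegral f : Rintegrable f ->
  (\int[mu]_(t in D) f t)%:E = (\int[mu]_(t in D) (f t)%:E)%E.
Proof. by move=> fi; rewrite fineK//; exact: integrable_fin_num. Qed.

Lemma eq_Rintegrable f g : (forall t, D t -> f t = g t) -> Rintegrable f -> Rintegrable g.
Proof.
by move=> fg; apply: eq_integrable => // t; rewrite inE => Dt /=; rewrite fg.
Qed.

Lemma RintegrableD f g : Rintegrable f -> Rintegrable g -> Rintegrable (fun t => f t + g t).
Proof. by move=> fi gi; exact: (eq_integrable mD _ _ _ (integrableD mD fi gi)). Qed.

Lemma RintegrableZl r f : Rintegrable f -> Rintegrable (fun t => r * f t).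
Proof. by move=> fi; exact: (eq_integrable mD _ _ _ (integrableZl mD r fi)). Qed.

Lemma RintegrableB f g : Rintegrable f -> Rintegrable g -> Rintegrable (fun t => f t - g t).
Proof. by move=> fi gi; exact: (eq_integrable mD _ _ _ (integrableB mD fi gi)). Qed.

Lemma Rintegrable0 : Rintegrable (fun=> 0).
Proof. exact: integrable0. Qed.

Lemma Rintegrable_sum (I : Type) (s : seq I) (F : I -> T -> R) :
  (forall i, Rintegrable (F i)) -> Rintegrable (fun t => \sum_(i <- s) F i t).
Proof.
move=> Fi; elim: s => [|i s IH].
  by apply: eq_Rintegrable Rintegrable0 => t _; rewrite big_nil.
by apply: eq_Rintegrable (RintegrableD (Fi i) IH) => t _; rewrite big_cons.
Qed.

Lemma Rintegral0 : \int[mu]_(t in D) 0 = 0 :> R.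
Proof. by rewrite Rintegral_cst// mul0r. Qed.

Lemma Rintegral_sum (I : Type) (s : seq I) (F : I -> T -> R) :
  (forall i, Rintegrable (F i)) ->
  \int[mu]_(t in D) (\sum_(i <- s) F i t) = \sum_(i <- s) \int[mu]_(t in D) F i t.
Proof.
move=> Fi; elim: s => [|i s IH].
  under eq_Rintegral do rewrite big_nil.
  by rewrite big_nil Rintegral0.
rewrite big_cons -IH -(RintegralD mD (Fi i) (Rintegrable_sum s Fi)).
by apply: eq_Rintegral => t _; rewrite big_cons.
Qed.

Lemma le_Rintegrable f g : measurable_fun D f -> (forall t, D t -> `|f t| <= g t) ->
  Rintegrable g -> Rintegrable f.
Proof.
move=> mf fg gi; apply: (le_integrable mD _ _ gi); first exact/measurable_EFinP.
by move=> t Dt /=; rewrite lee_fin; apply: le_trans (fg _ Dt) _; exact: ler_norm.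
Qed.

Lemma ae_le_Rintegrable f g : measurable_fun D f ->
  {ae mu, forall t, D t -> `|f t| <= g t} -> Rintegrable g -> Rintegrable f.
Proof.
move=> mf fg gi; apply/integrableP; split; first exact/measurable_EFinP.
have /integrableP[mg gfin] := gi; apply: le_lt_trans gfin.
apply: ae_ge0_le_integral => //.
- by do 2 apply: measurableT_comp => //; exact/measurable_EFinP.
- exact: measurableT_comp.
apply: filterS fg => t fg Dt /=; rewrite lee_fin.
by apply: le_trans (fg Dt) _; exact: ler_norm.
Qed.

Lemma RintegrableM_bounded f g M : Rintegrable f -> measurable_fun D g ->
  (forall t, D t -> `|g t| <= M) -> Rintegrable (fun t => f t * g t).
Proof.
move=> fi mg gM; apply: (@le_Rintegrable _ (fun t => M * `|f t|)).
- by apply: measurable_funM => //; exact: Rintegrable_measurable.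
- by move=> t Dt; rewrite normrM mulrC ler_wpM2r//; exact: gM.
- by apply: RintegrableZl; exact: (integrable_norm fi).
Qed.

Lemma ae_eq_Rintegral f g : measurable_fun D f -> measurable_fun D g ->
  {ae mu, forall t, D t -> f t = g t} -> \int[mu]_(t in D) f t = \int[mu]_(t in D) g t.
Proof.
move=> mf mg fg; rewrite /Rintegral; congr fine.
apply: ae_eq_integral => //; [exact/measurable_EFinP|exact/measurable_EFinP|].
by apply: filterS fg => t fg Dt /=; rewrite fg.
Qed.

Lemma ae_cvg_series (w : nat -> T -> R) (B : R) : (forall k t, D t -> 0 <= w k t) ->
  (forall k, Rintegrable (w k)) ->
  (forall m, \sum_(0 <= k < m) \int[mu]_(t in D) w k t <= B) ->
  {ae mu, forall t, D t -> cvgn (series (w ^~ t))}.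
Proof.
move=> w0 wi wB; pose S t := (\sum_(k <oo) (w k t)%:E)%E.
have w0E k t : D t -> (0 <= (w k t)%:E)%E by move=> Dt; rewrite lee_fin w0.
have mw k : measurable_fun D (EFin \o w k) by apply/measurable_EFinP; exact: Rintegrable_measurable.
have S_int : mu.-integrable D S.
  apply/integrableP; split.
    by apply: ge0_emeasurable_sum => [k t Dt _|k _]; [exact: w0E|exact: mw].
  under eq_integral => t /[!inE] Dt.
    rewrite gee0_abs; last by apply: nneseries_ge0 => k _ _; exact: w0E.
    over.
  rewrite (integral_nneseries mu mD mw w0E); apply: (@le_lt_trans _ _ B%:E); last by rewrite ltry.
  apply: lime_le; first by apply: is_cvg_nneseries => k _ _; apply: integral_ge0 => t; exact: w0E.
  apply: nearW => m; under eq_bigr do rewrite -EFin_Rintegral//.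
  by rewrite sumEFin lee_fin.
apply: filterS (integrable_ae mD S_int) => t S_fin Dt.
apply: nondecreasing_is_cvgn.
  by apply/nondecreasing_seqP => k; rewrite seriesSr lerDl w0.
exists (fine (S t)) => _ [k _ <-]; rewrite seriesEnat /= -lee_fin fineK; last exact: S_fin.
by rewrite -sumEFin; apply: nneseries_lim_ge => j _ _; exact: w0E.
Qed.

Definition sqintegrable (f : T -> R) := measurable_fun D f /\ Rintegrable (fun t => f t ^+ 2).

Lemma sqintegrableM f g : sqintegrable f -> sqintegrable g -> Rintegrable (fun t => f t * g t).
Proof.
move=> [mf fi] [mg gi]; apply: (le_Rintegrable (g := fun t => f t ^+ 2 + g t ^+ 2)).
- exact: measurable_funM.
- move=> t _; have := sqr_ge0 (f t + g t); have := sqr_ge0 (f t - g t).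
  by rewrite ler_norml => ? ?; apply/andP; split; nra.
- exact: RintegrableD.
Qed.

Lemma sqintegrableD f g : sqintegrable f -> sqintegrable g -> sqintegrable (fun t => f t + g t).
Proof.
move=> fs gs; have fg := sqintegrableM fs gs; case: fs gs => [mf fi] [mg gi]; split.
  exact: measurable_funD.
by apply: eq_Rintegrable (RintegrableD (RintegrableD fi gi) (RintegrableZl 2 fg)) => t _; ring.
Qed.

Lemma sqintegrableZ r f : sqintegrable f -> sqintegrable (fun t => r * f t).
Proof.
move=> [mf fi]; split; first by apply: measurable_funM => //; exact: measurable_cst.
by apply: eq_Rintegrable (RintegrableZl (r ^+ 2) fi) => t _; ring.
Qed.

Lemma sqintegrableB f g : sqintegrable f -> sqintegrable g -> sqintegrable (fun t => f t - g t).
Proof.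
move=> fs gs; have := sqintegrableD fs (sqintegrableZ (-1) gs).
by congr sqintegrable; apply/funext => t; rewrite mulN1r.
Qed.

Lemma Rintegral_sqrD_le f g : sqintegrable f -> sqintegrable g ->
  \int[mu]_(t in D) ((f t + g t) ^+ 2) <=
  2 * \int[mu]_(t in D) (f t ^+ 2) + 2 * \int[mu]_(t in D) (g t ^+ 2).
Proof.
move=> fs gs; have [_ fgi] := sqintegrableD fs gs; case: fs gs => [_ fi] [_ gi].
rewrite -!RintegralZl// -RintegralD; [|by []|exact: RintegrableZl..].
apply: le_Rintegral => //; first by apply: RintegrableD; exact: RintegrableZl.
by move=> t _; have := sqr_ge0 (f t - g t); nra.
Qed.

Lemma sqintegrable_lim (u : nat -> T -> R) v (B : R) : (forall k, sqintegrable (u k)) ->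
  (forall k, \int[mu]_(t in D) (u k t ^+ 2) <= B) -> measurable_fun D v ->
  {ae mu, forall t, D t -> u ^~ t @ \oo --> v t} ->
  sqintegrable v /\ \int[mu]_(t in D) (v t ^+ 2) <= B.
Proof.
move=> us uB mv uv; pose f k t := (u k t ^+ 2)%:E.
have mf k : measurable_fun D (f k).
  by apply/measurable_EFinP; apply: Rintegrable_measurable; case: (us k).
have mv2 : measurable_fun D (fun t => (v t ^+ 2)%:E).
  by apply/measurable_EFinP; exact: measurable_funX.
have v_le : (\int[mu]_(t in D) (v t ^+ 2)%:E <= B%:E)%E.
  have -> : (\int[mu]_(t in D) (v t ^+ 2)%:E = \int[mu]_(t in D) limn_einf (f ^~ t))%E.
    apply: ae_eq_integral => //.
      rewrite /limn_einf; apply: measurableT_comp => //.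
      by apply: measurable_fun_limn_esup => k; exact: measurableT_comp.
    apply: filterS uv => t ut Dt.
    have : f ^~ t @ \oo --> (v t ^+ 2)%:E.
      by apply: cvg_EFin; [exact: nearW|rewrite expr2; apply: cvgM; exact: ut].
    by move=> /cvg_limn_einf_sup[-> _].
  apply: le_trans (fatou _ mD mf _) _; first by move=> k t _; rewrite lee_fin sqr_ge0.
  apply: le_trans (limn_einf_sup _) _; rewrite limn_esup_lim.
  apply: lime_le; first exact: is_cvg_esups.
  apply: nearW => k; apply: ge_ereal_sup => _ [j _ <-].
  by rewrite -EFin_Rintegral ?lee_fin//; case: (us j).
have vi : Rintegrable (fun t => v t ^+ 2).
  apply/integrableP; split=> //; under eq_integral do rewrite /= ger0_norm ?sqr_ge0//.
  by apply: le_lt_trans v_le _; rewrite ltry.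
by split=> //; rewrite -lee_fin EFin_Rintegral.
Qed.

Section FastCauchy.
Variables (u : nat -> T -> R) (K : R).
Hypothesis us : forall k, sqintegrable (u k).
Hypothesis u_cauchy :
  forall k, \int[mu]_(t in D) ((u k.+1 t - u k t) ^+ 2) <= K * quarter R k.

Lemma fast_cauchy_ge0 : 0 <= K.
Proof.
have := u_cauchy 0; rewrite /quarter expr0 mulr1; apply: le_trans.
by apply: Rintegral_ge0 => t _; exact: sqr_ge0.
Qed.

(* Since [|x| <= 2^-k + 2^k x^2], the summability of [2^k |u_(k+1) - u_k|^2] suffices. *)
Lemma fast_cauchy_ae_cvg : {ae mu, forall t, D t -> cvgn (u ^~ t)}.
Proof.
pose w k t := 2 ^+ k * (u k.+1 t - u k t) ^+ 2.
have di k : Rintegrable (fun t => (u k.+1 t - u k t) ^+ 2).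
  by case: (sqintegrableB (us k.+1) (us k)).
have w0 k t : 0 <= w k t by rewrite /w mulr_ge0 ?sqr_ge0 ?exprn_ge0.
have wB m : \sum_(0 <= k < m) \int[mu]_(t in D) w k t <= 2 * K * (1 - 2^-1 ^+ m).
  elim: m => [|m IH]; first by rewrite big_nil expr0 subrr mulr0.
  rewrite big_nat_recr//= (RintegralZl _ mD (di m)).
  have quarterE : 2 ^+ m * quarter R m = 2^-1 ^+ m.
    by rewrite /quarter -exprMn; congr (_ ^+ _); field.
  have := ler_wpM2l (exprn_ge0 m (ler0n R 2)) (u_cauchy m).
  by rewrite [2 ^+ m * (K * _)]mulrCA quarterE exprS; lra.
have w_cvg : {ae mu, forall t, D t -> cvgn (series (w ^~ t))}.
  apply: (@ae_cvg_series w (2 * K)).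
  - by move=> k t _; exact: w0.
  - by move=> k; exact: RintegrableZl.
  move=> m; apply: le_trans (wB m) _; apply: ler_piMr.
    by rewrite mulr_ge0// fast_cauchy_ge0.
  by rewrite lerBlDr lerDl exprn_ge0.
apply: filterS w_cvg => t w_cvg Dt.
have d_cvg : cvgn (series (fun k => u k.+1 t - u k t)).
  have half_cvg : cvgn (series (geometric 1 (2^-1 : R))).
    by apply: is_cvg_geometric_series; rewrite ger0_norm; lra.
  apply: normed_cvg; apply: series_le_cvg (is_cvg_seriesD half_cvg (w_cvg Dt)) => k /=.
  - exact: normr_ge0.
  - by apply: addr_ge0; [rewrite mulr_ge0// exprn_ge0|exact: w0].
  - by rewrite fctE /geometric /w /= mul1r exprVn normr_le_invD_sqr// exprn_gt0.
have -> : u ^~ t = (fun k => u 0 t + series (fun k => u k.+1 t - u k t) k).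
  by apply/funext => k; rewrite [LHS](eq_sum_telescope (u ^~ t)).
by apply: is_cvgD => //; exact: is_cvg_cst.
Qed.

Lemma fast_cauchy_dist k m :
  \int[mu]_(t in D) ((u (k + m)%N t - u k t) ^+ 2) <= 4 * K * quarter R k.
Proof.
elim: m k => [|m IH] k.
  under eq_Rintegral do rewrite addn0 subrr expr0n.
  by rewrite Rintegral0 !mulr_ge0 ?fast_cauchy_ge0// ltW// quarter_gt0.
have := Rintegral_sqrD_le (sqintegrableB (us (k.+1 + m)%N) (us k.+1))
  (sqintegrableB (us k.+1) (us k)).
under eq_Rintegral do rewrite addrA subrK addSnnS.
by have := IH k.+1; have := u_cauchy k; rewrite quarterS; lra.
Qed.

End FastCauchy.

Theorem sqintegrable_complete (u : nat -> T -> R) (K : R) :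
  (forall k, sqintegrable (u k)) ->
  (forall k, \int[mu]_(t in D) ((u k.+1 t - u k t) ^+ 2) <= K * quarter R k) ->
  exists v, sqintegrable v /\
    forall k, \int[mu]_(t in D) ((v t - u k t) ^+ 2) <= 4 * K * quarter R k.
Proof.
move=> us u_cauchy; pose v t := fine (limn_esup (fun k => (u k t)%:E)).
have mv : measurable_fun D v.
  apply: (measurableT_comp (f := fine)) => //.
  by apply: measurable_fun_limn_esup => k; apply/measurable_EFinP; case: (us k).
have uv : {ae mu, forall t, D t -> u ^~ t @ \oo --> v t}.
  apply: filterS (fast_cauchy_ae_cvg us u_cauchy) => t /[apply] ut.
  have uE : (fun k => (u k t)%:E) @ \oo --> (limn (u ^~ t))%:E.
    by apply: cvg_EFin => //; exact: nearW.
  by rewrite /v (cvg_limn_einf_sup uE).2.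
have dist k : sqintegrable (fun t => v t - u k t) /\
    \int[mu]_(t in D) ((v t - u k t) ^+ 2) <= 4 * K * quarter R k.
  apply: (sqintegrable_lim (u := fun m t => u (k + m)%N t - u k t)).
  - by move=> m; exact: sqintegrableB.
  - exact: fast_cauchy_dist.
  - by apply: measurable_funB => //; case: (us k).
  apply: filterS uv => t ut Dt; apply: cvgB; last exact: cvg_cst.
  by have := ut Dt; rewrite -(cvg_shiftn k); under eq_fun do rewrite addnC.
exists v; split=> [|k]; last by case: (dist k).
have := sqintegrableD (dist 0%N).1 (us 0%N).
by congr sqintegrable; apply/funext => t; rewrite subrK.
Qed.

End Rintegrable.

(** * Uniqueness of Fourier coefficients *)

Lemma bernoulli_lower (R : realFieldType) (y : R) N : 0 <= y <= 1 -> 1 - N%:R * y <= (1 - y) ^+ N.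
Proof.
move=> /andP[y0 y1]; elim: N => [|N IH]; first by rewrite mul0r subr0 expr0.
rewrite exprS; apply: le_trans (ler_wpM2l _ IH); last by rewrite subr_ge0.
by rewrite -natr1; have : 0 <= N%:R :> R by []; nra.
Qed.

Lemma bernoulli_upper (R : realFieldType) (y : R) N :
  0 <= y <= 1 -> (1 - y) ^+ N * (1 + N%:R * y) <= 1.
Proof.
move=> /andP[y0 y1]; elim: N => [|N IH]; first by rewrite mul0r addr0 expr0 mulr1.
apply: le_trans IH; rewrite exprSr -mulrA; apply: ler_wpM2l.
  by rewrite exprn_ge0// subr_ge0.
by rewrite -natr1; have : 0 <= N%:R :> R by []; nra.
Qed.

Section StepPolynomials.
Variable R : realType.
Implicit Type x : R.

(* These polynomials in [x] tend boundedly to the indicator function of [x < 1/2]. *)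
Definition step_poly k : {poly R} := (1 - 'X ^+ k) ^+ (2 ^ k).

Lemma horner_step_poly k x : (step_poly k).[x] = (1 - x ^+ k) ^+ (2 ^ k).
Proof. by rewrite /step_poly horner_exp !hornerE. Qed.

Lemma step_poly_range x k : 0 <= x <= 1 -> 0 <= (step_poly k).[x] <= 1.
Proof.
move=> /andP[x0 x1]; rewrite horner_step_poly.
have xk0 : 0 <= x ^+ k by rewrite exprn_ge0.
have xk1 : x ^+ k <= 1 by rewrite exprn_ile1.
by rewrite exprn_ge0 ?subr_ge0// exprn_ile1 ?subr_ge0// lerBlDr lerDl.
Qed.

Lemma step_poly_cvg1 x : 0 <= x < 2^-1 -> (fun k => (step_poly k).[x]) @ \oo --> (1 : R).
Proof.
move=> /andP[x0 x1].
apply: (@squeeze_cvgr _ _ _ _ (fun k => 1 - (2 * x) ^+ k) (cst 1)); last 2 first.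
- rewrite -[X in _ --> X]subr0; apply: cvgB; first exact: cvg_cst.
  by apply: cvg_expr; rewrite ger0_norm; lra.
- exact: cvg_cst.
apply: nearW => k; have x01 : 0 <= x <= 1 by lra.
have /andP[_ ->] := step_poly_range k x01; rewrite andbT exprMn -natrX horner_step_poly.
by apply: bernoulli_lower; rewrite exprn_ge0// exprn_ile1//; lra.
Qed.

Lemma step_poly_cvg0 x : 2^-1 < x <= 1 -> (fun k => (step_poly k).[x]) @ \oo --> (0 : R).
Proof.
move=> /andP[x0 x1]; have x_gt0 : 0 < x by lra.
apply: (@squeeze_cvgr _ _ _ _ (cst 0) (fun k => (2 * x)^-1 ^+ k)); last 2 first.
- exact: cvg_cst.
- apply: cvg_expr; rewrite ger0_norm ?invr_ge0; last by lra.
  by rewrite invf_lt1; lra.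
apply: nearW => k; have x01 : 0 <= x <= 1 by lra.
have /andP[-> _] := step_poly_range k x01; rewrite /= horner_step_poly.
have xk01 : 0 <= x ^+ k <= 1 by rewrite exprn_ge0 ?exprn_ile1//; lra.
have := @bernoulli_upper _ _ (2 ^ k) xk01.
have x2_gt0 : 0 < (2 * x) ^+ k by rewrite exprn_gt0//; lra.
have -> : (2 ^ k)%:R * x ^+ k = (2 * x) ^+ k by rewrite natrX exprMn.
set q := (1 - _) ^+ _; have q0 : 0 <= q by rewrite exprn_ge0// subr_ge0; case/andP: xk01.
by move=> q_le; rewrite exprVn -[X in _ <= X]mul1r ler_pdivlMr//; lra.
Qed.

End StepPolynomials.

#[local] Instance ae_lebesgue_filter (R : realType) :
  Filter (almost_everywhere (@lebesgue_measure R)).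
Proof. exact: ae_filter_ringOfSetsType. Qed.

Section Circle.
Variable R : realType.
Local Notation mu := (@lebesgue_measure R).
Local Notation D := (@Tdom R).

(* Lebesgue measure lives on [measurableTypeR R], whose display differs from that of [R]. *)
Definition circle_measurable (f : R -> R) := measurable_fun (D : set (measurableTypeR R)) f.

Lemma measurable_Tdom : measurable (D : set (measurableTypeR R)).
Proof. exact: measurable_itv. Qed.

Lemma lebesgue_measure_Tdom : mu D = 1%:E.
Proof. by rewrite /Tdom lebesgue_measure_itv /= lte_fin ltr01 oppr0 adde0. Qed.

Lemma Rintegrable_Tdom_cst r : Rintegrable mu D (fun=> r).
Proof.
apply: measurable_bounded_integrable; first exact: measurable_Tdom.
- by have := lebesgue_measure_Tdom; rewrite /= => ->; rewrite ltry.
- exact: measurable_cst.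
- exact: bounded_cst.
Qed.

Lemma Rintegral_Tdom_cst r : \int[mu]_(t in D) r = r.
Proof.
transitivity (r * fine (mu D)); first exact: (Rintegral_cst _ measurable_Tdom).
by rewrite lebesgue_measure_Tdom mulr1.
Qed.

Lemma ae_neq (x : R) : {ae mu, forall t, t != x}.
Proof.
exists [set x]; split; [exact: measurable_set1|exact: lebesgue_measure_set1|].
by move=> t /= /negP; rewrite negbK => /eqP.
Qed.

Definition wave (j : int) (a t : R) : R := cos (2 * pi * j%:~R * t - a).

Lemma circle_measurable_wave j a : circle_measurable (wave j a).
Proof.
apply: (@measurable_funS _ _ _ _ setT) => //.
apply: continuous_measurable_fun => t; apply: continuous_comp.
  apply: cvgB; last exact: cvg_cst.
  by apply: cvgM; [exact: cvg_cst|exact: cvg_id].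
exact: continuous_cos.
Qed.

Lemma normr_wave_le1 j a t : `|wave j a t| <= 1. Proof. exact: cos_max. Qed.

Lemma wave0 a t : wave 0 a t = cos a.
Proof. by rewrite /wave mulr0 mul0r sub0r cosN. Qed.

Lemma waveM j k a c t :
  wave j a t * wave k c t = 2^-1 * (wave (j + k) (a + c) t + wave (j - k) (a - c) t).
Proof.
rewrite /wave rmorphB rmorphD.
have -> : 2 * pi * (j%:~R + k%:~R) * t - (a + c) =
  (2 * pi * j%:~R * t - a) + (2 * pi * k%:~R * t - c) by ring.
have -> : 2 * pi * (j%:~R - k%:~R) * t - (a - c) =
  (2 * pi * j%:~R * t - a) - (2 * pi * k%:~R * t - c) by ring.
move: (2 * pi * j%:~R * t - a) (2 * pi * k%:~R * t - c) => x y.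
by rewrite cosB cosD; field.
Qed.

Section Annihilator.
Variable g : R -> R.
Hypothesis gi : Rintegrable mu D g.

Definition annihilates (phi : R -> R) := exists M : R, [/\ circle_measurable phi,
  forall t, `|phi t| <= M & forall j a, \int[mu]_(t in D) (g t * phi t * wave j a t) = 0].

Lemma Rintegrable_wave phi M j a : circle_measurable phi -> (forall t, `|phi t| <= M) ->
  Rintegrable mu D (fun t => g t * phi t * wave j a t).
Proof.
move=> mphi phiM.
apply: (@RintegrableM_bounded _ _ _ _ _ measurable_Tdom _ _ 1) => [||t _].
- exact: (RintegrableM_bounded measurable_Tdom gi mphi (fun t _ => phiM t)).
- exact: circle_measurable_wave.
- exact: normr_wave_le1.
Qed.

Lemma annihilates_lin r phi psi : annihilates phi -> annihilates psi ->
  annihilates (fun t => r * phi t + psi t).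
Proof.
move=> [M [mphi phiM phi0]] [N [mpsi psiN psi0]]; exists (`|r| * M + N); split.
- by apply: measurable_funD => //; apply: measurable_funM => //; exact: measurable_cst.
- by move=> t; apply: le_trans (ler_normD _ _) _; rewrite lerD// normrM ler_wpM2l.
move=> j a; have phi_i := Rintegrable_wave j a mphi phiM.
have psi_i := Rintegrable_wave j a mpsi psiN.
transitivity (\int[mu]_(t in D)
    (r * (g t * phi t * wave j a t) + g t * psi t * wave j a t)).
  by apply: eq_Rintegral => t _; ring.
rewrite (RintegralD measurable_Tdom (RintegrableZl measurable_Tdom r phi_i) psi_i).
by rewrite (RintegralZl _ measurable_Tdom phi_i) phi0 psi0 mulr0 addr0.
Qed.

Lemma annihilates_wave phi k c : annihilates phi -> annihilates (fun t => phi t * wave k c t).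
Proof.
move=> [M [mphi phiM phi0]]; exists M; split.
- by apply: measurable_funM => //; exact: circle_measurable_wave.
- by move=> t; rewrite normrM; apply: le_trans (phiM t); rewrite ler_piMr// normr_wave_le1.
move=> j a; have phi_i j' a' := Rintegrable_wave j' a' mphi phiM.
transitivity (\int[mu]_(t in D) (2^-1 * (g t * phi t * wave (j + k) (a + c) t +
    g t * phi t * wave (j - k) (a - c) t))).
  apply: eq_Rintegral => t _; by rewrite -mulrDr [RHS]mulrCA -waveM; ring.
rewrite (RintegralZl _ measurable_Tdom (RintegrableD measurable_Tdom (phi_i _ _) (phi_i _ _))).
by rewrite (RintegralD measurable_Tdom (phi_i _ _) (phi_i _ _)) !phi0 addr0 mulr0.
Qed.

Lemma annihilates_lim (phi : nat -> R -> R) (psi : R -> R) : (forall k, annihilates (phi k)) ->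
  (forall k t, `|phi k t| <= 1) -> circle_measurable psi ->
  {ae mu, forall t, D t -> phi ^~ t @ \oo --> psi t} ->
  \int[mu]_(t in D) (g t * psi t) = 0.
Proof.
move=> phi_ann phi1 mpsi phi_cvg; have mg := Rintegrable_measurable gi.
have mphi k : circle_measurable (phi k) by have [M []] := phi_ann k.
have mE (f : R -> R) : circle_measurable f ->
    measurable_fun (D : set (measurableTypeR R)) (EFin \o f).
  by move=> mf; exact/measurable_EFinP.
have fg_cvg : {ae mu, forall t, D t ->
    (fun k => (EFin \o (fun t => g t * phi k t)) t) @ \oo --> (EFin \o (fun t => g t * psi t)) t}.
  apply: filterS phi_cvg => t phi_cvg Dt; apply: cvg_EFin; first exact: nearW.
  by apply: cvgM; [exact: cvg_cst|exact: phi_cvg].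
have fg_le : {ae mu, forall t k, D t ->
    (`|(EFin \o (fun t => (g t * phi k t)%R)) t| <= (EFin \o (fun t => `|g t|%R)) t)%E}.
  by apply: aeW => t k Dt /=; rewrite lee_fin normrM ler_piMr.
have [_ _] := dominated_convergence measurable_Tdom
  (fun k => mE _ (measurable_funM mg (mphi k))) (mE _ (measurable_funM mg mpsi))
  fg_cvg (integrable_norm gi) fg_le.
have -> : (fun k => (\int[mu]_(t in D) (EFin \o (fun t => (g t * phi k t)%R)) t)%E) = fun=> 0%E.
  apply/funext => k; have [M [_ phiM phi0]] := phi_ann k.
  have gphi_i := RintegrableM_bounded measurable_Tdom gi (mphi k) (fun t _ => phiM t).
  rewrite -(EFin_Rintegral measurable_Tdom gphi_i); congr (_%:E).
  rewrite -[RHS](phi0 0 0); apply: eq_Rintegral => t _.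
  by rewrite wave0 cos0 mulr1.
by move=> /cvg_lim; rewrite lim_cst// /Rintegral => /(_ _)/esym ->.
Qed.

Hypothesis g_wave : forall j a, \int[mu]_(t in D) (g t * wave j a t) = 0.

Lemma annihilates_cst r : annihilates (fun=> r).
Proof.
exists `|r|; split=> [|//|j a]; first exact: measurable_cst.
transitivity (\int[mu]_(t in D) (r * (g t * wave j a t))).
  by apply: eq_Rintegral => t _; ring.
rewrite (RintegralZl _ measurable_Tdom) ?g_wave ?mulr0//.
exact: (RintegrableM_bounded measurable_Tdom gi (circle_measurable_wave j a)
  (fun t _ => normr_wave_le1 j a t)).
Qed.

Lemma annihilates_horner k c (p : {poly R}) : annihilates (fun t => p.[wave k c t]).
Proof.
elim/poly_ind: p => [|p r IH].
  by under eq_fun do rewrite horner0; exact: annihilates_cst.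
under eq_fun do rewrite hornerMXaddC -[_ * _]mul1r.
by apply: annihilates_lin; [exact: annihilates_wave|exact: annihilates_cst].
Qed.

Lemma wave1_gt (x t : R) : 0 < t < x -> x < 1 -> cos (pi * x) < wave 1 (pi * x) t.
Proof.
move=> /andP[t0 tx] x1; have pi0 := pi_gt0 R.
rewrite /wave mulr1 -(cos_norm (2 * pi * t - pi * x)) ltr_cos ?in_itv/=.
- by rewrite ltr_norml; apply/andP; split; nra.
- by rewrite normr_ge0 ler_norml; apply/andP; split; nra.
- by apply/andP; split; nra.
Qed.

Lemma wave1_lt (x t : R) : 0 < x < t -> t < 1 -> wave 1 (pi * x) t < cos (pi * x).
Proof.
move=> /andP[x0 xt] t1; have pi0 := pi_gt0 R; rewrite /wave mulr1.
have [le_pi|gt_pi] := leP (2 * pi * t - pi * x) pi.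
  by rewrite ltr_cos ?in_itv/=; [nra|apply/andP; split; nra..].
have -> : cos (2 * pi * t - pi * x) = cos (2 * pi - (2 * pi * t - pi * x)).
  by rewrite -cosN -[LHS]cosD2pi; congr cos; rewrite mulr2n; ring.
by rewrite ltr_cos ?in_itv/=; [nra|apply/andP; split; nra..].
Qed.

(* [y] maps the wave to [[0, 1]] and its value [cos (pi x)] at [0] and [x] to [1/2], so that
   the step polynomials in [y] tend to the indicator function of [[0, x]]. *)
Lemma initial_integral_eq0 (x : R) : 0 < x < 1 ->
  \int[mu]_(t in D) (g t * (t <= x)%R%:R) = 0.
Proof.
move=> /andP[x0 x1]; pose y c : R := 2^-1 + (cos (pi * x) - c) / 4.
pose phi k t := (step_poly R k).[y (wave 1 (pi * x) t)].
have y01 t : 0 <= y (wave 1 (pi * x) t) <= 1.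
  have := cos_max (pi * x); have := normr_wave_le1 1 (pi * x) t.
  by rewrite !ler_norml /y => /andP[? ?] /andP[? ?]; lra.
apply: (@annihilates_lim phi) => [k|k t||].
- have -> : phi k = fun t =>
    (step_poly R k \Po ((2^-1 + cos (pi * x) / 4)%:P - 4^-1 *: 'X)).[wave 1 (pi * x) t].
    by apply/funext => t; rewrite /phi horner_comp; congr horner; rewrite !hornerE /y; field.
  exact: annihilates_horner.
- by have /andP[? ?] := step_poly_range k (y01 t); rewrite ger0_norm.
- have -> : (fun t => (t <= x)%R%:R) = \1_(`]-oo, x]) :> (R -> R).
    apply/funext => t; rewrite indicE; case: (leP t x) => tx.
      by rewrite mem_set//= in_itv.
    by rewrite memNset//= in_itv /= => /(lt_le_trans tx); rewrite ltxx.
  by apply: measurable_indic; exact: measurable_itv.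
apply: filterS (filterI (ae_neq 0) (filterI (ae_neq x) (ae_neq 1))) => t [tn0 [tnx tn1]].
rewrite /Tdom /= in_itv /= => /andP[t_ge0 t_le1].
have t0 : 0 < t by rewrite lt_def tn0. have t1 : t < 1 by rewrite lt_neqAle tn1.
have [tx|tx] := leP t x.
  have {}tx : t < x by rewrite lt_neqAle tnx.
  apply: step_poly_cvg1; rewrite (andP (y01 t)).1 /=.
  by have := @wave1_gt x t; rewrite t0 tx => /(_ isT x1); rewrite /y; lra.
apply: step_poly_cvg0; rewrite (andP (y01 t)).2 andbT.
by have := @wave1_lt x t; rewrite x0 tx => /(_ isT t1); rewrite /y; lra.
Qed.

Lemma initial_Rintegral_eq0 (x : R) : 0 < x < 1 -> \int[mu]_(t in `[0, x]) g t = 0.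
Proof.
move=> x01; rewrite -[RHS](initial_integral_eq0 x01) [RHS]Rintegral_mkcond [LHS]Rintegral_mkcond.
congr Rintegral; apply/funext => t; rewrite !patchE /Tdom; case: (leP t x) => tx.
  rewrite mulr1; congr (if _ then _ else _); apply/idP/idP; rewrite !inE /= !in_itv /= tx andbT.
    by move=> ->; rewrite (le_trans tx)//; lra.
  by case/andP.
rewrite mulr0 if_same memNset//= in_itv /= => /andP[_ /(lt_le_trans tx)].
by rewrite ltxx.
Qed.

Theorem fourier_unique : {ae mu, forall t, D t -> g t = 0}.
Proof.
have g_loc : locally_integrable [set: R] (g \_ D).
  by apply: integrable_locally => //; exact: measurable_Tdom.
have gD_int : mu.-integrable setT (EFin \o (g \_ D)).
  rewrite -restrict_EFin; apply/integrable_restrict; first exact: measurable_Tdom.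
    exact: measurableT.
  by rewrite setTI.
have gx_int x : mu.-integrable [set` Interval (BLeft 0) (BRight x)] (EFin \o (g \_ D)).
  have mI : measurable ([set` Interval (BLeft 0) (BRight x)] : set (measurableTypeR R)).
    exact: measurable_itv.
  exact: (integrableS measurableT mI (@subsetT _ _) gD_int).
have := FTC1 gx_int g_loc; set G := (fun x => _) => dG.
apply: filterS (filterI dG (filterI (ae_neq 0) (ae_neq 1))) => t [/= dGt [tn0 tn1]].
rewrite /Tdom /= in_itv /= => /andP[t_ge0 t_le1].
have t0 : 0 < t by rewrite lt_def tn0.
have t1 : t < 1 by rewrite lt_neqAle tn1.
have G0 y : 0 < y < 1 -> G y = 0.
  move=> y01; rewrite -(initial_Rintegral_eq0 y01); apply: eq_Rintegral => s.
  rewrite inE /= in_itv /= patchE => /andP[s0 sy].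
  by rewrite mem_set// /Tdom /= in_itv /= s0 /=; lra.
have t0E : (0%:E < t%:E)%E by rewrite lte_fin.
have [_] := dGt t0E; rewrite patchE mem_set; last by rewrite /Tdom /= in_itv /= t_ge0.
move=> <-; rewrite derive1E (@near_eq_derive _ _ _ _ (cst 0)) ?derive_cst//.
near=> y; apply: G0; apply/andP; split; near: y; [exact: lt_nbhsr|exact: lt_nbhsl].
Unshelve. all: by end_near. Qed.

End Annihilator.
End Circle.

(** * The space of square integrable vector functions *)

Section ComplexVectors.
Variable R : realType.
Local Notation C := (R[i]).
Local Notation Re := (@complex.Re R).
Local Notation Im := (@complex.Im R).
Local Open Scope complex_scope.

Lemma complex_ext (x y : C) : Re x = Re y -> Im x = Im y -> x = y.
Proof. by case: x y => ? ? [? ?] /= -> ->. Qed.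

Lemma Re_mul (x y : C) : Re (x * y) = Re x * Re y - Im x * Im y.
Proof. by case: x y => ? ? []. Qed.

Lemma Im_mul (x y : C) : Im (x * y) = Re x * Im y + Im x * Re y.
Proof. by case: x y => ? ? []. Qed.

Lemma Re_conjc (x : C) : Re x^* = Re x. Proof. by case: x. Qed.

Lemma Im_conjc (x : C) : Im x^* = - Im x. Proof. by case: x. Qed.

Lemma cabs2_ge0 (x : C) : 0 <= cabs2 x.
Proof. by rewrite addr_ge0// sqr_ge0. Qed.

Lemma cabs2M (x y : C) : cabs2 (x * y) = cabs2 x * cabs2 y.
Proof. by rewrite /cabs2 Re_mul Im_mul; ring. Qed.

Lemma cabs2D_le (x y : C) : cabs2 (x + y) <= 2 * cabs2 x + 2 * cabs2 y.
Proof.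
rewrite /cabs2 !raddfD; have := sqr_ge0 (Re x - Re y).
by have := sqr_ge0 (Im x - Im y); nra.
Qed.

Lemma cabs2_sum_le (I : Type) (s : seq I) (F : I -> C) :
  cabs2 (\sum_(i <- s) F i) <= 2 ^+ size s * \sum_(i <- s) cabs2 (F i).
Proof.
elim: s => [|i s IH]; first by rewrite !big_nil /cabs2 /= expr0n addr0 mulr0.
rewrite !big_cons /=; apply: le_trans (cabs2D_le _ _) _; rewrite exprS.
have : 1 <= 2 ^+ size s :> R by rewrite exprn_ege1// ler1n.
by have := cabs2_ge0 (F i); nra.
Qed.

Lemma vnorm2_ge0 n (v : 'cV[C]_n) : 0 <= vnorm2 v.
Proof. by apply: sumr_ge0 => i _; exact: cabs2_ge0. Qed.

Lemma cabs2_le_vnorm2 n (v : 'cV[C]_n) i : cabs2 (v i 0) <= vnorm2 v.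
Proof. by rewrite /vnorm2 (bigD1 i)//= lerDl sumr_ge0// => j _; exact: cabs2_ge0. Qed.

Lemma adjmxK m n (A : 'M[C]_(m, n)) : adjmx (adjmx A) = A.
Proof. by apply/matrixP => i j; rewrite !mxE conjcK. Qed.

Lemma adjmxM m n p (A : 'M[C]_(m, n)) (B : 'M[C]_(n, p)) :
  adjmx (A *m B) = adjmx B *m adjmx A.
Proof. by rewrite /adjmx map_mxM trmx_mul. Qed.

Lemma adjmxZ m n c (A : 'M[C]_(m, n)) : adjmx (c *: A) = c^* *: adjmx A.
Proof. by rewrite /adjmx map_mxZ linearZ. Qed.

Lemma adjmx_delta m n i j : adjmx (delta_mx i j : 'M[C]_(m, n)) = delta_mx j i.
Proof. by rewrite /adjmx map_delta_mx trmx_delta. Qed.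

Definition hdot n (v w : 'cV[C]_n) : C := (adjmx w *m v) 0 0.

Lemma hdotE n (v w : 'cV[C]_n) : hdot v w = \sum_i v i 0 * (w i 0)^*.
Proof. by rewrite /hdot mxE; apply: eq_bigr => i _; rewrite !mxE mulrC. Qed.

Lemma hdotZl n c (v w : 'cV[C]_n) : hdot (c *: v) w = c * hdot v w.
Proof. by rewrite /hdot -scalemxAr mxE. Qed.

Lemma hdotZr n c (v w : 'cV[C]_n) : hdot v (c *: w) = c^* * hdot v w.
Proof. by rewrite /hdot adjmxZ -scalemxAl mxE. Qed.

Lemma hdot_adj m n (A : 'M[C]_(m, n)) v w : hdot (A *m v) w = hdot v (adjmx A *m w).
Proof. by rewrite /hdot adjmxM adjmxK mulmxA. Qed.

Lemma hdot_delta n (v : 'cV[C]_n) i : hdot v (delta_mx i 0) = v i 0.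
Proof. by rewrite /hdot adjmx_delta -rowE mxE. Qed.

Definition rcoord n (v : 'cV[C]_n) (p : 'I_n * bool) : R :=
  (if p.2 then Im else Re) (v p.1 0).

Lemma rcoord0 n p : rcoord (0 : 'cV[C]_n) p = 0.
Proof. by rewrite /rcoord mxE; case: p.2. Qed.

Lemma rcoordD n (v w : 'cV[C]_n) p : rcoord (v + w) p = rcoord v p + rcoord w p.
Proof. by rewrite /rcoord mxE; case: p.2; rewrite raddfD. Qed.

Lemma rcoordB n (v w : 'cV[C]_n) p : rcoord (v - w) p = rcoord v p - rcoord w p.
Proof. by rewrite /rcoord !mxE; case: p.2; rewrite raddfB. Qed.

Lemma rcoordZ n (c : C) (v : 'cV[C]_n) p :
  rcoord (c *: v) p = Re c * rcoord v p + Im c * rcoord ('i *: v) p.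
Proof.
by rewrite /rcoord !mxE; case: p.2; rewrite !(Re_mul, Im_mul) /=; ring.
Qed.

Lemma rcoordJ n (v : 'cV[C]_n) i s :
  rcoord ('i *: v) (i, s) = (-1) ^+ (~~ s) * rcoord v (i, ~~ s).
Proof.
by rewrite /rcoord !mxE; case: s; rewrite /= ?Re_mul ?Im_mul /=; ring.
Qed.

Lemma measurable_rcoord n (f : R -> 'cV[C]_n) : mx_measurable f <->
  forall p, measurable_fun (@Tdom R) (fun t => rcoord (f t) p).
Proof.
split=> [mf [i []]|mf i j]; [by case: (mf i 0)..|].
by rewrite ord1; split; [exact: (mf (i, false))|exact: (mf (i, true))].
Qed.

Definition rdot n (v w : 'cV[C]_n) : R := \sum_p rcoord v p * rcoord w p.

Lemma rdotE n (v w : 'cV[C]_n) :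
  rdot v w = \sum_i (Re (v i 0) * Re (w i 0) + Im (v i 0) * Im (w i 0)).
Proof.
rewrite /rdot -(pair_bigA _ (fun i s => rcoord v (i, s) * rcoord w (i, s))).
by apply: eq_bigr => i _; rewrite big_bool addrC.
Qed.

Lemma rdotxx n (v : 'cV[C]_n) : rdot v v = vnorm2 v.
Proof. by rewrite rdotE; apply: eq_bigr => i _; rewrite /cabs2 !expr2. Qed.

Lemma rdotC n (v w : 'cV[C]_n) : rdot v w = rdot w v.
Proof. by apply: eq_bigr => p _; rewrite mulrC. Qed.

Lemma rdotDl n (u v w : 'cV[C]_n) : rdot (u + v) w = rdot u w + rdot v w.
Proof. by rewrite -big_split; apply: eq_bigr => p _; rewrite rcoordD mulrDl. Qed.

Lemma rdotZl n (r : R) (v w : 'cV[C]_n) : rdot (r%:C *: v) w = r * rdot v w.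
Proof.
by rewrite mulr_sumr; apply: eq_bigr => p _; rewrite rcoordZ /= mul0r addr0 mulrA.
Qed.

Lemma Re_hdot n (v w : 'cV[C]_n) : Re (hdot v w) = rdot v w.
Proof.
rewrite hdotE rdotE raddf_sum; apply: eq_bigr => i _.
by rewrite [LHS]Re_mul Re_conjc Im_conjc mulrN opprK.
Qed.

Lemma Im_hdot n (v w : 'cV[C]_n) : Im (hdot v w) = rdot v ('i *: w).
Proof. by rewrite -Re_hdot hdotZr Re_mul /=; ring. Qed.

Lemma rdot_adj m n (A : 'M[C]_(m, n)) v w : rdot (A *m v) w = rdot v (adjmx A *m w).
Proof. by rewrite -!Re_hdot hdot_adj. Qed.

Lemma rdot_unimodular n (c : C) (v w : 'cV[C]_n) : cabs2 c = 1 ->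
  rdot (c *: v) (c *: w) = rdot v w.
Proof.
move=> c1; rewrite -!Re_hdot hdotZl hdotZr mulrA; suff -> : c * c^* = 1 by rewrite mul1r.
move: c1; rewrite /cabs2; case: c => x y /= c1; apply: complex_ext => /=; last by ring.
by rewrite -c1; ring.
Qed.

End ComplexVectors.

Section L2Space.
Variables (R : realType) (n : nat).
Local Notation C := (R[i]).
Local Notation mu := (@lebesgue_measure R).
Local Notation D := (@Tdom R).
Local Notation mD := (@measurable_Tdom R).
Local Notation sqintegrable := (sqintegrable mu D).
Local Open Scope complex_scope.

Lemma L2_rcoord (f : R -> 'cV[C]_n) : L2 f <-> forall p, sqintegrable (fun t => rcoord (f t) p).
Proof.
have rdotE t : vnorm2 (f t) = \sum_p rcoord (f t) p ^+ 2.
  by rewrite -rdotxx; apply: eq_bigr => p _; rewrite expr2.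
split=> [[/measurable_rcoord mf fi] p|fs].
  split; first exact: mf.
  apply: (le_Rintegrable mD _ _ fi); first exact: (measurable_funX _ (mf p)).
  move=> t _; rewrite ger0_norm ?sqr_ge0// rdotE (bigD1 p)//= lerDl.
  by rewrite sumr_ge0// => i _; exact: sqr_ge0.
split; first by apply/measurable_rcoord => p; case: (fs p).
apply: eq_Rintegrable (Rintegrable_sum mD _ (fun p => (fs p).2)) => [|t _]; first exact: mD.
by rewrite rdotE.
Qed.

Definition L2_pred : {pred (R -> 'cV[C]_n)} := fun f => `[< L2 f >].

Lemma L2_submod_closed : submod_closed L2_pred.
Proof.
split=> [|c f g /asboolP/L2_rcoord fs /asboolP/L2_rcoord gs]; apply/asboolP/L2_rcoord => p.
  under eq_fun do rewrite rcoord0.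
  split; first exact: measurable_cst.
  by under eq_fun do rewrite expr0n; exact: Rintegrable0.
have Jfs : sqintegrable (fun t => rcoord ('i *: f t) p).
  by case: p => i s; under eq_fun do rewrite rcoordJ; exact: (sqintegrableZ mD).
under eq_fun do rewrite rcoordD rcoordZ.
by do !apply: (sqintegrableD mD) => //; exact: (sqintegrableZ mD).
Qed.

HB.instance Definition _ :=
  GRing.isSubmodClosed.Build C (R -> 'cV[C]_n) L2_pred L2_submod_closed.

Record L2space := L2Space { L2fun :> R -> 'cV[C]_n; L2funP : L2fun \in L2_pred }.
HB.instance Definition _ := [isSub for L2fun].
HB.instance Definition _ := [Choice of L2space by <:].
HB.instance Definition _ := [SubChoice_isSubLmodule of L2space by <:].

Definition toL2 (f : R -> 'cV[C]_n) (fL : L2 f) : L2space :=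
  L2Space (introT (asboolP _) fL : f \in L2_pred).

Lemma L2fun_L2 (f : L2space) : L2 f.
Proof. by case: f => f /= /asboolP. Qed.

Lemma L2space_ext (f g : L2space) : (forall t, f t = g t) -> f = g.
Proof. by move=> fg; apply: val_inj; apply/funext. Qed.

Lemma L2funD (f g : L2space) t : (f + g) t = f t + g t. Proof. by []. Qed.

Lemma L2funB (f g : L2space) t : (f - g) t = f t - g t. Proof. by []. Qed.

Lemma L2funZ c (f : L2space) t : (c *: f) t = c *: f t. Proof. by []. Qed.

Lemma sqintegrable_rcoord (f : L2space) p : sqintegrable (fun t => rcoord (f t) p).
Proof. by have /L2_rcoord := L2fun_L2 f. Qed.

Lemma Rintegrable_rdot (f g : L2space) : Rintegrable mu D (fun t => rdot (f t) (g t)).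
Proof.
by apply: (Rintegrable_sum mD) => p; apply: (sqintegrableM mD); exact: sqintegrable_rcoord.
Qed.

Definition ip (f g : L2space) : R := \int[mu]_(t in D) rdot (f t) (g t).

Lemma ip_semi_inner : semi_inner ip.
Proof.
split=> [f g h|f g|r f g|f g|f].
- rewrite -(RintegralD mD (Rintegrable_rdot _ _) (Rintegrable_rdot _ _)).
  by apply: eq_Rintegral => t _; rewrite -rdotDl.
- by apply: eq_Rintegral => t _; rewrite rdotC.
- rewrite -(RintegralZl _ mD (Rintegrable_rdot _ _)).
  by apply: eq_Rintegral => t _; rewrite -rdotZl.
- apply: eq_Rintegral => t _; apply: rdot_unimodular.
  by rewrite /cabs2 /= expr0n expr1n add0r.
- by apply: Rintegral_ge0 => t _; rewrite rdotxx vnorm2_ge0.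
Qed.

Lemma normsq_ip (f : L2space) : normsq ip f = \int[mu]_(t in D) vnorm2 (f t).
Proof. by apply: eq_Rintegral => t _; exact: rdotxx. Qed.

Lemma normsq_ip_rcoord (f : L2space) :
  normsq ip f = \sum_p \int[mu]_(t in D) (rcoord (f t) p ^+ 2).
Proof.
rewrite -(Rintegral_sum mD _ (fun p => (sqintegrable_rcoord f p).2)).
by apply: eq_Rintegral => t _; apply: eq_bigr => p _; rewrite expr2.
Qed.

Lemma rcoord_le_normsq_ip (f : L2space) p :
  \int[mu]_(t in D) (rcoord (f t) p ^+ 2) <= normsq ip f.
Proof.
rewrite normsq_ip_rcoord (bigD1 p)//= lerDl sumr_ge0// => i _.
by apply: Rintegral_ge0 => t _; exact: sqr_ge0.
Qed.

Theorem ip_complete : complete_for ip (fun=> True).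
Proof.
move=> u _ [K uK].
have /choice[w wP] p : exists w, sqintegrable w /\ forall k,
    \int[mu]_(t in D) ((w t - rcoord (u k t) p) ^+ 2) <= 4 * K * quarter R k.
  apply: (sqintegrable_complete mD) => k; first exact: sqintegrable_rcoord.
  apply: le_trans (uK k); apply: le_trans (rcoord_le_normsq_ip _ p).
  by under [leRHS]eq_Rintegral do rewrite L2funB rcoordB.
pose v t : 'cV[C]_n := \col_i Complex (w (i, false) t) (w (i, true) t).
have vE t p : rcoord (v t) p = w p t by case: p => i []; rewrite /rcoord mxE.
have vL : L2 v by apply/L2_rcoord => p; under eq_fun do rewrite vE; case: (wP p).
exists (toL2 vL) => //; exists (\sum_(p : 'I_n * bool) 4 * K) => k.
rewrite normsq_ip_rcoord mulr_suml; apply: ler_sum => p _.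
by under eq_Rintegral do rewrite L2funB rcoordB vE; case: (wP p).
Qed.

Lemma cform_ip (f g : L2space) : cform ip f g = cint (fun t => hdot (f t) (g t)).
Proof.
by apply: complex_ext; apply: eq_Rintegral => t _; rewrite ?Re_hdot ?Im_hdot.
Qed.

End L2Space.

Section Exponentials.
Variable R : realType.
Local Notation C := (R[i]).
Local Notation Re := (@complex.Re R).
Local Notation Im := (@complex.Im R).
Local Notation mu := (@lebesgue_measure R).
Local Notation D := (@Tdom R).
Local Notation mD := (@measurable_Tdom R).
Local Notation Rintegrable := (Rintegrable mu D).
Local Open Scope complex_scope.

Definition zpow (j : int) (t : R) : C :=
  Complex (cos (2 * pi * j%:~R * t)) (sin (2 * pi * j%:~R * t)).

Lemma Re_zpow j t : Re (zpow j t) = wave j 0 t.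
Proof. by rewrite /wave subr0. Qed.

Lemma Im_zpow j t : Im (zpow j t) = wave j (pi / 2) t.
Proof. by rewrite /wave cosBpihalf. Qed.

Lemma zpowD j k t : zpow (j + k) t = zpow j t * zpow k t.
Proof.
have E : 2 * pi * (j + k)%:~R * t = 2 * pi * j%:~R * t + 2 * pi * k%:~R * t.
  by rewrite rmorphD; ring.
by apply: complex_ext; rewrite ?Re_mul ?Im_mul /= E ?cosD ?sinD; ring.
Qed.

Lemma zpow0 t : zpow 0 t = 1.
Proof. by apply: complex_ext; rewrite /= mulr0 mul0r ?cos0 ?sin0. Qed.

Lemma conjc_zpow j t : (zpow j t)^* = cexpm j t.
Proof. by []. Qed.

Lemma cexpmN j t : cexpm (- j) t = zpow j t.
Proof. by apply: complex_ext; rewrite /= rmorphN mulrN mulNr ?cosN ?sinN ?opprK. Qed.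

Lemma cabs2_zpow j t : cabs2 (zpow j t) = 1.
Proof. by rewrite /cabs2 /= cos2Dsin2. Qed.

Lemma Rintegral_Tdom_derive (F f : R -> R) :
  (forall t : R, is_derive t (1 : R) F (f t)) -> continuous f ->
  \int[mu]_(t in D) f t = F 1 - F 0.
Proof.
move=> dF cf; have dFx (t : R) : derivable F t 1 by case: (dF t).
have cF : continuous F.
  by move=> t; apply: differentiable_continuous; exact/derivable1_diffP.
rewrite /Rintegral (@continuous_FTC2 _ f F 0 1)//=.
- exact: continuous_subspaceT.
- split=> //; first exact: cvg_at_right_filter (cF 0).
  exact: cvg_at_left_filter (cF 1).
- by move=> t _; rewrite derive1E derive_val.
Qed.

Lemma wave_period j a : wave j a 1 = wave j a 0 :> R.
Proof.
rewrite /wave mulr0 mulr1.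
wlog: j a / 0 <= j => [pos|]; last case: j => // k _.
  have [/pos->//|/ltW j0] := leP 0 j.
  rewrite -cosN -[RHS]cosN; have := pos (- j) (- a); rewrite oppr_ge0 => /(_ j0).
  by rewrite rmorphN !sub0r => <-; congr cos; ring.
rewrite sub0r -[RHS](periodicn (@cosD2pi R) k); congr cos.
by rewrite -mulr_natr -(mulr_natr pi) -pmulrn; ring.
Qed.

Lemma Rintegral_wave j a : \int[mu]_(t in D) wave j a t = (j == 0)%:R * cos a.
Proof.
have [->|j0] := eqVneq j 0.
  by under eq_Rintegral do rewrite wave0; rewrite Rintegral_Tdom_cst mul1r.
pose w : R := 2 * pi * j%:~R.
have w0 : w != 0 by rewrite !mulf_neq0 ?intr_eq0// gt_eqF// pi_gt0.
have sinE t : sin (w * t - a) = wave j (a + pi / 2) t.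
  by rewrite /wave -/w opprD addrA cosBpihalf.
have dwave (t : R) : is_derive t (1 : R) (fun t => w^-1 * sin (w * t - a)) (wave j a t).
  apply: is_derive_eq; rewrite /GRing.scale /= /wave -/w.
  by rewrite !(mulr1, mulr0, add0r, addr0, subr0, oppr0); field.
rewrite (Rintegral_Tdom_derive dwave) => [|t].
  by rewrite !sinE wave_period subrr mul0r.
apply: continuous_comp; last exact: continuous_cos.
by apply: cvgB; last exact: cvg_cst; apply: cvgM; [exact: cvg_cst|exact: cvg_id].
Qed.

Lemma cint_zpow j : cint (zpow j) = (j == 0)%:R.
Proof.
apply: complex_ext.
  transitivity (\int[mu]_(t in D) wave j 0 t); last by rewrite Rintegral_wave cos0 mulr1; case: eqP.
  by apply: eq_Rintegral => t _; rewrite Re_zpow.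
transitivity (\int[mu]_(t in D) wave j (pi / 2) t).
  by apply: eq_Rintegral => t _; rewrite Im_zpow.
by rewrite Rintegral_wave cos_pihalf mulr0; case: eqP.
Qed.

Section FourierUniqueness.
Variable phi : R -> C.
Hypothesis Re_phi : Rintegrable (fun t => Re (phi t)).
Hypothesis Im_phi : Rintegrable (fun t => Im (phi t)).

Lemma Rintegrable_mul_cexpm j : Rintegrable (fun t => Re (phi t * cexpm j t)) /\
  Rintegrable (fun t => Im (phi t * cexpm j t)).
Proof.
have wave_i f (a : R) : Rintegrable f -> Rintegrable (fun t => f t * wave (- j) a t).
  move=> fi; apply: (RintegrableM_bounded mD fi (circle_measurable_wave _ _)) => t _.
  exact: normr_wave_le1.
split.
  apply: (eq_Rintegrable mD _ (RintegrableB mD (wave_i _ 0 Re_phi) (wave_i _ (pi / 2) Im_phi))).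
  by move=> t _; rewrite Re_mul -[j]opprK cexpmN Re_zpow Im_zpow opprK.
apply: (eq_Rintegrable mD _ (RintegrableD mD (wave_i _ (pi / 2) Re_phi) (wave_i _ 0 Im_phi))).
by move=> t _; rewrite Im_mul -[j]opprK cexpmN Re_zpow Im_zpow opprK.
Qed.

Hypothesis phi0 : forall j, cint (fun t => phi t * cexpm j t) = 0.

Lemma Re_fourier_unique : {ae mu, forall t, D t -> Re (phi t) = 0}.
Proof.
apply: fourier_unique => // j a.
pose p k t := Re (phi t * cexpm k t); pose q k t := Im (phi t * cexpm k t).
have p_i k : Rintegrable (p k) by case: (Rintegrable_mul_cexpm k).
have q_i k : Rintegrable (q k) by case: (Rintegrable_mul_cexpm k).
have p0 k : \int[mu]_(t in D) p k t = 0 by have [] := phi0 k.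
have q0 k : \int[mu]_(t in D) q k t = 0 by have [] := phi0 k.
transitivity (\int[mu]_(t in D)
    (cos a / 2 * (p j t + p (- j) t) + sin a / 2 * (q (- j) t - q j t))).
  apply: eq_Rintegral => t _; rewrite /p /q cexpmN -conjc_zpow !Re_mul !Im_mul.
  by rewrite Re_conjc Im_conjc /wave cosB /=; field.
have ps := RintegrableD mD (p_i j) (p_i (- j)).
have qs := RintegrableB mD (q_i (- j)) (q_i j).
rewrite (RintegralD mD (RintegrableZl mD _ ps) (RintegrableZl mD _ qs)).
rewrite (RintegralZl _ mD ps) (RintegralZl _ mD qs) (RintegralD mD (p_i _) (p_i _)).
by rewrite (RintegralB mD (q_i _) (q_i _)) !p0 !q0; ring.
Qed.

End FourierUniqueness.

Theorem complex_fourier_unique (phi : R -> C) :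
  Rintegrable (fun t => Re (phi t)) -> Rintegrable (fun t => Im (phi t)) ->
  (forall j, cint (fun t => phi t * cexpm j t) = 0) -> {ae mu, forall t, D t -> phi t = 0}.
Proof.
move=> Re_phi Im_phi phi0.
(* [psi] is ['i] times the conjugate of [phi]. *)
pose psi t : C := Complex (Im (phi t)) (Re (phi t)).
have psi0 j : cint (fun t => psi t * cexpm j t) = 0.
  have [re0 im0] := phi0 (- j); apply: complex_ext; [rewrite -[RHS]im0|rewrite -[RHS]re0].
    by apply: eq_Rintegral => t _; rewrite cexpmN Re_mul Im_mul /=; ring.
  by apply: eq_Rintegral => t _; rewrite cexpmN Re_mul Im_mul /=; ring.
have := Re_fourier_unique (phi := psi) Im_phi Re_phi psi0.
move=> /filterI/(_ (Re_fourier_unique Re_phi Im_phi phi0)).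
by apply: filterS => t [im0 re0] Dt; apply: complex_ext; [exact: re0|exact: im0].
Qed.

End Exponentials.

(** * Multiplication operators *)

Section Multiplication.
Variable R : realType.
Local Notation C := (R[i]).
Local Notation Re := (@complex.Re R).
Local Notation Im := (@complex.Im R).
Local Notation mu := (@lebesgue_measure R).
Local Notation D := (@Tdom R).
Local Notation mD := (@measurable_Tdom R).
Local Open Scope complex_scope.

Lemma mx_measurableM m n p (F : R -> 'M[C]_(m, n)) (G : R -> 'M[C]_(n, p)) :
  mx_measurable F -> mx_measurable G -> mx_measurable (fun t => F t *m G t).
Proof.
move=> mF mG i j; split.
  have -> : (fun t => Re ((F t *m G t) i j)) =
      fun t => \sum_k (Re (F t i k) * Re (G t k j) - Im (F t i k) * Im (G t k j)).
    by apply/funext => t; rewrite mxE raddf_sum; apply: eq_bigr => k _; rewrite [LHS]Re_mul.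
  apply: measurable_sum => k; have [? ?] := mF i k; have [? ?] := mG k j.
  by apply: measurable_funB; exact: measurable_funM.
have -> : (fun t => Im ((F t *m G t) i j)) =
    fun t => \sum_k (Re (F t i k) * Im (G t k j) + Im (F t i k) * Re (G t k j)).
  by apply/funext => t; rewrite mxE raddf_sum; apply: eq_bigr => k _; rewrite [LHS]Im_mul.
apply: measurable_sum => k; have [? ?] := mF i k; have [? ?] := mG k j.
by apply: measurable_funD; exact: measurable_funM.
Qed.

Lemma Linf_vnorm2_le m n (F : R -> 'M[C]_(m, n)) : Linf F -> exists K : R,
  {ae mu, forall t, D t -> forall v, vnorm2 (F t *m v) <= K * vnorm2 v}.
Proof.
move=> [_ [M FM]]; exists (\sum_(i < m) (2 ^+ size (index_enum 'I_n) * `|M|)).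
apply: filterS FM => t FtM Dt v; rewrite mulr_suml; apply: ler_sum => i _.
rewrite mxE; apply: le_trans (cabs2_sum_le _ _) _; rewrite -mulrA.
apply: ler_wpM2l; first by rewrite exprn_ge0.
rewrite mulr_sumr; apply: ler_sum => j _; rewrite cabs2M.
apply: ler_wpM2r; first exact: cabs2_ge0.
by apply: le_trans (FtM Dt i j) _; exact: ler_norm.
Qed.

Lemma L2_mul m n (F : R -> 'M[C]_(m, n)) (f : R -> 'cV[C]_n) :
  Linf F -> L2 f -> L2 (fun t => F t *m f t).
Proof.
move=> FL [mf fi]; have [K FK] := Linf_vnorm2_le FL.
have mFf := mx_measurableM FL.1 mf; split=> //.
apply: (ae_le_Rintegrable mD _ _ (RintegrableZl mD K fi)).
  apply: measurable_sum => i; have [mRe mIm] := mFf i 0.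
  by apply: measurable_funD; exact: measurable_funX.
by apply: filterS FK => t FtK Dt; rewrite ger0_norm ?vnorm2_ge0//; exact: FtK.
Qed.

Definition Mul m n (F : R -> 'M[C]_(m, n)) (FL : Linf F) (f : L2space R n) : L2space R m :=
  toL2 (L2_mul FL (L2fun_L2 f)).

Lemma MulE m n (F : R -> 'M[C]_(m, n)) (FL : Linf F) f t : Mul FL f t = F t *m f t.
Proof. by []. Qed.

Lemma Mul_is_linear m n (F : R -> 'M[C]_(m, n)) (FL : Linf F) : linear (Mul FL).
Proof.
move=> c f g; apply: L2space_ext => t.
by rewrite MulE !L2funD !L2funZ !MulE mulmxDr -scalemxAr.
Qed.

HB.instance Definition _ m n (F : R -> 'M[C]_(m, n)) (FL : Linf F) :=
  GRing.isLinear.Build C (L2space R n) (L2space R m) *:%R (Mul FL) (Mul_is_linear FL).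

Lemma Linf_adj m n (F : R -> 'M[C]_(m, n)) : Linf F -> Linf (adjfun F).
Proof.
move=> [mF [M FM]]; split.
  move=> i j; have [mRe mIm] := mF j i; split.
    by apply: eq_measurable_fun mRe => t _; rewrite !mxE Re_conjc.
  apply: (eq_measurable_fun (fun t => - Im (F t j i))) => [t _|].
    by rewrite !mxE Im_conjc.
  exact: measurable_funN mIm.
exists M; apply: filterS FM => t FtM Dt i j; apply: le_trans (FtM Dt j i).
by rewrite !mxE /cabs2 Re_conjc Im_conjc sqrrN.
Qed.

Lemma Mul_adj m n (F : R -> 'M[C]_(m, n)) (FL : Linf F) f g :
  ip (Mul FL f) g = ip f (Mul (Linf_adj FL) g).
Proof. by apply: eq_Rintegral => t _; exact: rdot_adj. Qed.

Lemma cform_Mul_adj m n (F : R -> 'M[C]_(m, n)) (FL : Linf F) f g :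
  cform (@ip R n) (Mul (Linf_adj FL) f) g = cform (@ip R m) f (Mul FL g).
Proof.
have ipE h : ip (Mul (Linf_adj FL) f) h = ip f (Mul FL h).
  by rewrite (siC (@ip_semi_inner R n)) -Mul_adj (siC (@ip_semi_inner R m)).
by rewrite /cform !ipE [Mul FL ('i *: g)]linearZ.
Qed.

Definition ae_isometric m n (F : R -> 'M[C]_(m, n)) :=
  {ae mu, forall t, D t -> adjmx (F t) *m F t = 1%:M}.

Lemma normsq_Mul_isometric m n (F : R -> 'M[C]_(m, n)) (FL : Linf F) f : ae_isometric F ->
  normsq (@ip R m) (Mul FL f) = normsq (@ip R n) f.
Proof.
move=> F_iso; rewrite !normsq_ip; apply: (ae_eq_Rintegral mD).
- exact: (Rintegrable_measurable (L2fun_L2 (Mul FL f)).2).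
- exact: (Rintegrable_measurable (L2fun_L2 f).2).
apply: filterS F_iso => t Ft_iso Dt.
by rewrite -!rdotxx MulE rdot_adj mulmxA Ft_iso// mul1mx.
Qed.

Section Shift.
Variable n : nat.
Local Notation V := (L2space R n).
Local Notation ip := (@ip R n).

Lemma Linf_zpow j : Linf (fun t => (zpow j t)%:M : 'M[C]_n).
Proof.
split=> [i l|]; last first.
  exists 1; apply: aeW => t Dt i l; rewrite mxE; case: (i == l).
    by rewrite mulr1n cabs2_zpow.
  by rewrite mulr0n /cabs2 /= expr0n addr0.
have [<-|il] := eqVneq i l.
  split; under eq_fun do rewrite mxE eqxx ?Re_zpow ?Im_zpow; exact: circle_measurable_wave.
by split; under eq_fun do rewrite mxE (negbTE il); exact: measurable_cst.
Qed.

Definition zmul (j : int) : {linear V -> V} := Mul (Linf_zpow j).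

Lemma zmulE j (f : V) t : zmul j f t = zpow j t *: f t.
Proof. by rewrite MulE mul_scalar_mx. Qed.

Lemma Mul_zmul F (FL : Linf F) j f : Mul FL (zmul j f) = zmul j (Mul FL f).
Proof. by apply: L2space_ext => t; rewrite zmulE !MulE mul_scalar_mx -scalemxAr. Qed.

Lemma L2_cst (v : 'cV[C]_n) : L2 (fun=> v).
Proof.
apply/L2_rcoord => p; split; first exact: measurable_cst.
exact: Rintegrable_Tdom_cst.
Qed.

Definition zbasis j i : V := zmul j (toL2 (L2_cst (delta_mx i 0))).

Lemma zbasisE j i t : zbasis j i t = zpow j t *: delta_mx i 0.
Proof. by rewrite zmulE. Qed.

Lemma hdot_zbasis (f : V) j i t : hdot (f t) (zbasis j i t) = f t i 0 * cexpm j t.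
Proof. by rewrite zbasisE hdotZr hdot_delta mulrC. Qed.

Lemma fcoefE (f : V) j i : fcoef ip zbasis f j i = cint (fun t => f t i 0 * cexpm j t).
Proof. by rewrite /fcoef cform_ip; congr cint; apply/funext => t; exact: hdot_zbasis. Qed.

Lemma zbasis_orthonormal j i k l : cform ip (zbasis j i) (zbasis k l) = ((j == k) && (i == l))%:R.
Proof.
rewrite -/(fcoef ip zbasis (zbasis j i) k l) fcoefE -[in RHS]subr_eq0.
have -> : (fun t => zbasis j i t l 0 * cexpm k t) = fun t => (i == l)%:R * zpow (j - k) t.
  apply/funext => t; rewrite zbasisE !mxE eqxx andbT eq_sym zpowD -[zpow (- k) t]cexpmN opprK.
  by rewrite mulrCA mulrA.
case: (i == l); last first.
  under eq_fun do rewrite mul0r.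
  by rewrite andbF; apply: complex_ext; exact: (Rintegral0 mu mD).
by under eq_fun do rewrite mul1r; rewrite cint_zpow andbT.
Qed.

Lemma zbasis_total (f : V) : (forall j i, cform ip f (zbasis j i) = 0) -> normsq ip f = 0.
Proof.
move=> f0; have sq_cst : sqintegrable mu D (fun=> 1).
  by split; [exact: measurable_cst|exact: Rintegrable_Tdom_cst].
have coord_i p : Rintegrable mu D (fun t => rcoord (f t) p).
  apply: (eq_Rintegrable mD _ (sqintegrableM mD (sqintegrable_rcoord f p) sq_cst)) => t _.
  by rewrite mulr1.
have f_ae i : {ae mu, forall t, D t -> f t i 0 = 0}.
  apply: complex_fourier_unique (coord_i (i, false)) (coord_i (i, true)) _ => j.
  by rewrite -fcoefE; exact: f0.
rewrite normsq_ip_rcoord big1// => p _; rewrite -(Rintegral0 mu mD).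
have [mf _] := sqintegrable_rcoord f p.
apply: (ae_eq_Rintegral mD); [exact: measurable_funX|exact: measurable_cst|].
by apply: filterS (f_ae p.1) => t ft0 Dt; rewrite /rcoord ft0//; case: p.2; rewrite /= expr0n.
Qed.

Theorem zmul_bilateral_shift : bilateral_shift ip zmul zbasis.
Proof.
split.
- exact: ip_semi_inner.
- exact: ip_complete.
- by move=> j k f; apply: L2space_ext => t; rewrite !zmulE scalerA zpowD.
- by move=> f; apply: L2space_ext => t; rewrite zmulE zpow0 scale1r.
- move=> j f g; apply: eq_Rintegral => t _; rewrite !zmulE.
  exact: rdot_unimodular (cabs2_zpow _ _).
- by move=> k j i; apply: L2space_ext => t; rewrite zmulE !zbasisE scalerA zpowD.
- exact: zbasis_orthonormal.
- exact: zbasis_total.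
Qed.

End Shift.
End Multiplication.


(** * Hankel operators *)

Section HankelOperators.
Variables (R : realType) (n : nat).
Local Notation C := (R[i]).
Local Notation V := (L2space R n).
Local Notation ip := (@ip R n).
Local Notation zbasis := (@zbasis R n).
Local Notation analytic := (analytic ip zbasis).
Local Notation coanalytic := (coanalytic ip zbasis).
Local Open Scope complex_scope.
Let bze := zmul_bilateral_shift R n.
Let bP := @ip_semi_inner R n.

Lemma fcoef_vanish_fourier (S : int -> Prop) (f : V) :
  fcoef_vanish ip zbasis S f <-> forall j, S j -> fourier f j = 0.
Proof.
split=> [fS j Sj|f0 j Sj i].
  by apply/matrixP => i k; rewrite ord1 !mxE -fcoefE fS.
by have /matrixP/(_ i 0) := f0 j Sj; rewrite !mxE -fcoefE.
Qed.

Lemma H2_analytic (f : V) : H2 f <-> analytic f.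
Proof.
by rewrite /analytic fcoef_vanish_fourier; split=> [[]//|]; split=> //; exact: L2fun_L2.
Qed.

Lemma H2minus_coanalytic (f : V) : H2minus f <-> coanalytic f.
Proof.
by rewrite /coanalytic fcoef_vanish_fourier; split=> [[]//|]; split=> //; exact: L2fun_L2.
Qed.

Lemma l2norm_le (f : V) (c : R) : 0 <= c -> (l2norm f <= c) = (normsq ip f <= c ^+ 2).
Proof.
by move=> c0; rewrite /l2norm -normsq_ip -{1}(ger0_norm c0) -sqrtr_sqr ler_sqrt// sqr_ge0.
Qed.

Lemma l2norm_le1 (f : V) : (l2norm f <= 1) = (normsq ip f <= 1).
Proof. by rewrite l2norm_le// expr1n. Qed.

Section HankelNorm.
Variable F : R -> 'M[C]_n.
Hypothesis FL : Linf F.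
Local Notation hankel_op := (hankel_op ip zbasis (Mul FL)).

Lemma hankel_hankel_op (f : V) : hankel F f (hankel_op f).
Proof.
split; first by apply/H2minus_coanalytic; exact: (coanalytic_Pm bze _).
have -> : (fun t => F t *m f t - hankel_op f t) = L2fun (Mul FL f - hankel_op f).
  by apply/funext => t; rewrite L2funB MulE.
by apply/H2_analytic; exact: (analytic_Pp bze (Mul FL f)).
Qed.

Lemma hankel_null_eqv (f h : V) : hankel F f h -> null_eqv ip (hankel_op f) h.
Proof.
move=> [/H2minus_coanalytic hm hp]; apply: (Pm_unique bze hm); apply/H2_analytic.
suff -> : L2fun (Mul FL f - h) = fun t => F t *m f t - h t by [].
by apply/funext => t; rewrite L2funB MulE.
Qed.

Lemma hankel_norm_le (c : R) : 0 <= c ->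
  (forall f, analytic f -> normsq ip (hankel_op f) <= c ^+ 2 * normsq ip f) ->
  (hankel_norm F <= c%:E)%E.
Proof.
move=> c0 F_le; apply: ge_ereal_sup => _ [f [h [fH f1 Ffh ->]]]; rewrite lee_fin.
have [fL _] := fH; have [[hL _] _] := Ffh.
have -> : (fun t => h t - (0 : R -> 'cV[C]_n) t) = toL2 hL.
  by apply/funext => t; rewrite /= subr0.
rewrite l2norm_le// -(null_eqv_normsq bP (@hankel_null_eqv (toL2 fL) (toL2 hL) Ffh)).
have f_analytic : analytic (toL2 fL) by apply/H2_analytic.
apply: le_trans (F_le _ f_analytic) _; rewrite ler_piMr ?sqr_ge0//.
by rewrite -l2norm_le1.
Qed.

Lemma hankel_minus_norm_le (K0 : (R -> 'cV[C]_n) -> R -> 'cV[C]_n) (K : V -> V) (c : R) : 0 <= c ->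
  (forall f, analytic f -> K0 f = K f) ->
  (forall (r : R) f, analytic f -> K (r%:C *: f) = r%:C *: K f) ->
  (hankel_minus_norm F K0 <= c%:E)%E ->
  forall f, analytic f -> normsq ip (hankel_op f - K f) <= c ^+ 2 * normsq ip f.
Proof.
move=> c0 K0E KZ F_le f fp.
apply: (le_normsq_of_unit_ball bP (H := analytic)
  (G := fun f => normsq ip (hankel_op f - K f))) fp => [r {}f fp|r {}f fp|{}f fp f1].
- exact: (fcoef_vanishZ bze _ fp).
- transitivity (normsq ip (r%:C *: (hankel_op f - K f))); last exact: (normsqZ bP).
  apply: (null_eqv_normsq bP); rewrite /null_eqv KZ// scalerBr opprB addrA subrK.
  exact: (hankel_opZ _ bze).
rewrite -l2norm_le// -lee_fin; apply: le_trans F_le; apply: ereal_sup_ubound.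
exists f, (hankel_op f); split.
- exact/H2_analytic.
- by rewrite l2norm_le1.
- exact: hankel_hankel_op.
- by rewrite K0E.
Qed.

Lemma hankel_contraction_of_norm_le1 : (hankel_norm F <= 1%:E)%E ->
  hankel_contraction ip zbasis (Mul FL).
Proof.
move=> F_le f fp; have := hankel_minus_norm_le (K := fun=> 0) ler01 _ _ F_le fp.
rewrite expr1n mul1r subr0; apply=> [g _|r g _]; first by [].
by rewrite scaler0.
Qed.

Definition L2_or0 (g : R -> 'cV[C]_n) : V :=
  if pselect (L2 g) is left gL then toL2 gL else 0.

Lemma L2_or0E g : L2 g -> L2_or0 g = g :> (R -> 'cV[C]_n).
Proof. by rewrite /L2_or0; case: pselect. Qed.

Lemma L2_or0_compact K (f : V) : compact_op K -> analytic f ->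
  L2_or0 (K f) = K f :> (R -> 'cV[C]_n).
Proof.
move=> [K_H2 _] fp; apply: L2_or0E.
by have [] := K_H2 f ((H2_analytic f).2 fp).
Qed.

Lemma compact_on_L2_or0 K : compact_op K -> compact_on ip analytic (fun f => L2_or0 (K f)).
Proof.
move=> K_compact; have [_ [K_lin K_net]] := K_compact; split=> [c f g fp gp|r r0].
  have cfgp : analytic (c *: f + g) by exact: (fcoef_vanish_lin bze).
  apply: L2space_ext => t; rewrite L2funD L2funZ !L2_or0_compact//.
  by have /= -> := K_lin c f g ((H2_analytic f).2 fp) ((H2_analytic g).2 gp).
have r1 : 0 < Num.sqrt r by rewrite sqrtr_gt0.
have [s [sL Ks]] := K_net _ r1; exists [seq L2_or0 g | g <- s] => f fp f1.
have [||g gs gP] := Ks f; [exact/H2_analytic|by rewrite l2norm_le1|].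
exists (L2_or0 g); first exact: map_f.
move: gP; have -> : (fun t => K f t - g t) = (L2_or0 (K f) - L2_or0 g : V).
  by apply/funext => t; rewrite L2funB L2_or0_compact// L2_or0E//; exact: sL.
by rewrite /l2norm -normsq_ip ltr_sqrt.
Qed.

Lemma hankel_near_compact : (hankel_ess_norm F < 1%:E)%E ->
  exists K q, [/\ compact_on ip analytic K, 0 <= q < 1 &
    forall f, analytic f -> normsq ip (hankel_op f - K f) <= q * normsq ip f].
Proof.
move=> /ereal_inf_lt[_ [K [K_compact ->]] K_lt1].
have [c [c0 c1 K_le]] : exists c : R, [/\ 0 <= c, c < 1 & (hankel_minus_norm F K <= c%:E)%E].
  case: (hankel_minus_norm F K) K_lt1 => [r| |] //; rewrite ?lte_fin => r1.
    by exists (Num.max r 0); rewrite gt_max r1 ltr01 lee_fin !le_max !lexx orbT.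
  by exists 0; rewrite lexx ltr01 leNye.
have K'_compact := compact_on_L2_or0 K_compact.
exists (fun f : V => L2_or0 (K f)), (c ^+ 2); split=> //; first by rewrite sqr_ge0 expr_lt1.
apply: (hankel_minus_norm_le c0 _ _ K_le) => [f fp|r f fp]; first by rewrite L2_or0_compact.
exact: (compactZ bze K'_compact).
Qed.

End HankelNorm.

Lemma hankel_ess_norm_le (F : R -> 'M[C]_n) : (hankel_ess_norm F <= hankel_norm F)%E.
Proof.
apply: ereal_inf_lbound; exists (fun _ _ => 0); split=> //.
have zL := L2fun_L2 (0 : V).
split=> [f _|]; first by apply/(H2minus_coanalytic 0); exact: (fcoef_vanish0 bze).
split=> [a f g _ _|r r0]; first by apply/funext => t; rewrite scaler0 addr0.
exists [:: L2fun (0 : V)]; split=> [g|f _ _]; first by rewrite inE => /eqP ->.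
exists (L2fun (0 : V)); first by rewrite inE.
have -> : (fun t : R => 0 - L2fun (0 : V) t) = L2fun (0 : V) by apply/funext => t; rewrite subr0.
by rewrite /l2norm -normsq_ip (si0l bP) sqrtr0.
Qed.

End HankelOperators.

(** * Unitary interpolants *)

Section FourierOfProducts.
Variables (R : realType) (n : nat).
Local Notation C := (R[i]).
Local Notation V := (L2space R n).
Local Notation ip := (@ip R n).
Local Notation zmul := (@zmul R n).
Local Notation zbasis := (@zbasis R n).
Local Notation mu := (@lebesgue_measure R).
Local Notation D := (@Tdom R).
Local Notation mD := (@measurable_Tdom R).
Local Open Scope complex_scope.
Let bze := zmul_bilateral_shift R n.

Lemma fourier_Mul (F : R -> 'M[C]_n) (FL : Linf F) j l i :
  fourier F j l i = fcoef ip zbasis (Mul FL (zbasis 0 i)) j l.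
Proof.
rewrite mxE fcoefE; congr cint; apply/funext => t.
by rewrite MulE zbasisE zpow0 scale1r -colE mxE.
Qed.

Lemma fcoef_Mul_zbasis (F : R -> 'M[C]_n) (FL : Linf F) j k l i :
  fcoef ip zbasis (Mul FL (zbasis k i)) j l = fourier F (j - k) l i.
Proof.
by rewrite -[k in LHS]addr0 -(shift_basis bze) Mul_zmul (fcoef_shift bze) -fourier_Mul.
Qed.

Lemma fcoef_Mul_adj_zbasis (F : R -> 'M[C]_n) (FL : Linf F) j k l i :
  fcoef ip zbasis (Mul (Linf_adj FL) (zbasis k i)) j l = (fourier F (k - j) i l)^*.
Proof.
rewrite /fcoef cform_Mul_adj (cformC (shift_form bze)) -fcoef_Mul_zbasis.
by [].
Qed.

Lemma cint_hdotB (f g f' g' : V) :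
  cint (fun t => hdot (f t) (g t) - hdot (f' t) (g' t)) = cform ip f g - cform ip f' g'.
Proof.
have ipB (h h' : V) : \int[mu]_(t in D) (rdot (f t) (h t) - rdot (f' t) (h' t)) =
    ip f h - ip f' h' by exact: (RintegralB mD (Rintegrable_rdot _ _) (Rintegrable_rdot _ _)).
apply: complex_ext; rewrite raddfB /= -ipB; apply: eq_Rintegral => t _; rewrite raddfB.
  by congr (_ - _); exact: Re_hdot.
by congr (_ - _); exact: Im_hdot.
Qed.

Lemma hdot_fourier_unique (f g f' g' : V) :
  (forall j, cform ip (zmul j f) g = cform ip (zmul j f') g') ->
  {ae mu, forall t, D t -> hdot (f t) (g t) = hdot (f' t) (g' t)}.
Proof.
move=> fg; suff : {ae mu, forall t, D t -> hdot (f t) (g t) - hdot (f' t) (g' t) = 0}.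
  by apply: filterS => t fg0 /fg0/eqP; rewrite subr_eq0 => /eqP.
have rdotB_i (h h' : V) : Rintegrable mu D (fun t => rdot (f t) (h t) - rdot (f' t) (h' t)).
  exact: (RintegrableB mD (Rintegrable_rdot f h) (Rintegrable_rdot f' h')).
apply: complex_fourier_unique => [||j].
- by apply: (eq_Rintegrable mD _ (rdotB_i g g')) => t _; rewrite raddfB -!Re_hdot.
- apply: (eq_Rintegrable mD _ (rdotB_i ('i *: g) ('i *: g'))) => t _.
  by rewrite raddfB -!Im_hdot.
transitivity (cform ip (zmul (- j) f) g - cform ip (zmul (- j) f') g'); last first.
  by rewrite fg subrr.
rewrite -cint_hdotB; congr cint; apply/funext => t.
by rewrite !zmulE !hdotZl -mulrBr mulrC -[zpow (- j) t]cexpmN opprK.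
Qed.

End FourierOfProducts.

Section ColumnFunction.
Variables (R : realType) (n : nat).
Local Notation C := (R[i]).
Local Notation V := (L2space R n).
Local Notation ip := (@ip R n).
Local Notation zmul := (@zmul R n).
Local Notation zbasis := (@zbasis R n).
Local Notation mu := (@lebesgue_measure R).
Local Notation D := (@Tdom R).
Let bze := zmul_bilateral_shift R n.

Definition colfun (u : 'I_n -> V) (t : R) : 'M[C]_n := \matrix_(r, c) u c t r 0.

Lemma colfun_delta u t i : colfun u t *m (delta_mx i 0 : 'cV[C]_n) = u i t.
Proof. by rewrite -colE; apply/matrixP => r c; rewrite !mxE ord1. Qed.

Lemma adj_colfun_mul u t l i : (adjmx (colfun u t) *m colfun u t) l i = hdot (u i t) (u l t).
Proof. by rewrite mxE hdotE; apply: eq_bigr => r _; rewrite !mxE mulrC. Qed.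

Variable u : 'I_n -> V.
Hypothesis u_orthonormal : orthonormal_columns ip zmul zbasis u.

Lemma colfun_unitary : ae_isometric (colfun u).
Proof.
have u_hdot (il : 'I_n * 'I_n) : {ae mu, forall t, D t ->
    hdot (u il.1 t) (u il.2 t) = hdot (zbasis 0 il.1 t) (zbasis 0 il.2 t)}.
  apply: hdot_fourier_unique => -[k|k]; first by rewrite (shift_basis bze) addr0.
  by rewrite NegzE !(cform_shiftN bze k.+1) (shift_basis bze) addr0 u_orthonormal.
have u_ae : {ae mu, forall t (il : 'I_n * 'I_n), D t ->
    hdot (u il.1 t) (u il.2 t) = hdot (zbasis 0 il.1 t) (zbasis 0 il.2 t)}.
  exact: filter_forall.
apply: filterS u_ae => t ut Dt; apply/matrixP => l i.
rewrite adj_colfun_mul (ut (i, l) Dt) !zbasisE zpow0 !scale1r hdot_delta !mxE.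
by rewrite andbT eq_sym.
Qed.

Lemma colfun_Linf : Linf (colfun u).
Proof.
split=> [r c|].
  have [mu_c _] := L2fun_L2 (u c); have [mRe mIm] := mu_c r 0.
  by split; under eq_fun do rewrite mxE.
exists 1; apply: filterS colfun_unitary => t Ut Dt r c.
have <- : vnorm2 (u c t) = 1.
  rewrite -rdotxx -Re_hdot -adj_colfun_mul Ut// mxE eqxx.
  by [].
by rewrite mxE; exact: cabs2_le_vnorm2.
Qed.

Lemma Mul_colfun_zbasis k i : Mul colfun_Linf (zbasis k i) = zmul k (u i).
Proof. by apply: L2space_ext => t; rewrite MulE zmulE zbasisE -scalemxAr colfun_delta. Qed.

End ColumnFunction.

Section UnitaryInterpolants.
Variables (R : realType) (n : nat).
Local Notation C := (R[i]).
Local Notation V := (L2space R n).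
Local Notation ip := (@ip R n).
Local Notation zmul := (@zmul R n).
Local Notation zbasis := (@zbasis R n).
Local Notation analytic := (analytic ip zbasis).
Local Notation coanalytic := (coanalytic ip zbasis).
Local Notation Pm := (Pm ip zbasis).
Local Notation Pp := (Pp ip zbasis).
Local Open Scope complex_scope.
Let bze := zmul_bilateral_shift R n.
Let bP := @ip_semi_inner R n.

Lemma ae_isometric_adj (U : R -> 'M[C]_n) : ae_isometric U -> ae_isometric (adjfun U).
Proof. by apply: filterS => t Ut Dt; rewrite /adjfun adjmxK; apply: mulmx1C; exact: Ut. Qed.

(* For a unitary function [U] the two Hardy projections of [U f] share the norm of [f], so that a
   lower bound for one of them is an upper bound below 1 for the other. *)
Lemma unitary_hankel_ess_norm_lt1 (U : R -> 'M[C]_n) (UL : Linf U) (K : R) : ae_isometric U ->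
  0 <= K -> (forall f, analytic f -> normsq ip f <= K * normsq ip (Pp (Mul UL f))) ->
  (hankel_ess_norm U < 1%:E)%E.
Proof.
move=> U_unitary K0 U_ge; pose q := K / (K + 1).
have K1 : 0 < K + 1 by lra.
have q0 : 0 <= q by rewrite divr_ge0// ltW.
have q1 : q < 1 by rewrite ltr_pdivrMr// mul1r ltrDl.
apply: le_lt_trans (hankel_ess_norm_le _) _.
apply: (@le_lt_trans _ _ (Num.sqrt q)%:E); last by rewrite lte_fin -sqrtr1 ltr_sqrt.
apply: (hankel_norm_le (FL := UL)) => [|f fp]; first exact: sqrtr_ge0.
have f_split := form_PmPp bze (Mul UL f) (Mul UL f).
rewrite (normsq_Mul_isometric UL f U_unitary) in f_split.
have := U_ge f fp; have := si_ge0 bP (Pp (Mul UL f)).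
rewrite sqr_sqrtr// /q mulrAC ler_pdivlMr// f_split /hankel_op.
by move: (normsq ip (Pm _)) (normsq ip (Pp _)) => m p; lra.
Qed.

Lemma adj_hankel_ess_norm_lt1 (u : 'I_n -> V)
    (u_orthonormal : orthonormal_columns ip zmul zbasis u) :
  columns_bounded_below ip zmul zbasis u -> (hankel_ess_norm (adjfun (colfun u)) < 1%:E)%E.
Proof.
move=> [K K0 uK]; pose UL := colfun_Linf u_orthonormal.
have U_unitary := colfun_unitary u_orthonormal.
apply: (unitary_hankel_ess_norm_lt1 (UL := Linf_adj UL)) K0 _ => [|f fp].
  exact: ae_isometric_adj.
have [v [vp f_le vE]] := uK f fp.
suff /(null_eqv_normsq bP) -> : null_eqv ip (Pp (Mul (Linf_adj UL) f)) v by [].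
apply: (Pp_unique bze vp) => -[k|//] _ i.
by rewrite (fcoefB bze) vE -(Mul_colfun_zbasis u_orthonormal) -cform_Mul_adj subrr.
Qed.

Lemma interpolant_diff_analytic (Phi U : R -> 'M[C]_n) (PhiL : Linf Phi) (UL : Linf U) :
  (forall j : int, j < 0 -> fourier U j = fourier Phi j) ->
  forall f, analytic f -> analytic (Mul PhiL f - Mul UL f).
Proof.
move=> UPhi f fp j j0 i.
have adj_coanalytic :
    coanalytic (Mul (Linf_adj PhiL) (zbasis j i) - Mul (Linf_adj UL) (zbasis j i)).
  by move=> k k0 l; rewrite (fcoefB bze) !fcoef_Mul_adj_zbasis UPhi ?subrr//; lia.
have adjE h : ip (Mul PhiL f - Mul UL f) h =
    ip f (Mul (Linf_adj PhiL) h - Mul (Linf_adj UL) h).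
  by rewrite (siBl bP) !Mul_adj (siBr bP).
apply/cform_eq0; rewrite !adjE; split; first exact: (analytic_orth bze).
rewrite [Mul _ ('i *: _)]linearZ [X in _ - X]linearZ -scalerBr.
by apply: (analytic_orth bze) => //; exact: (fcoef_vanishZ bze).
Qed.

Lemma unitary_interpolant_hankel_norm (Phi U : R -> 'M[C]_n) : Linf Phi ->
  unitary_interpolant Phi U -> (hankel_norm Phi <= 1%:E)%E.
Proof.
move=> PhiL [UL U_unitary UPhi]; apply: (hankel_norm_le (FL := PhiL)) => // f fp.
have /(null_eqv_normsq bP) -> :
    null_eqv ip (hankel_op ip zbasis (Mul PhiL) f) (hankel_op ip zbasis (Mul UL) f).
  apply: (Pm_unique bze); first exact: (coanalytic_Pm bze _).
  have -> : Mul PhiL f - Pm (Mul UL f) = (Mul PhiL f - Mul UL f) + Pp (Mul UL f).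
    by rewrite PmE opprB addrA addrAC.
  by apply: (fcoef_vanishD bze); [exact: interpolant_diff_analytic|exact: (analytic_Pp bze _)].
rewrite expr1n mul1r -(normsq_Mul_isometric UL f U_unitary).
exact: (normsq_Pm_le bze _).
Qed.

Lemma exists_unitary_interpolant (Phi : R -> 'M[C]_n) : Linf Phi ->
  (hankel_ess_norm Phi < 1%:E)%E -> (hankel_norm Phi <= 1%:E)%E ->
  exists U, unitary_interpolant Phi U /\ (hankel_ess_norm (adjfun U) < 1%:E)%E.
Proof.
move=> PhiL Phi_ess Phi_norm.
have contr := hankel_contraction_of_norm_le1 PhiL Phi_norm.
have [K [q [K_compact q01 near]]] := hankel_near_compact PhiL Phi_ess.
have [u [u_orthonormal u_coef u_lower]] := exists_interpolating_columns bze
  (Mul_adj PhiL) (Mul_zmul PhiL 1) contr K_compact q01 near.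
exists (colfun u); split; last exact: adj_hankel_ess_norm_lt1.
split; [exact: colfun_Linf|exact: colfun_unitary|move=> j j0; apply/matrixP => l i].
rewrite (fourier_Mul (colfun_Linf u_orthonormal)) (fourier_Mul PhiL) Mul_colfun_zbasis.
by rewrite (shift0 bze) u_coef.
Qed.

End UnitaryInterpolants.

Theorem theorem3p1 (R : realType) (n : nat) (Phi : R -> 'M[R[i]]_n) :
  Linf Phi -> (hankel_ess_norm Phi < 1%:E)%E ->
  ((exists U : R -> 'M[R[i]]_n,
      unitary_interpolant Phi U /\ (hankel_ess_norm (adjfun U) < 1%:E)%E)
   <-> (hankel_norm Phi <= 1%:E)%E).
Proof.
move=> PhiL Phi_ess; split=> [[U [U_interpolant _]]|Phi_norm].
  exact: unitary_interpolant_hankel_norm U_interpolant.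
exact: exists_unitary_interpolant.
Qed.
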